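(* Let $\gamma_L,\gamma_R,\alpha_L,\alpha_R,b\in\mathbb{R}$ and consider the planar piecewise linear system $$\begin{cases}\dot x=2\gamma_L x-y-b,\\ \dot y=(1+\gamma_L^2)x-\alpha_L,\end{cases}\ \text{if } x\le 0,\qquad \begin{cases}\dot x=2\gamma_R x-y+b,\\ \dot y=(1+\gamma_R^2)x-\alpha_R,\end{cases}\ \text{if } x>0.$$ Put $x_\Lambda=\alpha_\Lambda/(1+\gamma_\Lambda^2)$ for $\Lambda\in\{L,R\}$, $y_L=2\gamma_Lx_L-b$ and $y_R=2\gamma_Rx_R+b$. There exists a period annulus at infinity if and only if we are in one of the three following cases. (a) $\gamma_L=\gamma_R=0$ and $b=0$. Then also $y_L=y_R=0$, and the phase plane is the result of matching two linear centers, both symmetric with respect to the $x$-axis, located at the points $(x_L,0)$ and $(x_R,0)$, which can be real or virtual equilibria. Moreover, the system is reversible, and if at least one of these equilibrium points is virtual then the center is global. (b) $\gamma_L=-\gamma_R\ne0$, $x_L=x_R=0$ and $b=0$. Then also $y_L=y_R=0$, and the origin is a boundary focus from both sides, constituting a reversible global nonlinear center. (c) $\gamma_L=-\gamma_R\ne0$, $x_L=-x_R\ne0$ and $b=0$. Then also $y_L=y_R\ne0$, so that there are two real equilibria when $x_L<0<x_R$ and two virtual ones when $x_R<0<x_L$. The phase plane exhibits a reversible nonlinear center at infinity. This center is not global when there are real equilibria: the period annulus at infinity then ends in a heart-shaped homoclinic orbit to a pseudo-saddle at the origin, which contains the two foci in its interior. In the case of virtual equilibria, the origin behaves as a global nonlinear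 center.
   Context: On $\Sigma=\{x=0\}$ the system is understood with the Filippov convention; orbits far from the origin cross $\Sigma$ and, when $b=0$, all points of $\Sigma$ other than the origin are crossing points. The points $(x_L,y_L)$ and $(x_R,y_R)$ are the equilibria of the left and right linear systems, with eigenvalues $\gamma_L\pm i$ and $\gamma_R\pm i$. The left (right) equilibrium is real if $x_L<0$ ($x_R>0$), boundary if $x_L=0$ ($x_R=0$), and virtual if $x_L>0$ ($x_R<0$). There is a period annulus (center) at infinity if all orbits passing sufficiently far from the origin are (crossing) periodic orbits. The center is global if the whole plane, except for one point (the center point), is filled with periodic orbits. Reversible means time-reversible: invariant under $(x,y,\tau)\mapsto(x,-y,-\tau)$ (in case (a)) or under $(x,y,\tau)\mapsto(-x,y,-\tau)$ (in cases (b), (c)), where $\tau$ is time. A pseudo-saddle at the origin is a point of $\Sigma$ where a visible tangency of the left system and a visible tangency of the right system coincide (a tangency is visible if the orbit of the corresponding linear system through it locally stays in the corresponding half-plane); a homoclinic orbit to it is a closed curve formed by orbit arcs of the system leaving and returning to this point. *)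

(* Defs.v *)
From HB Require Import structures.
From mathcomp Require Import all_boot all_order all_algebra.
From mathcomp Require Import all_classical all_reals all_analysis.
From mathcomp Require Import complex.
Import Order.TTheory GRing.Theory Num.Theory.
Import numFieldNormedType.Exports.
Set Implicit Arguments.
Unset Strict Implicit.
Unset Printing Implicit Defensive.
Local Open Scope classical_set_scope.
Local Open Scope ring_scope.

(* Points and vectors of the plane are pairs; Sigma is the line p.1 = 0.      *)

Definition affine_field {R : realType} (gamma alpha beta : R) (p : R * R) :
  R * R := (2 * gamma * p.1 - p.2 + beta, (1 + gamma ^+ 2) * p.1 - alpha).

(* On Sigma the velocity may be any convex combination of the two fields;     *)
(* this is insensitive to which side the line Sigma itself is assigned to.    *)
Definition filippov {R : realType} (fL fR : R * R -> R * R) (p : R * R) :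
  set (R * R) :=
  [set v | [\/ p.1 < 0 /\ v = fL p, 0 < p.1 /\ v = fR p |
    p.1 = 0 /\ exists2 s : R, 0 <= s <= 1 & v = s *: fL p + (1 - s) *: fR p]].

(* X is absolutely continuous on the compact subintervals of the interval I   *)
(* (written as: X is the indefinite integral of an integrable velocity v) and *)
(* v t lies in F (X t) for almost every t in I.                               *)
Definition filippov_solution {R : realType} (F : R * R -> set (R * R))
    (I : set R) (X : R -> R * R) : Prop :=
  exists v : R -> R * R,
    (forall s t : R, s <= t -> `[s, t] `<=` I ->
      [/\ (@lebesgue_measure R).-integrable `[s, t] (fun u => (v u).1%:E),
          (@lebesgue_measure R).-integrable `[s, t] (fun u => (v u).2%:E),
          (X t).1 - (X s).1
            = \int[@lebesgue_measure R]_(u in `[s, t]) (v u).1 &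
          (X t).2 - (X s).2
            = \int[@lebesgue_measure R]_(u in `[s, t]) (v u).2]) /\
    {ae @lebesgue_measure R, forall t, I t -> F (X t) (v t)}.

Definition crossing_point {R : realType} (fL fR : R * R -> R * R)
    (p : R * R) : Prop := p.1 = 0 /\ 0 < (fL p).1 * (fR p).1.

Definition periodic_orbit {R : realType} (X : R -> R * R) : Prop :=
  (exists2 T : R, 0 < T & forall t, X (t + T) = X t) /\
  exists t, X t <> X 0.

Definition crossing_periodic_orbit {R : realType} (fL fR : R * R -> R * R)
    (X : R -> R * R) : Prop :=
  [/\ periodic_orbit X,
      exists t, (X t).1 = 0 &
      forall t, (X t).1 = 0 -> crossing_point fL fR (X t)].

(* Filippov solutions need not be unique: there must be an orbit through p    *)
(* and all the orbits through p must satisfy Q.                               *)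
Definition orbit_through {R : realType} (F : R * R -> set (R * R))
    (Q : (R -> R * R) -> Prop) (p : R * R) : Prop :=
  (exists2 X : R -> R * R, filippov_solution F setT X & X 0 = p) /\
  (forall X : R -> R * R, filippov_solution F setT X -> X 0 = p -> Q X).

Definition crossing_periodic_set {R : realType} (fL fR : R * R -> R * R) :
  set (R * R) :=
  orbit_through (filippov fL fR) (crossing_periodic_orbit fL fR).

Definition has_period_annulus_at_infinity {R : realType}
    (fL fR : R * R -> R * R) : Prop :=
  exists r : R, forall p : R * R, r < `|p| -> crossing_periodic_set fL fR p.

(* The maximal period annulus at infinity: the connected component of the     *)
(* set of points on crossing periodic orbits that contains all far points.    *)
Definition period_annulus_at_infinity {R : realType}
    (fL fR : R * R -> R * R) : set (R * R) :=
  [set p | exists r : R, forall q : R * R, r < `|q| ->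
    connected_component (crossing_periodic_set fL fR) p q].

Definition global_center_at {R : realType} (F : R * R -> set (R * R))
    (c : R * R) : Prop :=
  forall p : R * R, orbit_through F periodic_orbit p <-> p <> c.

Definition global_center {R : realType} (F : R * R -> set (R * R)) : Prop :=
  exists c : R * R, global_center_at F c.

Definition flip_y {R : realType} (p : R * R) : R * R := (p.1, - p.2).
Definition flip_x {R : realType} (p : R * R) : R * R := (- p.1, p.2).

(* Invariance under (p, tau) |-> (S p, - tau), for S = flip_x or flip_y: both *)
(* are linear, so the velocity v at p becomes - S v at S p.                   *)
Definition reversible {R : realType} (F : R * R -> set (R * R))
    (S : R * R -> R * R) : Prop :=
  forall p : R * R, F (S p) = (fun v => - S v) @` F p.

(* The system does not coincide, even off Sigma, with one affine system.      *)
Definition nonlinear {R : realType} (F : R * R -> set (R * R)) : Prop :=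
  ~ exists a b c a' b' c' : R, forall p : R * R, p.1 <> 0 ->
      F p = [set (a * p.1 + b * p.2 + c, a' * p.1 + b' * p.2 + c')].

Definition smooth_solution {R : realType} (f : R * R -> R * R)
    (X : R -> R * R) : Prop :=
  forall t : R, is_derive t (1 : R) X (f (X t)).

Definition linear_center_at {R : realType} (f : R * R -> R * R)
    (c : R * R) : Prop :=
  f c = 0 /\
  forall X : R -> R * R, smooth_solution f X -> X 0 <> c -> periodic_orbit X.

Definition symmetric_wrt_x_axis {R : realType} (f : R * R -> R * R) : Prop :=
  forall X : R -> R * R, smooth_solution f X -> flip_y @` range X = range X.

Definition linear_part {R : realType} (f : R * R -> R * R) : 'M[R]_2 :=
  \matrix_(i < 2, j < 2)
    let w := f (if j == 0 then (1, 0) else (0, 1)) - f 0 in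
    if i == 0 then w.1 else w.2.

Definition focus_at {R : realType} (f : R * R -> R * R) (c : R * R) : Prop :=
  f c = 0 /\
  exists lambda : R[i],
    [/\ eigenvalue (map_mx (real_complex R) (linear_part f)) lambda,
        complex.Re lambda <> 0 & complex.Im lambda <> 0].

Definition real_left {R : realType} (f : R * R -> R * R) (p : R * R) : Prop :=
  f p = 0 /\ p.1 < 0.
Definition real_right {R : realType} (f : R * R -> R * R) (p : R * R) : Prop :=
  f p = 0 /\ 0 < p.1.
Definition virtual_left {R : realType} (f : R * R -> R * R) (p : R * R) :
  Prop := f p = 0 /\ 0 < p.1.
Definition virtual_right {R : realType} (f : R * R -> R * R) (p : R * R) :
  Prop := f p = 0 /\ p.1 < 0.

Definition visible_tangency_left {R : realType} (f : R * R -> R * R)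
    (p : R * R) : Prop :=
  [/\ p.1 = 0, (f p).1 = 0 &
    forall X : R -> R * R, smooth_solution f X -> X 0 = p ->
      \forall t \near (0 : R)^', (X t).1 < 0].
Definition visible_tangency_right {R : realType} (f : R * R -> R * R)
    (p : R * R) : Prop :=
  [/\ p.1 = 0, (f p).1 = 0 &
    forall X : R -> R * R, smooth_solution f X -> X 0 = p ->
      \forall t \near (0 : R)^', 0 < (X t).1].

Definition pseudo_saddle {R : realType} (fL fR : R * R -> R * R)
    (p : R * R) : Prop :=
  visible_tangency_left fL p /\ visible_tangency_right fR p.

Definition homoclinic_orbit {R : realType} (F : R * R -> set (R * R))
    (p : R * R) (G : set (R * R)) : Prop :=
  exists (X : R -> R * R) (T : R),
    [/\ 0 < T, filippov_solution F `[0, T] X, X 0 = p, X T = p &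
        {in `[0, T[ &, injective X} /\ G = X @` `[0, T]].

(* Two lobes, mirror images in Sigma, meeting on Sigma only at the notch (the *)
(* origin) and at the tip (0, y1); the lobes leave the notch away from the    *)
(* tip, so that the notch points inwards.                                     *)
Definition heart_shaped {R : realType} (G : set (R * R)) : Prop :=
  flip_x @` G = G /\
  exists y1 : R,
    [/\ y1 <> 0,
        forall p : R * R, G p /\ p.1 = 0 <-> p = (0, 0) \/ p = (0, y1) &
        exists2 d : R, 0 < d &
          forall p : R * R, G p -> 0 < `|p| < d -> p.2 * y1 < 0].

Definition inside {R : realType} (G : set (R * R)) : set (R * R) :=
  [set p | ~ G p /\ bounded_set (connected_component (~` G) p)].
Definition outside {R : realType} (G : set (R * R)) : set (R * R) :=
  [set p | ~ G p /\ ~ bounded_set (connected_component (~` G) p)].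

(* Main.v *)
Require Import Defs.
From HB Require Import structures.
From mathcomp Require Import all_boot all_order all_algebra.
From mathcomp Require Import all_classical all_reals all_analysis.
From mathcomp Require Import measurable_realfun complex ring lra.
Import Order.TTheory GRing.Theory Num.Theory.
Import numFieldNormedType.Exports.
Local Open Scope classical_set_scope.
Local Open Scope ring_scope.

(** Sufficiency. When b = 0 every Filippov solution crosses x = 0 transversally off the origin, so
    orbits are unique as long as they avoid the origin, and they are concatenations of arcs of the
    spirals of the two foci. If gammaL = - gammaR and xL = - xR, the left arcs are the mirror images
    of the right ones run backwards; if gammaL = gammaR = 0, all arcs are circular and symmetric
    with respect to the x-axis. In both cases the right arc leaving (0, y0), y0 < 0, and the left
    arc leaving its end point form a closed loop. With two real foci the loops exist exactly for
    the spirals larger than the one tangent to x = 0 at the origin, and this spiral with its mirror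
    image is the heart.

    Necessity. Far from the origin an orbit goes from (0, - eta) through (0, zeta) to (0, - eta'),
    and the first integrals ln rho - gamma theta of the two foci relate eta to zeta and zeta to
    eta'. Expanding them at infinity, the sign of eta' - eta is decided by the first nonzero
    quantity among gammaL + gammaR and three coefficients of relative order 1/eta, 1/eta^2 and
    1/eta^3, the second one multiplied by gammaR. If eta < eta' whenever eta is large, then a far
    periodic orbit would have no lowest point on x = 0; the case eta' < eta follows by reversing
    time. Hence all of them vanish, which leaves exactly the three cases. *)

(** * Derivatives of real functions *)

(** A Filippov solution is only absolutely continuous and need not be unique where it slides or is
    tangent to x = 0. Each solution is therefore first reduced to its [tame] data. For b = 0 these
    determine it away from the origin, so a solution that meets a crossing loop at one time follows
    it forever, and closing a loop settles all orbits through its points. Necessity needs no series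
    for the return map. At (0, s) the first integral has derivative (s - b) / ((s - c)^2 + x^2), so
    the mismatch of the two foci has a rational derivative whose numerator is quadratic, the cubic
    terms cancelling. The mismatch tends to 0 at infinity, so its sign for large s is opposite to
    that of the first nonzero coefficient of this numerator: these are the three coefficients. The
    middle one changes sign when the foci are exchanged, so its two contributions cancel unless zeta
    / eta tends to exp(gamma pi) <> 1; hence the factor gammaR. With gammaL = - gammaR, the first
    coefficient gives b = - gammaR (xL + xR). If gammaR <> 0, the other two then give (xL - xR)(xL +
    xR) = 0 and (xL + xR)(xL^2 + xR^2) = 0, that is, xL = - xR. *)

Section Calculus.
Context {R : realType}.
Implicit Types (f g : R -> R) (t a b : R).

Lemma isd_eq {f t a b} : is_derive t 1 f a -> a = b -> is_derive t 1 f b.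
Proof. by move=> ? <-. Qed.
Lemma isd_cst (c : R) t : is_derive t 1 (fun=> c) (0 : R).
Proof. exact: is_derive_cst. Qed.
Lemma isd_id t : is_derive t 1 (fun x : R => x) (1 : R).
Proof. exact: is_derive_id. Qed.
Lemma isd_add {f g t a b} : is_derive t 1 f a -> is_derive t 1 g b ->
  is_derive t 1 (fun x => f x + g x) (a + b).
Proof. by move=> ? ?; apply: is_deriveD. Qed.
Lemma isd_opp {f t a} : is_derive t 1 f a -> is_derive t 1 (fun x => - f x) (- a).
Proof. by move=> ?; apply: is_deriveN. Qed.
Lemma isd_mul {f g t a b} : is_derive t 1 f a -> is_derive t 1 g b ->
  is_derive t 1 (fun x => f x * g x) (a * g t + f t * b).
Proof.
move=> df dg; have h := @is_deriveM _ _ f g t 1 a b df dg.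
by apply: (isd_eq h); rewrite /GRing.scale /=; ring.
Qed.
Lemma isd_comp {f g t a b} : is_derive t 1 f a -> is_derive (f t) 1 g b ->
  is_derive t 1 (fun x => g (f x)) (b * a).
Proof. by move=> df dg; have h := @is_derive1_comp _ g f t b a dg df. Qed.
Lemma isd_exp t : is_derive t 1 (@expR R) (expR t).
Proof. exact: is_derive_expR. Qed.
Lemma isd_cos t : is_derive t 1 (@cos R) (- sin t).
Proof. exact: is_derive_cos. Qed.
Lemma isd_sin t : is_derive t 1 (@sin R) (cos t).
Proof. exact: is_derive_sin. Qed.
Lemma isd_inv {f t a} : f t != 0 -> is_derive t 1 f a ->
  is_derive t 1 (fun x => (f x)^-1) (- ((f t)^-1 * (f t)^-1 * a)).
Proof.
move=> f0 df; have h := @is_deriveV _ f t a 1 f0 df.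
by apply: (isd_eq h); rewrite /GRing.scale /= expr2 invfM mulNr.
Qed.
Lemma isd_sqr {f t a} : is_derive t 1 f a ->
  is_derive t 1 (fun x => f x ^+ 2) (2 * f t * a).
Proof.
move=> df; have h := isd_mul df df.
have -> : (fun x => f x ^+ 2) = (fun x => f x * f x).
  by apply/funext => x; rewrite expr2.
by apply: (isd_eq h); ring.
Qed.

Lemma isd_cont {f t a} : is_derive t 1 f a -> {for t, continuous f}.
Proof. by move=> [df _]; apply/differentiable_continuous/derivable1_diffP. Qed.

Lemma mvt {f} (df : R -> R) {a b} : a < b ->
  (forall x, a < x < b -> is_derive x 1 f (df x)) ->
  (forall x, a <= x <= b -> {for x, continuous f}) ->
  exists c, a < c < b /\ f b - f a = df c * (b - a).
Proof.
move=> ab d c.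
have d' x : x \in `]a, b[%R -> is_derive x 1 f (df x).
  by rewrite in_itv/=; exact: d.
have c' : {within `[a, b], continuous f}.
  by apply: continuous_in_subspaceT => x; rewrite inE/= in_itv/=; exact: c.
have [x xab e] := MVT ab d' c'.
by exists x; move: xab; rewrite in_itv/=.
Qed.

Lemma isd_lt {f} (df : R -> R) {a b} : a < b ->
  (forall x, a < x < b -> is_derive x 1 f (df x) /\ 0 < df x) ->
  (forall x, a <= x <= b -> {for x, continuous f}) -> f a < f b.
Proof.
move=> ab d c; have [x [xab e]] := mvt df ab (fun x xab => (d x xab).1) c.
rewrite -subr_gt0 e mulr_gt0 ?subr_gt0//; by have [] := d _ xab.
Qed.

Lemma isd_gt {f} (df : R -> R) {a b} : a < b ->
  (forall x, a < x < b -> is_derive x 1 f (df x) /\ df x < 0) ->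
  (forall x, a <= x <= b -> {for x, continuous f}) -> f b < f a.
Proof.
move=> ab d c; have [x [xab e]] := mvt df ab (fun x xab => (d x xab).1) c.
rewrite -subr_lt0 e pmulr_llt0 ?subr_gt0//; by have [] := d _ xab.
Qed.

Lemma isd_cst_eq {f a b} : a <= b ->
  (forall x, a < x < b -> is_derive x 1 f 0) ->
  (forall x, a <= x <= b -> {for x, continuous f}) -> f a = f b.
Proof.
rewrite le_eqVlt => /predU1P[-> //|ab] d c.
have [x [xab e]] := mvt (fun=> 0) ab d c.
by apply/eqP; rewrite eq_sym -subr_eq0 e mul0r.
Qed.

Lemma ivt {f a b} v : a <= b ->
  (forall x, a <= x <= b -> {for x, continuous f}) ->
  f a <= v <= f b \/ f b <= v <= f a -> exists2 c, a <= c <= b & f c = v.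
Proof.
move=> ab c h; have c' : {within `[a, b], continuous f}.
  by apply: continuous_in_subspaceT => x; rewrite inE/= in_itv/=; exact: c.
have h' : Num.min (f a) (f b) <= v <= Num.max (f a) (f b).
  by case: h => /andP[h1 h2]; rewrite ge_min le_max h1 h2 ?orbT.
have [x xab e] := IVT ab c' h'.
by exists x; move: xab; rewrite ?in_itv.
Qed.

End Calculus.

(** Syntax-directed differentiation. The value of the derivative stays an existential variable that
    the rules fill in, and [isd_eq] leaves its equality with the expected value to [ring]. Since
    [is_derive] is a class, [notypeclasses refine] keeps instance search away from the unknown
    derivative. *)
Ltac isd_core :=
  lazymatch goal with
  | |- is_derive ?t 1 (fun x => ?c) _ =>
    first
    [ notypeclasses refine (isd_cst _ _)
    | notypeclasses refine (isd_id _)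
    | eassumption
    | lazymatch goal with
      | |- is_derive _ _ (fun x => @?f x + @?g x) _ =>
          notypeclasses refine (@isd_add _ f g _ _ _ _ _); isd_core
      | |- is_derive _ _ (fun x => - @?f x) _ =>
          notypeclasses refine (@isd_opp _ f _ _ _); isd_core
      | |- is_derive _ _ (fun x => @?f x * @?g x) _ =>
          notypeclasses refine (@isd_mul _ f g _ _ _ _ _); isd_core
      | |- is_derive _ _ (fun x => @?f x ^+ 2) _ =>
          notypeclasses refine (@isd_sqr _ f _ _ _); isd_core
      | |- is_derive _ _ (fun x => expR (@?f x)) _ =>
          notypeclasses refine (@isd_comp _ f expR _ _ _ _ _);
          [isd_core|notypeclasses refine (isd_exp _)]
      | |- is_derive _ _ (fun x => cos (@?f x)) _ =>
          notypeclasses refine (@isd_comp _ f cos _ _ _ _ _);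
          [isd_core|notypeclasses refine (isd_cos _)]
      | |- is_derive _ _ (fun x => sin (@?f x)) _ =>
          notypeclasses refine (@isd_comp _ f sin _ _ _ _ _);
          [isd_core|notypeclasses refine (isd_sin _)]
      end ]
  | |- _ => first [eassumption | notypeclasses refine (isd_cst _ _)]
  end.
Ltac der := notypeclasses refine (isd_eq _ _); [isd_core|cbv beta].

Ltac bounds := apply/andP; split; lra.

(** * Orbits of affine fields of focus type *)

Section Flow.
Context {R : realType}.
Implicit Types (X : R -> R * R) (p : R * R) (f : R * R -> R * R).

Lemma cont_pair X t : {for t, continuous X} <->
  {for t, continuous (fun s => (X s).1)} /\ {for t, continuous (fun s => (X s).2)}.
Proof.
split=> [h|[h1 h2]].
  by split; [apply: (cvg_comp X fst h); exact: cvg_fst|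
             apply: (cvg_comp X snd h); exact: cvg_snd].
have -> : X = (fun s => ((X s).1, (X s).2)) by apply/funext => s; case: (X s).
exact: (@cvg_pair _ _ _ (nbhs t) (nbhs (X t).1) (nbhs (X t).2) _ _ _ _ _ h1 h2).
Qed.

Definition solves_at f X (t : R) : Prop :=
  is_derive t (1 : R) (fun s => (X s).1) (f (X t)).1 /\
  is_derive t (1 : R) (fun s => (X s).2) (f (X t)).2.

Lemma solves_at_cont f X t : solves_at f X t -> {for t, continuous X}.
Proof. by move=> [/isd_cont ? /isd_cont ?]; apply/cont_pair. Qed.

Lemma is_derive_cvgP (V : normedModType R) (f : R -> V) (t : R) (l : V) :
  is_derive t 1 f l <-> h^-1 *: (f (h *: 1 + t) - f t) @[h --> 0^'] --> l.
Proof.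
split=> [[d <-]|h].
  exact: d.
apply: DeriveDef; first by apply/cvg_ex; exists l.
exact/cvg_lim.
Qed.

Lemma smooth_solutionP f X :
  smooth_solution f X <-> forall t, solves_at f X t.
Proof.
split=> h t.
  have /is_derive_cvgP {}h := h t.
  split; apply/is_derive_cvgP.
    by apply: (cvg_comp _ fst h); exact: cvg_fst.
  by apply: (cvg_comp _ snd h); exact: cvg_snd.
have [/is_derive_cvgP h1 /is_derive_cvgP h2] := h t.
apply/is_derive_cvgP.
exact: (@cvg_pair _ _ _ _ (nbhs (f (X t)).1) (nbhs (f (X t)).2) _ _ _ _ _ h1 h2).
Qed.

Definition focus (gamma alpha beta : R) : R * R :=
  (alpha / (1 + gamma ^+ 2), 2 * gamma * (alpha / (1 + gamma ^+ 2)) + beta).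

Arguments focus : simpl never.

Lemma D_gt0 (gamma : R) : 0 < 1 + gamma ^+ 2.
Proof. by rewrite ltr_wpDr ?sqr_ge0. Qed.

Lemma affine_field_focus gamma alpha beta p (c := focus gamma alpha beta) :
  affine_field gamma alpha beta p =
  (2 * gamma * (p.1 - c.1) - (p.2 - c.2), (1 + gamma ^+ 2) * (p.1 - c.1)).
Proof.
rewrite /affine_field /c {c}/focus /=; congr pair; first by ring.
by rewrite mulrBr mulrCA divff ?mulr1// gt_eqF ?D_gt0.
Qed.

(** In the coordinates u = x - c.1, v = gamma u - (y - c.2) the field is u' = gamma u + v, v' =
    gamma v - u, which is w' = (gamma - i) w for w = u + i v: a rotation scaled by exp(gamma t). *)
Definition flow (gamma alpha beta : R) p (t : R) : R * R :=
  let c := focus gamma alpha beta in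
  let u := p.1 - c.1 in let v := gamma * u - (p.2 - c.2) in
  let U := expR (gamma * t) * (u * cos t + v * sin t) in
  let V := expR (gamma * t) * (v * cos t - u * sin t) in
  (c.1 + U, c.2 + gamma * U - V).

Lemma flow_solves gamma alpha beta p t :
  solves_at (affine_field gamma alpha beta) (flow gamma alpha beta p) t.
Proof.
rewrite /solves_at affine_field_focus /flow /=.
by split; der; ring.
Qed.

(** The solution carried back by the inverse flow ([P] and [Q] below) has zero derivative.
    Derivatives are required only inside the interval, because solutions have corners at the times
    when they meet Sigma. *)
Lemma flow_unique gamma alpha beta X (a b : R) :
  (forall t, a < t < b -> solves_at (affine_field gamma alpha beta) X t) ->
  (forall t, a <= t <= b -> {for t, continuous X}) ->
  forall s t, a <= s <= b -> a <= t <= b ->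
  X t = flow gamma alpha beta (X s) (t - s).
Proof.
move=> dX cX s t sab tab.
have [c cE] : {c | c = focus gamma alpha beta} by exists (focus gamma alpha beta).
pose u r := (X r).1 - c.1; pose v r := gamma * u r - ((X r).2 - c.2).
pose P r := expR (- (gamma * (r - s))) * (u r * cos (r - s) - v r * sin (r - s)).
pose Q r := expR (- (gamma * (r - s))) * (v r * cos (r - s) + u r * sin (r - s)).
have du r : a < r < b -> is_derive r 1 u (gamma * u r + v r).
  move=> /dX[]; rewrite affine_field_focus -cE /= => d1 d2.
  by rewrite /u; der; rewrite /v /u; ring.
have dv r : a < r < b -> is_derive r 1 v (gamma * v r - u r).
  move=> rab; have du' := du _ rab; have [] := dX _ rab.
  rewrite affine_field_focus -cE /= => d1 d2.
  by rewrite /v; der; rewrite /v /u; ring.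
have cu r : a <= r <= b -> {for r, continuous u}.
  by move=> /cX/cont_pair[c1 c2]; apply: continuousB; [assumption|exact: cvg_cst].
have cv r : a <= r <= b -> {for r, continuous v}.
  move=> rab; have cu' := cu _ rab; have /cont_pair[c1 c2] := cX _ rab.
  apply: continuousB; first by apply: continuousM; [exact: cvg_cst|assumption].
  by apply: continuousB; [assumption|exact: cvg_cst].
have ce r : {for r, continuous (fun r => expR (- (gamma * (r - s))))}.
  by apply: isd_cont; der; reflexivity.
have cc r : {for r, continuous (fun r => cos (r - s))}.
  by apply: isd_cont; der; reflexivity.
have cs r : {for r, continuous (fun r => sin (r - s))}.
  by apply: isd_cont; der; reflexivity.
have key (F : R -> R) : (forall r, a < r < b -> is_derive r 1 F 0) ->
    (forall r, a <= r <= b -> {for r, continuous F}) -> F t = F s.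
  move=> dF cF; have [/andP[as_ sb] /andP[at_ tb]] := (sab, tab).
  have [st|ts] := leP s t.
    apply/esym/isd_cst_eq => // r /andP[h1 h2]; [apply: dF|apply: cF].
      by rewrite (le_lt_trans as_ h1) (lt_le_trans h2 tb).
    by rewrite (le_trans as_ h1) (le_trans h2 tb).
  apply/isd_cst_eq; first exact: ltW.
    move=> r /andP[h1 h2]; apply: dF.
    by rewrite (le_lt_trans at_ h1) (lt_le_trans h2 sb).
  move=> r /andP[h1 h2]; apply: cF.
  by rewrite (le_trans at_ h1) (le_trans h2 sb).
have eP : P t = u s.
  have -> : P t = P s; last first.
    by rewrite /P subrr mulr0 oppr0 expR0 cos0 sin0; ring.
  apply: key.
  - by move=> r rab; have := du _ rab; have := dv _ rab => ? ?; rewrite /P; der; ring.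
  - move=> r rab; apply: continuousM => //; apply: continuousB.
      by apply: continuousM => //; exact: cu.
    by apply: continuousM => //; exact: cv.
have eQ : Q t = v s.
  have -> : Q t = Q s; last first.
    by rewrite /Q subrr mulr0 oppr0 expR0 cos0 sin0; ring.
  apply: key.
  - by move=> r rab; have := du _ rab; have := dv _ rab => ? ?; rewrite /Q; der; ring.
  - move=> r rab; apply: continuousM => //; apply: continuousD.
      by apply: continuousM => //; exact: cv.
    by apply: continuousM => //; exact: cu.
have E1 : expR (gamma * (t - s)) * expR (- (gamma * (t - s))) = 1.
  by rewrite -expRD subrr expR0.
have cs1 := cos2Dsin2 (t - s).
rewrite /flow -cE /= -/(u s) -/(v s) -eP -eQ /P /Q.
set E := expR _ in E1 *; set E' := expR _ in E1 *.
set C := cos _ in cs1 *; set S := sin _ in cs1 *.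
have -> : E * (E' * (u t * C - v t * S) * C + E' * (v t * C + u t * S) * S) =
  (E * E') * (C ^+2 + S ^+2) * u t by ring.
have -> : E * (E' * (v t * C + u t * S) * C - E' * (u t * C - v t * S) * S) =
  (E * E') * (C ^+2 + S ^+2) * v t by ring.
rewrite E1 cs1 /v /u; case: (X t) => x y /=; congr pair; ring.
Qed.

End Flow.

(** * Filippov solutions *)

Section Primitive.
Context {R : realType}.
Notation mu := (@lebesgue_measure R).
Implicit Types (x v w : R -> R).

Definition primitive x v := forall s t : R, s <= t ->
  mu.-integrable `[s, t] (EFin \o v) /\
  x t - x s = \int[mu]_(u in `[s, t]) v u.

Lemma ae_mono (P Q : R -> Prop) : (forall u, P u -> Q u) ->
  {ae mu, forall u, P u} -> {ae mu, forall u, Q u}.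
Proof.
by move=> PQ; apply: filterS; first exact: (ae_filter_ringOfSetsType mu).
Qed.

Lemma ae_ge0_Rintegral (D : set R) v : measurable D ->
  mu.-integrable D (EFin \o v) -> {ae mu, forall u, D u -> 0 <= v u} ->
  0 <= \int[mu]_(u in D) v u.
Proof.
move=> mD iv v0; rewrite /Rintegral.
have -> : (\int[mu]_(u in D) (v u)%:E = \int[mu]_(u in D) `|(v u)%:E|)%E.
  apply: ae_eq_integral => //.
  - by case/integrableP: iv.
  - by case/integrableP: (integrable_abse iv).
  - by apply: ae_mono v0 => u h /h /= h'; rewrite ger0_norm.
by apply: fine_ge0; apply: integral_ge0 => u _; exact: abse_ge0.
Qed.

Lemma primitive_ge x v (c s t : R) : primitive x v -> s <= t ->
  {ae mu, forall u, s <= u <= t -> c <= v u} -> c * (t - s) <= x t - x s.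
Proof.
move=> p st h; have [iv ->] := p _ _ st.
have ic : mu.-integrable `[s, t] (EFin \o (fun=> c : R)).
  by apply: continuous_compact_integrable; [exact: segment_compact|
     apply: continuous_subspaceT => ?; exact: cst_continuous].
have -> : c * (t - s) = \int[mu]_(u in `[s, t]) c.
  have e : mu `[s, t] = (t - s)%:E.
    rewrite lebesgue_measure_itv/= lte_fin; case: ltP => //= ts.
    by rewrite (@le_anti _ _ s t) ?st// subrr.
  by rewrite Rintegral_cst//; congr (_ * _); apply/esym; rewrite [X in fine X]e.
rewrite -subr_ge0 -RintegralB//.
apply: ae_ge0_Rintegral => //.
  by have := @integrableB _ _ _ mu _ (measurable_itv _) _ _ iv ic; apply: eq_integrable => // u _; rewrite /= EFinB.
by apply: ae_mono h => u h; rewrite /= in_itv/= => /h; rewrite subr_ge0.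
Qed.

Lemma primitiveN x v : primitive x v -> primitive (fun t => - x t) (fun t => - v t).
Proof.
move=> p s t st; have [iv e] := p _ _ st; split.
  by have := integrableN iv; apply: eq_integrable.
under eq_Rintegral do rewrite -mulN1r.
by rewrite RintegralZl// -e; ring.
Qed.

Lemma primitive_le x v (c s t : R) : primitive x v -> s <= t ->
  {ae mu, forall u, s <= u <= t -> v u <= c} -> x t - x s <= c * (t - s).
Proof.
move=> /primitiveN p st h; have := @primitive_ge _ _ (- c) s t p st.
have h' : {ae mu, forall u, s <= u <= t -> - c <= - v u}.
  by apply: ae_mono h => u h /h; rewrite lerN2.
by move=> /(_ h'); lra.
Qed.

Lemma primitive_cont x v : primitive x v -> continuous x.
Proof.
move=> p t; have st : t - 1 <= t + 1 by lra.
have [iv _] := p _ _ st.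
have /= c := parameterized_integral_continuous st iv.
have it : t \in `](t - 1), (t + 1)[%R by rewrite in_itv/=; lra.
have ct : {for t, continuous (fun s => x (t - 1) + parameterized_integral mu (t - 1) s v)}.
  apply: continuousD; first exact: cst_continuous.
  have ab : t - 1 < t + 1 by lra.
  exact: (within_continuous_continuous ab c it).
suff : {near t, (fun s => x (t - 1) + parameterized_integral mu (t - 1) s v) =1 x}.
  move=> h; rewrite /continuous_at -(nbhs_singleton h).
  by apply: cvg_trans ct; apply: near_eq_cvg; apply: filterS h => s ->.
exists 1 => //= s; rewrite /ball_/= ltr_distlC => /andP[s0 _].
have s1 : t - 1 <= s by exact: ltW.
by have [_] := p _ _ s1; rewrite /parameterized_integral => <-; ring.
Qed.

(** The derivative exists at t itself although v is known only almost everywhere: continuity of w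
    squeezes the increments of x between (w t - d) k and (w t + d) k. *)
Lemma primitive_der x v w (t e : R) : primitive x v -> 0 < e ->
  {for t, continuous w} ->
  {ae mu, forall u, t - e < u < t + e -> v u = w u} -> is_derive t 1 x (w t).
Proof.
move=> p e0 cw h; apply/is_derive_cvgP/cvgrPdist_le => d d0.
have /cvgrPdist_le/(_ _ d0)[r r0 hr] := cw.
near=> k.
have k0 : k != 0 by near: k; exact: nbhs_dnbhs_neq.
have kr : `|k| < Num.min r e.
  by near: k; apply: dnbhs0_lt; rewrite lt_min r0 e0.
have {kr}[kr ke] : `|k| < r /\ `|k| < e by apply/andP; rewrite -lt_min.
have hb : {ae mu, forall u, `|u - t| <= `|k| -> w t - d <= v u <= w t + d}.
  apply: ae_mono h => u h ut.
  have ue : `|u - t| < e by exact: le_lt_trans ke.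
  rewrite h; last by move: ue; rewrite ltr_distlC => /andP[? ?]; bounds.
  have := hr u; rewrite /= /ball_/= distrC (le_lt_trans ut kr) => /(_ isT).
  by rewrite distrC ler_distl.
rewrite scaler1; rewrite [_ *: _]mulrC -(@ler_pM2r _ `|k|) ?normr_gt0// -normrM mulrBl divfK//.
have [k1|k1] := ltP 0 k.
  have tk : t <= k + t by lra.
  have g := primitive_ge _ _ (w t - d) _ _ p tk; have l := primitive_le _ _ (w t + d) _ _ p tk.
  rewrite (gtr0_norm k1) in hb *.
  rewrite ler_norml; apply/andP; split.
    have : x (k + t) - x t <= (w t + d) * (k + t - t).
      apply: l; apply: ae_mono hb => u h' /andP[u1 u2]; have := h' _ => /(_ _)/andP[] //.
      by rewrite ger0_norm; lra.
    by lra.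
  have : (w t - d) * (k + t - t) <= x (k + t) - x t.
    apply: g; apply: ae_mono hb => u h' /andP[u1 u2]; have := h' _ => /(_ _)/andP[] //.
    by rewrite ger0_norm; lra.
  by lra.
have {}k1 : k < 0 by rewrite lt_neqAle k0.
have tk : k + t <= t by lra.
have g := primitive_ge _ _ (w t - d) _ _ p tk; have l := primitive_le _ _ (w t + d) _ _ p tk.
rewrite (ltr0_norm k1) in hb *.
rewrite ler_norml; apply/andP; split.
  have : (w t - d) * (t - (k + t)) <= x t - x (k + t).
    apply: g; apply: ae_mono hb => u h' /andP[u1 u2]; have := h' _ => /(_ _)/andP[] //.
    by rewrite ler0_norm; lra.
  by lra.
have : x t - x (k + t) <= (w t + d) * (t - (k + t)).
  apply: l; apply: ae_mono hb => u h' /andP[u1 u2]; have := h' _ => /(_ _)/andP[] //.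
  by rewrite ler0_norm; lra.
by lra.
Unshelve. all: by end_near. Qed.

End Primitive.

(** * Piecewise smooth curves are Filippov solutions *)

Section Existence.
Context {R : realType}.
Notation mu := (@lebesgue_measure R).

Lemma near_cont_gt0 (w : R -> R) (t c : R) : {for t, continuous w} -> c < w t ->
  exists2 e, 0 < e & forall s, `|s - t| < e -> c < w s.
Proof.
move=> cw wt; have /cvgrPdist_lt/(_ (w t - c)) := cw.
rewrite subr_gt0 => /(_ wt)[r r0 hr]; exists r => // s st.
have := hr s; rewrite /= /ball_/= distrC => /(_ st).
by rewrite ltr_distlC => /andP[]; lra.
Qed.

Lemma near_is_derive (f g : R -> R) (t a e : R) : 0 < e ->
  (forall s, `|s - t| < e -> f s = g s) -> is_derive t 1 f a -> is_derive t 1 g a.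
Proof.
move=> e0 h; apply: near_eq_is_derive.
by exists e => // s; rewrite /= /ball_/= distrC; exact: h.
Qed.

Lemma near_cont (f g : R -> R) (t e : R) : 0 < e ->
  (forall s, `|s - t| < e -> f s = g s) -> {for t, continuous f} -> {for t, continuous g}.
Proof.
move=> e0 h c; rewrite /prop_for /continuous_at -(h t) ?subrr ?normr0//.
apply: cvg_trans c; apply: near_eq_cvg.
by exists e => // s; rewrite /= /ball_/= distrC => /h.
Qed.

(** Here w is the switching function, a and b the velocities on its two sides. The difference of x
    and the integral of the velocity has zero derivative except at isolated times, and continuity
    carries it across these. *)
Lemma piecewise_primitive (x a b w : R -> R) :
  continuous a -> continuous b -> continuous w -> continuous x ->
  (forall t, exists2 e : R, 0 < e & forall s, 0 < `|s - t| < e ->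
     0 < w s /\ is_derive s 1 x (b s) \/ w s < 0 /\ is_derive s 1 x (a s)) ->
  primitive x (fun u => if 0 < w u then b u else a u).
Proof.
move=> ca cb cw cx hx; set v := (fun u => _).
have mv : measurable_fun [set: R] v.
  apply: measurable_fun_ifT.
  - by apply: measurable_fun_ltr => //; exact: continuous_measurable_fun.
  - exact: continuous_measurable_fun.
  - exact: continuous_measurable_fun.
have iv (s t : R) : mu.-integrable `[s, t] (EFin \o v).
  have ig : mu.-integrable `[s, t] (EFin \o (fun u => `|a u| + `|b u|)).
    have cg : continuous (fun u : R => `|a u| + `|b u|).
      by move=> u; apply: cvgD; apply: cvg_norm; [exact: ca|exact: cb].
    apply: continuous_compact_integrable; first exact: segment_compact.
    exact: continuous_subspaceT.
  apply: (le_integrable _ _ _ ig) => //.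
    by apply/measurable_EFinP; apply: measurable_funS mv.
  move=> u _ /=; rewrite lee_fin [leRHS]ger0_norm ?addr_ge0// /v.
  by case: ifP => _; [rewrite lerDr|rewrite lerDl].
move=> s t st; split; first exact: iv.
(* The margins make s and t interior points of the interval on which the integral is
   differentiated. *)
pose A := s - 1; pose U := t + 1.
have As : A < s by rewrite /A; lra.
have tU : t < U by rewrite /U; lra.
have AU : A < U by lra.
pose P r := \int[mu]_(u in `[A, r]) v u.
have cP r : A < r < U -> {for r, continuous P}.
  move=> rAU; have c := parameterized_integral_continuous (ltW AU) (iv A U).
  by apply: (within_continuous_continuous AU c); rewrite in_itv.
have dP r : A < r < U -> {for r, continuous v} -> is_derive r 1 P (v r).
  move=> /andP[Ar rU] vr.
  have [d e] := continuous_FTC1_closed rU (iv A U) Ar vr.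
  by apply: DeriveDef; [exact: d|rewrite -derive1E; exact: e].
pose W r := x r - P r.
have cW r : A < r < U -> {for r, continuous W}.
  by move=> rAU; apply: continuousB; [exact: cx|exact: cP].
have dW r : A < r < U -> is_derive r 1 W 0.
  move=> rAU; have [e e0 he] := hx r.
  pose e' := Num.min e (Num.min (r - A) (U - r)).
  have e'0 : 0 < e' by rewrite !lt_min e0; move: rAU => /andP[? ?]; apply/and3P; split=> //; lra.
  have d0 q : 0 < `|q - r| < e' -> is_derive q 1 W 0.
    rewrite !lt_min => /and4P[q0 q1 q2 q3].
    have qAU : A < q < U.
      move: q2 q3; rewrite !ltr_norml => /andP[? ?] /andP[? ?]; bounds.
    have /he : 0 < `|q - r| < e by rewrite q0 q1.
    have sub := (subrr (v q)).
    case=> -[wq dx].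
      have vq : v q = b q by rewrite /v wq.
      have [d d0 hd] := near_cont_gt0 _ _ _ (cw q) wq.
      have cv : {for q, continuous v}.
        by apply: (near_cont b _ _ _ d0) => [p /hd|]; [rewrite /v => ->|exact: cb].
      have dPq := dP _ qAU cv; rewrite /W.
      by der; rewrite vq subrr.
    have vq : v q = a q by rewrite /v ltNge (ltW wq).
    have cw' : {for q, continuous (fun u => - w u)} by apply: continuousN; exact: cw.
    have wq' : 0 < - w q by rewrite oppr_gt0.
    have [d d0 hd] := near_cont_gt0 _ _ _ cw' wq'.
    have cv : {for q, continuous v}.
      apply: (near_cont a _ _ _ d0) => [p /hd|]; last exact: ca.
      by rewrite oppr_gt0 /v => h; rewrite ltNge (ltW h).
    have dPq := dP _ qAU cv; rewrite /W.
    by der; rewrite vq subrr.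
  (* The time r may be a switching time. On either side of it W has zero derivative and W is
     continuous at r, so W is constant near r. *)
  apply: (near_is_derive (fun=> W r) _ _ _ _ e'0).
  move=> q qr.
  have qq p : `|p - r| < e' -> A < p < U.
    rewrite !lt_min => /and3P[_].
    by rewrite !ltr_norml => /andP[? ?] /andP[? ?]; bounds.
  have [qr'|rq] := leP q r.
    apply/esym/isd_cst_eq; [exact: qr'|move=> p /andP[h1 h2]|move=> p /andP[h1 h2]].
      apply: d0; move: qr; rewrite !ltr0_norm ?subr_lt0//; last by lra.
      by move=> ?; bounds.
    apply/cW/qq; move: qr; rewrite !ler0_norm ?subr_le0//; lra.
  apply/isd_cst_eq; first exact: ltW.
    move=> p /andP[h1 h2]; apply: d0; move: qr; rewrite !gtr0_norm ?subr_gt0//.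
    by move=> ?; bounds.
  move=> p /andP[h1 h2]; apply/cW/qq; move: qr; rewrite !ger0_norm ?subr_ge0//; lra.
have e : W s = W t.
  have sub r : s <= r <= t -> A < r < U by move=> /andP[? ?]; bounds.
  apply: isd_cst_eq => // r /andP[h1 h2]; [apply: dW|apply: cW]; apply: sub; apply/andP; split=> //; exact: ltW.
have -> : x t - x s = P t - P s by move: e; rewrite /W; lra.
have ist : mu.-integrable `]s, t] (EFin \o v).
  by apply: integrableS (iv s t) => //; exact: subset_itv_oc_cc.
have sA : (BLeft A <= BRight s)%O by rewrite bnd_simp ltW.
have ts : (BRight s <= BRight t)%O by rewrite bnd_simp.
by rewrite -Rintegral_itv_obnd_cbnd// -(Rintegral_itvB (iv A t) sA ts).
Qed.

Lemma constant_filippov_solution (F : R * R -> set (R * R)) (I : set R) p :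
  F p (0, 0) -> filippov_solution F I (fun=> p).
Proof.
move=> Fp; exists (fun=> (0, 0)); split; last exact: aeW.
move=> s t st _; rewrite !subrr.
have i0 : mu.-integrable `[s, t] (fun=> (0 : R)%:E) by exact: integrable0.
by split=> //; rewrite Rintegral_cst// mul0r.
Qed.

Section PiecewiseSmooth.
Variables (fL fR : R * R -> R * R).
Hypotheses (cL : continuous fL) (cR : continuous fR).

(** Nothing is asked at t, and the two sides of t may lie in the same half-plane: this admits both
    crossings and orbits that only touch Sigma. *)
Definition piecewise_smooth_at (X : R -> R * R) (t : R) : Prop :=
  exists2 e : R, 0 < e & forall s, 0 < `|s - t| < e ->
     0 < (X s).1 /\ solves_at fR X s \/ (X s).1 < 0 /\ solves_at fL X s.

Lemma piecewise_filippov_solution (I : set R) (X : R -> R * R) :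
  continuous X -> (forall t, piecewise_smooth_at X t) ->
  filippov_solution (filippov fL fR) I X.
Proof.
move=> cX hX.
have c1 : continuous (fun t => (X t).1) by move=> t; have /cont_pair[] := cX t.
have c2 : continuous (fun t => (X t).2) by move=> t; have /cont_pair[] := cX t.
have cLX : continuous (fun t => fL (X t)).
  by move=> t; apply: (@continuous_comp _ _ _ X fL); [exact: cX|exact: cL].
have cRX : continuous (fun t => fR (X t)).
  by move=> t; apply: (@continuous_comp _ _ _ X fR); [exact: cX|exact: cR].
have p1 : primitive (fun t => (X t).1)
    (fun t => if 0 < (X t).1 then (fR (X t)).1 else (fL (X t)).1).
  apply: piecewise_primitive => //.
  - by move=> t; have /cont_pair[] := cLX t.
  - by move=> t; have /cont_pair[] := cRX t.
  - move=> t; have [e e0 he] := hX t; exists e => // s /he.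
    by case=> -[? []]; [left|right].
have p2 : primitive (fun t => (X t).2)
    (fun t => if 0 < (X t).1 then (fR (X t)).2 else (fL (X t)).2).
  apply: piecewise_primitive => //.
  - by move=> t; have /cont_pair[] := cLX t.
  - by move=> t; have /cont_pair[] := cRX t.
  - move=> t; have [e e0 he] := hX t; exists e => // s /he.
    by case=> -[? []]; [left|right].
exists (fun t => ((if 0 < (X t).1 then (fR (X t)).1 else (fL (X t)).1),
                  (if 0 < (X t).1 then (fR (X t)).2 else (fL (X t)).2))).
split.
  by move=> s t st _ /=; have [i1 e1] := p1 _ _ st; have [i2 e2] := p2 _ _ st.
apply: aeW => t _ /=; have [h|h] := ltP 0 (X t).1.
  by apply: Or32; split=> //; case: (fR _).
(* On Sigma the chosen velocity is that of the left field, so the weight of [fL] is 1. *)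
move: h; rewrite le_eqVlt => /predU1P[h|h].
  apply: Or33; split=> //; exists 1; first by rewrite ler01 lexx.
  by rewrite scale1r subrr scale0r addr0; case: (fL _).
by apply: Or31; split=> //; case: (fL _).
Qed.

End PiecewiseSmooth.
End Existence.

(** * Regularity of Filippov solutions *)

Section Tame.
Context {R : realType}.
Notation mu := (@lebesgue_measure R).
Implicit Types (fL fR : R * R -> R * R) (X Y : R -> R * R).

Definition crosses_rightwards X (t : R) : Prop :=
  exists2 e : R, 0 < e & forall s, (t < s < t + e -> 0 < (X s).1) /\
                                   (t - e < s < t -> (X s).1 < 0).
Definition crosses_leftwards X (t : R) : Prop :=
  exists2 e : R, 0 < e & forall s, (t < s < t + e -> (X s).1 < 0) /\
                                   (t - e < s < t -> 0 < (X s).1).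

(* What remains of a Filippov solution without its velocity: the bound B replaces |b|, below which
   x = 0 may have sliding points where nothing is claimed. *)
Definition tame fL fR (B : R) X : Prop :=
  [/\ continuous X,
      forall t, 0 < (X t).1 -> solves_at fR X t,
      forall t, (X t).1 < 0 -> solves_at fL X t,
      forall t, (X t).1 = 0 -> (X t).2 < - B -> crosses_rightwards X t &
      forall t, (X t).1 = 0 -> B < (X t).2 -> crosses_leftwards X t].

Lemma affine_field_cont (gamma alpha beta : R) : continuous (affine_field gamma alpha beta).
Proof.
move=> p.
apply: (@cvg_pair _ _ _ (nbhs p) (nbhs (affine_field gamma alpha beta p).1)
  (nbhs (affine_field gamma alpha beta p).2) _ _ _ (fun p => _) (fun p => _)).
  apply: cvgD; last exact: cvg_cst.
  by apply: cvgB; [apply: cvgM; [exact: cvg_cst|exact: cvg_fst]|exact: cvg_snd].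
by apply: cvgB; [apply: cvgM; [exact: cvg_cst|exact: cvg_fst]|exact: cvg_cst].
Qed.

Lemma filippov_solution_primitive (F : R * R -> set (R * R)) X :
  filippov_solution F setT X -> exists v : R -> R * R,
  [/\ primitive (fun t => (X t).1) (fun t => (v t).1),
      primitive (fun t => (X t).2) (fun t => (v t).2) &
      {ae mu, forall t, F (X t) (v t)}].
Proof.
move=> [v [h1 h2]]; exists v; split.
- by move=> s t st; have [] := h1 s t st (fun _ _ => I).
- by move=> s t st; have [] := h1 s t st (fun _ _ => I).
- by apply: ae_mono h2 => u; apply.
Qed.

Lemma filippov_convex fL fR (P : R * R -> Prop) p v :
  (forall u w (s : R), 0 <= s <= 1 -> P u -> P w -> P (s *: u + (1 - s) *: w)) ->
  P (fL p) -> P (fR p) -> filippov fL fR p v -> P v.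
Proof. by move=> cP hL hR [[_ ->]|[_ ->]|[_ [s s01 ->]]] //; exact: cP. Qed.

Lemma filippov_solves_right fL fR X t : continuous fR ->
  filippov_solution (filippov fL fR) setT X -> 0 < (X t).1 -> solves_at fR X t.
Proof.
move=> cR /filippov_solution_primitive[v [p1 p2 h]] xt.
have c1 := primitive_cont _ _ p1; have c2 := primitive_cont _ _ p2.
have cX : continuous X by move=> s; apply/cont_pair; split; [exact: c1|exact: c2].
have cRX : {for t, continuous (fun t => fR (X t))}.
  by apply: (@continuous_comp _ _ _ X fR); [exact: cX|exact: cR].
have /cont_pair[cR1 cR2] := cRX.
have [e e0 he] := near_cont_gt0 _ _ _ (c1 t) xt.
have h' : {ae mu, forall u, t - e < u < t + e -> v u = fR (X u)}.
  apply: ae_mono h => u hu ut.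
  have {ut} xu0 : 0 < (X u).1 by apply: he; rewrite ltr_distlC; move: ut => /andP[? ?]; lra.
  by case: hu => [[xu _]|[_ ->]|[xu _]] //; exfalso; move: xu xu0; clear; lra.
split.
  by apply: (primitive_der _ _ _ _ _ p1 e0 cR1); apply: ae_mono h' => u hu /hu ->.
by apply: (primitive_der _ _ _ _ _ p2 e0 cR2); apply: ae_mono h' => u hu /hu ->.
Qed.

Lemma filippov_solves_left fL fR X t : continuous fL ->
  filippov_solution (filippov fL fR) setT X -> (X t).1 < 0 -> solves_at fL X t.
Proof.
move=> cL /filippov_solution_primitive[v [p1 p2 h]] xt.
have c1 := primitive_cont _ _ p1; have c2 := primitive_cont _ _ p2.
have cX : continuous X by move=> s; apply/cont_pair; split; [exact: c1|exact: c2].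
have cLX : {for t, continuous (fun t => fL (X t))}.
  by apply: (@continuous_comp _ _ _ X fL); [exact: cX|exact: cL].
have /cont_pair[cL1 cL2] := cLX.
have c1' : {for t, continuous (fun s => - (X s).1)} by apply: continuousN; exact: c1.
have [|e e0 he] := near_cont_gt0 _ _ 0 c1'; first by rewrite oppr_gt0.
have h' : {ae mu, forall u, t - e < u < t + e -> v u = fL (X u)}.
  apply: ae_mono h => u hu ut.
  have {ut} xu0 : 0 < - (X u).1 by apply: he; rewrite ltr_distlC; move: ut => /andP[? ?]; lra.
  by case: hu => [[_ ->]|[xu _]|[xu _]] //; exfalso; move: xu xu0; clear; lra.
split.
  by apply: (primitive_der _ _ _ _ _ p1 e0 cL1); apply: ae_mono h' => u hu /hu ->.
by apply: (primitive_der _ _ _ _ _ p2 e0 cL2); apply: ae_mono h' => u hu /hu ->.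
Qed.

(** At (0, y) the horizontal velocities of the two fields are - y - b and - y + b. They have the
    same sign as soon as |y| > |b|, and then every convex combination crosses. *)
Lemma filippov_tame (gammaL gammaR alphaL alphaR b : R)
    (fL := affine_field gammaL alphaL (- b)) (fR := affine_field gammaR alphaR b) X :
  filippov_solution (filippov fL fR) setT X -> tame fL fR `|b| X.
Proof.
move=> sX; have cL := affine_field_cont gammaL alphaL (- b).
have cR := affine_field_cont gammaR alphaR b.
have [v [p1 p2 h]] := filippov_solution_primitive _ _ sX.
have c1 := primitive_cont _ _ p1; have c2 := primitive_cont _ _ p2.
have b1 : b <= `|b| := ler_norm b.
have b2 : - b <= `|b| by rewrite -normrN ler_norm.
have cX : continuous X by move=> s; apply/cont_pair; split; [exact: c1|exact: c2].
(* all the admissible velocities at X t have, nearby, a first coordinate bounded away from 0 *)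
have key (sg : R) t : 0 < sg * (fL (X t)).1 -> 0 < sg * (fR (X t)).1 ->
    exists2 e : R, 0 < e & forall s s' : R, t - e < s -> s < s' -> s' < t + e ->
      0 < sg * ((X s').1 - (X s).1).
  move=> hL0 hR0.
  have cf (f : R * R -> R * R) : continuous f ->
      {for t, continuous (fun s => sg * (f (X s)).1)}.
    move=> cf; apply: continuousM; first exact: cst_continuous.
    suff /cont_pair[] : {for t, continuous (fun t => f (X t))} by [].
    by apply: (@continuous_comp _ _ _ X f); [exact: cX|exact: cf].
  pose m := Num.min (sg * (fL (X t)).1) (sg * (fR (X t)).1) / 2.
  have m0 : 0 < m by rewrite divr_gt0// lt_min hL0.
  have mL : m < sg * (fL (X t)).1.
    have : Num.min (sg * (fL (X t)).1) (sg * (fR (X t)).1) <= sg * (fL (X t)).1 by rewrite ge_min lexx.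
    by move: m0; rewrite /m; lra.
  have mR : m < sg * (fR (X t)).1.
    have : Num.min (sg * (fL (X t)).1) (sg * (fR (X t)).1) <= sg * (fR (X t)).1 by rewrite ge_min lexx orbT.
    by move: m0; rewrite /m; lra.
  have [eL eL0 hL] := near_cont_gt0 _ _ _ (cf _ cL) mL.
  have [eR eR0 hR] := near_cont_gt0 _ _ _ (cf _ cR) mR.
  exists (Num.min eL eR); first by rewrite lt_min eL0.
  move=> s s' ts ss' s't.
  have sg1 : primitive (fun t => sg * (X t).1) (fun t => sg * (v t).1).
    move=> r r' rr'; have [i1 e1] := p1 _ _ rr'; split.
      have := @integrableZl _ _ _ mu _ (measurable_itv _) sg _ i1.
      by apply: eq_integrable.
    by rewrite RintegralZl// -e1 mulrBr.
  have := primitive_ge _ _ m _ _ sg1 (ltW ss').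
  have h' : {ae mu, forall u, s <= u <= s' -> m <= sg * (v u).1}.
    apply: ae_mono h => u hu /andP[su us'].
    have [uL uR] : `|u - t| < eL /\ `|u - t| < eR.
      apply/andP; rewrite -lt_min ltr_distlC; bounds.
    move: hu; apply: (filippov_convex _ _ (fun w => m <= sg * w.1)) => [w w' r| |].
    - by move=> /andP[r0 r1] /= a1 a2; rewrite /GRing.scale/=; nra.
    - exact/ltW/hL.
    - exact/ltW/hR.
  move=> /(_ h'); have : 0 < m * (s' - s) by rewrite mulr_gt0// subr_gt0.
  by rewrite mulrBr; lra.
split=> //.
- by move=> t; exact: filippov_solves_right sX.
- by move=> t; exact: filippov_solves_left sX.
- move=> t x0 y0; have [||e e0 he] := key 1 t.
  + by rewrite /fL /affine_field /= x0; lra.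
  + by rewrite /fR /affine_field /= x0; lra.
  exists e => // s; split=> /andP[h1 h2].
    by have := he t s _ h1 h2; rewrite x0 => /(_ _); lra.
  by have := he s t h1 h2 _; rewrite x0 => /(_ _); lra.
- move=> t x0 y0; have [||e e0 he] := key (-1) t.
  + by rewrite /fL /affine_field /= x0; lra.
  + by rewrite /fR /affine_field /= x0; lra.
  exists e => // s; split=> /andP[h1 h2].
    by have := he t s _ h1 h2; rewrite x0 => /(_ _); lra.
  by have := he s t h1 h2 _; rewrite x0 => /(_ _); lra.
Qed.
End Tame.

(** * Uniqueness away from the sliding part of Sigma *)

Section Uniqueness.
Context {R : realType}.
Implicit Types (X Y : R -> R * R).

(** The times of agreement form an open set by hypothesis and a closed one by continuity.
    Connectedness of the line is used through the indicator of this set, which has zero derivative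
    everywhere. *)
Lemma agree_everywhere X Y (t0 : R) : continuous X -> continuous Y -> X t0 = Y t0 ->
  (forall t, X t = Y t -> exists2 e : R, 0 < e & forall s, `|s - t| < e -> X s = Y s) ->
  forall t, X t = Y t.
Proof.
move=> cX cY e0 loc t.
pose f s : R := (`[< X s = Y s >] : bool)%:R.
have df (s : R) : is_derive s (1 : R) f (0 : R).
  have [e|ne] := pselect (X s = Y s).
    have [d d0 hd] := loc _ e.
    apply: (near_is_derive (fun=> 1) _ _ _ _ d0) => r /hd e'.
    by rewrite /f e' asboolT.
  pose g r := `|(X r).1 - (Y r).1| + `|(X r).2 - (Y r).2|.
  have cg : {for s, continuous g}.
    have /cont_pair[a1 a2] := cX s; have /cont_pair[b1 b2] := cY s.
    by apply: cvgD; apply: cvg_norm; exact: cvgB.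
  have g0 : 0 < g s.
    rewrite lt_neqAle addr_ge0// andbT eq_sym; apply/eqP => g0; apply: ne.
    move: g0 => /eqP; rewrite paddr_eq0// !normr_eq0 !subr_eq0 => /andP[/eqP h1 /eqP h2].
    by case: (X s) (Y s) h1 h2 => [? ?] [? ?] /= -> ->.
  have [d d0 hd] := near_cont_gt0 _ _ _ cg g0.
  apply: (near_is_derive (fun=> 0) _ _ _ _ d0) => r /hd gr.
  rewrite /f asboolF// => e; move: gr.
  by rewrite /g e !subrr normr0 addr0 ltxx.
have cf s : {for s, continuous f} by exact: (isd_cont (df s)).
have : f t = f t0.
  have [tt0|t0t] := leP t t0; first by apply: isd_cst_eq.
  by apply/esym/isd_cst_eq => //; exact: ltW.
rewrite /f (asboolT e0) => /eqP.
by have [//|ne] := pselect (X t = Y t); rewrite (asboolF ne) eq_sym oner_eq0.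
Qed.

Lemma agree_right gamma alpha beta X Y (t e : R) (f := affine_field gamma alpha beta) :
  continuous X -> continuous Y -> X t = Y t ->
  (forall s, t < s < t + e -> solves_at f X s /\ solves_at f Y s) ->
  forall s, t <= s < t + e -> X s = Y s.
Proof.
move=> cX cY e0 h s /andP[ts se].
have sol Z : continuous Z -> (forall r, t < r < t + e -> solves_at f Z r) ->
    Z s = flow gamma alpha beta (Z t) (s - t).
  move=> cZ hZ; apply: (@flow_unique _ _ _ _ Z t s).
  - by move=> r /andP[h1 h2]; apply: hZ; rewrite h1 (lt_trans h2 se).
  - by move=> r _; exact: cZ.
  - by rewrite lexx ts.
  - by rewrite lexx ts.
by rewrite (sol X) ?(sol Y) ?e0// => r /h[].
Qed.

Lemma agree_left gamma alpha beta X Y (t e : R) (f := affine_field gamma alpha beta) :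
  continuous X -> continuous Y -> X t = Y t ->
  (forall s, t - e < s < t -> solves_at f X s /\ solves_at f Y s) ->
  forall s, t - e < s <= t -> X s = Y s.
Proof.
move=> cX cY e0 h s /andP[es st].
have sol Z : continuous Z -> (forall r, t - e < r < t -> solves_at f Z r) ->
    Z s = flow gamma alpha beta (Z t) (s - t).
  move=> cZ hZ; apply: (@flow_unique _ _ _ _ Z s t).
  - by move=> r /andP[h1 h2]; apply: hZ; rewrite h2 (lt_trans es h1).
  - by move=> r _; exact: cZ.
  - by rewrite lexx st.
  - by rewrite lexx st.
by rewrite (sol X) ?(sol Y) ?e0// => r /h[].
Qed.

Lemma pos_nbhd X (t : R) : continuous X -> 0 < (X t).1 ->
  exists2 e : R, 0 < e & forall s, `|s - t| < e -> 0 < (X s).1.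
Proof. by move=> cX; apply: near_cont_gt0; have /cont_pair[] := cX t. Qed.

Lemma neg_nbhd X (t : R) : continuous X -> (X t).1 < 0 ->
  exists2 e : R, 0 < e & forall s, `|s - t| < e -> (X s).1 < 0.
Proof.
move=> cX h; have /cont_pair[c1 _] := cX t.
have c1' : {for t, continuous (fun s => - (X s).1)} by exact: cvgN.
have [|e e0 he] := near_cont_gt0 _ _ 0 c1'; first by rewrite oppr_gt0.
by exists e => // s /he; rewrite oppr_gt0.
Qed.

Section TameUnique.
Variables (gammaL gammaR alphaL alphaR betaL betaR B : R).
Let fL := affine_field gammaL alphaL betaL.
Let fR := affine_field gammaR alphaR betaR.

Lemma tame_local X Y (t : R) : tame fL fR B X -> tame fL fR B Y -> X t = Y t ->
  ((X t).1 = 0 -> B < `|(X t).2|) ->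
  exists2 e : R, 0 < e & forall s, `|s - t| < e -> X s = Y s.
Proof.
move=> [cX XR XL Xr Xl] [cY YR YL Yr Yl] e0 hB.
have glue (gr ar br gl al bl : R) (e e' : R) : 0 < e -> 0 < e' ->
    (forall s, t < s < t + Num.min e e' ->
       solves_at (affine_field gr ar br) X s /\ solves_at (affine_field gr ar br) Y s) ->
    (forall s, t - Num.min e e' < s < t ->
       solves_at (affine_field gl al bl) X s /\ solves_at (affine_field gl al bl) Y s) ->
    exists2 e : R, 0 < e & forall s, `|s - t| < e -> X s = Y s.
  move=> p p' hr hl; exists (Num.min e e'); first by rewrite lt_min p.
  move=> s; rewrite ltr_distlC => /andP[h1 h2].
  have [ts|st] := leP t s.
    have h := agree_right gr ar br X Y t _ cX cY e0 hr s.
    by apply: h; bounds.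
  have h := agree_left gl al bl X Y t _ cX cY e0 hl s.
  by apply: h; bounds.
have [x0|x0|x0] := ltgtP (X t).1 0.
- have [e ep he] := neg_nbhd _ _ cX x0.
  have [|e' ep' he'] := neg_nbhd _ t cY; first by rewrite -e0.
  have m0 : 0 < Num.min e e' by rewrite lt_min ep.
  apply: (glue gammaL alphaL betaL gammaL alphaL betaL e e') => // s /andP[h1 h2].
    have [? ?] : `|s - t| < e /\ `|s - t| < e'.
      by apply/andP; rewrite -lt_min ltr_distlC; bounds.
    by split; [apply/XL/he|apply/YL/he'].
  have [? ?] : `|s - t| < e /\ `|s - t| < e'.
    by apply/andP; rewrite -lt_min ltr_distlC; bounds.
  by split; [apply/XL/he|apply/YL/he'].
- have [e ep he] := pos_nbhd _ _ cX x0.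
  have [|e' ep' he'] := pos_nbhd _ t cY; first by rewrite -e0.
  have m0 : 0 < Num.min e e' by rewrite lt_min ep.
  apply: (glue gammaR alphaR betaR gammaR alphaR betaR e e') => // s /andP[h1 h2].
    have [? ?] : `|s - t| < e /\ `|s - t| < e'.
      by apply/andP; rewrite -lt_min ltr_distlC; bounds.
    by split; [apply/XR/he|apply/YR/he'].
  have [? ?] : `|s - t| < e /\ `|s - t| < e'.
    by apply/andP; rewrite -lt_min ltr_distlC; bounds.
  by split; [apply/XR/he|apply/YR/he'].
have minl (e e' : R) : Num.min e e' <= e by rewrite ge_min lexx.
have minr (e e' : R) : Num.min e e' <= e' by rewrite ge_min lexx orbT.
move: (hB x0); rewrite ltr_normr => /orP[yB|yB].
  have [e ep he] := Xl _ x0 yB.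
  have [||e' ep' he'] := Yl t; rewrite -?e0//.
  apply: (glue gammaL alphaL betaL gammaR alphaR betaR e e') => // s /andP[h1 h2].
    have := minl e e'; have := minr e e' => ? ?.
    by split; [apply/XL; apply: (he s).1|apply/YL; apply: (he' s).1]; bounds.
  have := minl e e'; have := minr e e' => ? ?.
  by split; [apply/XR; apply: (he s).2|apply/YR; apply: (he' s).2]; bounds.
have {}yB : (X t).2 < - B by lra.
have [e ep he] := Xr _ x0 yB.
have [||e' ep' he'] := Yr t; rewrite -?e0//.
apply: (glue gammaR alphaR betaR gammaL alphaL betaL e e') => // s /andP[h1 h2].
  have := minl e e'; have := minr e e' => ? ?.
  by split; [apply/XR; apply: (he s).1|apply/YR; apply: (he' s).1]; bounds.
have := minl e e'; have := minr e e' => ? ?.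
by split; [apply/XL; apply: (he s).2|apply/YL; apply: (he' s).2]; bounds.
Qed.

(** Only X has to avoid the part |y| <= B of Sigma: local agreement is asked at times where Y agrees
    with X, and there Y avoids it too. *)
Lemma tame_unique X Y (t0 : R) : tame fL fR B X -> tame fL fR B Y -> X t0 = Y t0 ->
  (forall t, (X t).1 = 0 -> B < `|(X t).2|) -> forall t, X t = Y t.
Proof.
move=> tX tY e0 hB; apply: (agree_everywhere _ _ t0) => //.
- by case: tX.
- by case: tY.
by move=> t e; exact: (tame_local X Y t tX tY e (hB t)).
Qed.

Lemma solves_at_shift (f : R * R -> R * R) X (c t : R) :
  solves_at f X (t + c) -> solves_at f (fun s => X (s + c)) t.
Proof.
have d : is_derive t 1 (fun s : R => s + c) (1 : R) by der; rewrite addr0.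
move=> [d1 d2]; split.
  by apply: (isd_eq (isd_comp d d1)); rewrite mulr1.
by apply: (isd_eq (isd_comp d d2)); rewrite mulr1.
Qed.

Lemma tame_shift X (c : R) : tame fL fR B X -> tame fL fR B (fun t => X (t + c)).
Proof.
move=> [cX XR XL Xr Xl]; split.
- move=> t; apply: (@continuous_comp _ _ _ (fun t => t + c) X); last exact: cX.
  by apply: cvgD; [exact: cvg_id|exact: cvg_cst].
- by move=> t /XR; exact: solves_at_shift.
- by move=> t /XL; exact: solves_at_shift.
- move=> t x0 y0; have [e e0 he] := Xr _ x0 y0; exists e => // s.
  by split=> /andP[? ?]; have [h1 h2] := he (s + c); [apply: h1|apply: h2]; bounds.
- move=> t x0 y0; have [e e0 he] := Xl _ x0 y0; exists e => // s.
  by split=> /andP[? ?]; have [h1 h2] := he (s + c); [apply: h1|apply: h2]; bounds.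
Qed.
End TameUnique.
End Uniqueness.

(** * Crossing loops *)

Section Loops.
Context {R : realType}.
Variables (fL fR : R * R -> R * R).

(** Both arcs are complete orbits of the linear fields, of which only the times up to [tauR] and
    [tauL] are used. The heights of the two corners are left free, so that the heart, which passes
    through the tangency at the origin, is also a loop. *)
Record loop (r l : R -> R * R) (tauR tauL : R) : Prop := Loop {
  loop_tauR : 0 < tauR;
  loop_tauL : 0 < tauL;
  loop_r : forall t, solves_at fR r t;
  loop_l : forall t, solves_at fL l t;
  loop_rl : r tauR = l 0;
  loop_lr : l tauL = r 0;
  loop_x0 : (r 0).1 = 0;
  loop_x1 : (l 0).1 = 0;
  loop_right : forall t, 0 < t < tauR -> 0 < (r t).1;
  loop_left : forall t, 0 < t < tauL -> (l t).1 < 0 }.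

Lemma solves_at_near (f : R * R -> R * R) (X Y : R -> R * R) (t e : R) : 0 < e ->
  (forall s, `|s - t| < e -> Y s = X s) -> solves_at f Y t -> solves_at f X t.
Proof.
move=> e0 h [d1 d2]; have e1 := h t; rewrite subrr normr0 in e1.
split; rewrite -e1//.
  by apply: (near_is_derive (fun s => (Y s).1) _ _ _ _ e0) => // s /h ->.
by apply: (near_is_derive (fun s => (Y s).2) _ _ _ _ e0) => // s /h ->.
Qed.

Variables (r l : R -> R * R) (tauR tauL : R).
Hypothesis L : loop r l tauR tauL.

Definition loop_base (s : R) := if s <= tauR then r s else l (s - tauR).
Definition loop_solution (t : R) : R * R :=
  loop_base (t - (tauR + tauL) * (Num.floor (t / (tauR + tauL)))%:~R).

Let T := tauR + tauL.
Let T0 : 0 < T. Proof. by rewrite addr_gt0 ?(loop_tauR _ _ _ _ L) ?(loop_tauL _ _ _ _ L). Qed.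

Lemma loop_baseT : loop_base T = loop_base 0.
Proof.
rewrite /loop_base (ltW (loop_tauR _ _ _ _ L)) leNgt ltrDl (loop_tauL _ _ _ _ L) /=.
by have -> : T - tauR = tauL by [rewrite /T; ring]; rewrite (loop_lr _ _ _ _ L).
Qed.

Lemma loop_solutionE (k : int) (s : R) : 0 <= s <= T ->
  loop_solution (s + T * k%:~R) = loop_base s.
Proof.
move=> /andP[s0]; rewrite le_eqVlt => /predU1P[->|sT].
  have -> : T + T * k%:~R = T * (k + 1)%:~R by rewrite intrD; ring.
  rewrite /loop_solution -/T [X in Num.floor X]mulrC mulKf ?gt_eqF// intrKfloor.
  by rewrite subrr loop_baseT.
rewrite /loop_solution -/T.
have -> : Num.floor ((s + T * k%:~R) / T) = k.
  apply: Num.Theory.floor_def; rewrite ler_pdivlMr// ltr_pdivrMr//.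
  have -> : (k + 1)%:~R = k%:~R + 1 :> R by rewrite intrD.
  by bounds.
by rewrite addrK.
Qed.

Lemma loop_decomp (t : R) : exists (k : int) (s : R), t = s + T * k%:~R /\ 0 <= s < T.
Proof.
exists (Num.floor (t / T)), (t - T * (Num.floor (t / T))%:~R); split; first by ring.
have /andP[h1 h2] := Num.Theory.real_floor_itv (num_real (t / T)).
move: h1 h2; rewrite ler_pdivlMr// ltr_pdivrMr//.
have -> : (Num.floor (t / T) + 1)%:~R = (Num.floor (t / T))%:~R + 1 :> R by rewrite intrD.
by move=> h1 h2; bounds.
Qed.

Lemma loop_periodic (t : R) : loop_solution (t + T) = loop_solution t.
Proof.
have [k [s [-> /andP[s0 sT]]]] := loop_decomp t.
have -> : s + T * k%:~R + T = s + T * (k + 1)%:~R by rewrite intrD; ring.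
by rewrite !loop_solutionE// s0 ltW.
Qed.

Lemma loop_solution_r (s : R) : 0 <= s <= tauR -> loop_solution s = r s.
Proof.
move=> /andP[s0 s1]; have := loop_solutionE 0 s.
rewrite mulr0 addr0 => ->; last first.
  by rewrite s0 (le_trans s1)// lerDl ltW ?(loop_tauL _ _ _ _ L).
by rewrite /loop_base s1.
Qed.

Lemma loop_solution_l (s : R) : 0 <= s <= tauL -> loop_solution (tauR + s) = l s.
Proof.
move=> /andP[s0 s1]; have t0 := loop_tauR _ _ _ _ L; have := loop_solutionE 0 (tauR + s).
rewrite mulr0 addr0 => ->; last by apply/andP; split; rewrite /T; lra.
rewrite /loop_base; case: ifP => h; last by rewrite addrC addKr.
have -> : s = 0 by lra.
by rewrite addr0 (loop_rl _ _ _ _ L).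
Qed.

(** From t on, for a while, the periodic solution is a time translate of one of the two arcs. With
    the germ on the left of t this yields both continuity and piecewise smoothness, with no separate
    discussion of the corners. *)
Lemma loop_right_germ (t : R) : exists (c : R -> R * R) (e : R), [/\ 0 < e,
  forall s, t <= s < t + e -> loop_solution s = c s,
  {for t, continuous c} &
  (forall s, t < s < t + e -> 0 < (c s).1 /\ solves_at fR c s) \/
  (forall s, t < s < t + e -> (c s).1 < 0 /\ solves_at fL c s)].
Proof.
have [tR tL] := (loop_tauR _ _ _ _ L, loop_tauL _ _ _ _ L).
have [k [s [-> /andP[s0 sT]]]] := loop_decomp t.
pose d := T * k%:~R; rewrite -/d.
have sub q e : s + d <= q < s + d + e -> s + e <= T -> loop_solution q = loop_base (q - d).
  move=> /andP[q1 q2] eT; rewrite -(loop_solutionE k (q - d)) ?subrK//.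
  by bounds.
have [st|ts] := ltP s tauR.
  exists (fun q => r (q - d)), (tauR - s); split.
  - by rewrite subr_gt0.
  - move=> q hq; rewrite (sub _ _ hq); last by rewrite /T; lra.
    by rewrite /loop_base ifT//; move: hq => /andP[]; lra.
  - apply: (solves_at_cont fR); apply: solves_at_shift; exact: (loop_r _ _ _ _ L).
  - left=> q /andP[q1 q2]; split; last by apply: solves_at_shift; exact: (loop_r _ _ _ _ L).
    by apply: (loop_right _ _ _ _ L); bounds.
exists (fun q => l (q + (- d - tauR))), (T - s); split.
- by rewrite subr_gt0.
- move=> q hq; rewrite (sub _ _ hq); last by lra.
  rewrite /loop_base addrA; case: ifP => // h.
  have -> : q - d = tauR by move: hq => /andP[]; lra.
  by rewrite subrr (loop_rl _ _ _ _ L).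
- apply: (solves_at_cont fL); apply: solves_at_shift; exact: (loop_l _ _ _ _ L).
- right=> q /andP[q1 q2]; split; last by apply: solves_at_shift; exact: (loop_l _ _ _ _ L).
  by apply: (loop_left _ _ _ _ L); move: q1 q2; rewrite /T => q1 q2; bounds.
Qed.

Lemma loop_left_germ (t : R) : exists (c : R -> R * R) (e : R), [/\ 0 < e,
  forall s, t - e < s <= t -> loop_solution s = c s,
  {for t, continuous c} &
  (forall s, t - e < s < t -> 0 < (c s).1 /\ solves_at fR c s) \/
  (forall s, t - e < s < t -> (c s).1 < 0 /\ solves_at fL c s)].
Proof.
have [tR tL] := (loop_tauR _ _ _ _ L, loop_tauL _ _ _ _ L).
(* The remainder is taken in ]0, T] instead of [0, T[, so that the times just before t belong to the
   same period. *)
have [k [s [-> /andP[s0 sT]]]] : exists (k : int) (s : R), t = s + T * k%:~R /\ 0 < s <= T.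
  have [k [s [-> /andP[s0 sT]]]] := loop_decomp t.
  move: s0; rewrite le_eqVlt => /predU1P[<-|s0].
    by exists (k - 1), T; rewrite intrB T0 lexx; split=> //; ring.
  by exists k, s; rewrite s0 ltW.
pose d := T * k%:~R; rewrite -/d.
have sub q e : s + d - e < q <= s + d -> e <= s -> loop_solution q = loop_base (q - d).
  move=> /andP[q1 q2] eT; rewrite -(loop_solutionE k (q - d)) ?subrK//.
  by bounds.
have [st|ts] := leP s tauR.
  exists (fun q => r (q - d)), s; split => //.
  - move=> q hq; rewrite (sub _ _ hq)//.
    by rewrite /loop_base ifT//; move: hq => /andP[]; lra.
  - apply: (solves_at_cont fR); apply: solves_at_shift; exact: (loop_r _ _ _ _ L).
  - left=> q /andP[q1 q2]; split; last by apply: solves_at_shift; exact: (loop_r _ _ _ _ L).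
    by apply: (loop_right _ _ _ _ L); bounds.
exists (fun q => l (q + (- d - tauR))), (s - tauR); split.
- by rewrite subr_gt0.
- move=> q hq; rewrite (sub _ _ hq); last by lra.
  by rewrite /loop_base addrA ifF//; apply/negbTE; rewrite -ltNge; move: hq => /andP[]; lra.
- apply: (solves_at_cont fL); apply: solves_at_shift; exact: (loop_l _ _ _ _ L).
- right=> q /andP[q1 q2]; split; last by apply: solves_at_shift; exact: (loop_l _ _ _ _ L).
  by apply: (loop_left _ _ _ _ L); move: q1 q2 sT; rewrite /T => q1 q2 sT; bounds.
Qed.

Lemma loop_solution_cont : continuous loop_solution.
Proof.
move=> t; have [c [e [e0 h1 h2 _]]] := loop_right_germ t.
have [c' [e' [e'0 h1' h2' _]]] := loop_left_germ t.
have ht : t <= t < t + e by bounds.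
have ht' : t - e' < t <= t by bounds.
have ct : c t = c' t by rewrite -h1// h1'.
move=> A; rewrite [X in nbhs X](h1 _ ht) => nA.
have [d d0 hd] : nbhs t (c @^-1` A) by exact: h2.
have [d' d'0 hd'] : nbhs t (c' @^-1` A) by apply: h2'; rewrite -ct.
exists (Num.min (Num.min e e') (Num.min d d')); first by rewrite /= !lt_min e0 e'0 d0 d'0.
move=> s; rewrite /ball_/= !lt_min => /andP[/andP[se se'] /andP[sd sd']].
have [ts|st] := leP t s.
  have -> : loop_solution s = c s.
    by apply: h1; move: se; rewrite ltr_distlC => /andP[? ?]; bounds.
  exact: hd.
have -> : loop_solution s = c' s.
  by apply: h1'; move: se'; rewrite ltr_distlC => /andP[? ?]; bounds.
exact: hd'.
Qed.

Lemma loop_piecewise (t : R) : piecewise_smooth_at fL fR loop_solution t.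
Proof.
have [c [e [e0 h1 _ h2]]] := loop_right_germ t.
have [c' [e' [e'0 h1' _ h2']]] := loop_left_germ t.
exists (Num.min e e'); first by rewrite lt_min e0.
move=> s; rewrite lt_min normr_gt0 subr_eq0 => /and3P[st].
rewrite !ltr_distlC => /andP[s1 s2] /andP[s3 s4].
move: st; rewrite neq_lt => /orP[st|ts].
  have hs : t - e' < s <= t by bounds.
  have hs' : t - e' < s < t by bounds.
  pose d := Num.min (s - (t - e')) (t - s).
  have d0 : 0 < d by rewrite lt_min; bounds.
  have near q : `|q - s| < d -> c' q = loop_solution q.
    rewrite /d lt_min !ltr_distlC => /andP[/andP[? ?] /andP[? ?]]; apply/esym/h1'.
    by bounds.
  rewrite (h1' _ hs); case: h2' => /(_ _ hs')[x dx]; [left|right]; split=> //.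
    exact: (solves_at_near _ _ _ _ _ d0 near).
  exact: (solves_at_near _ _ _ _ _ d0 near).
have hs : t <= s < t + e by bounds.
have hs' : t < s < t + e by bounds.
pose d := Num.min (t + e - s) (s - t).
have d0 : 0 < d by rewrite lt_min; bounds.
have near q : `|q - s| < d -> c q = loop_solution q.
  rewrite /d lt_min !ltr_distlC => /andP[/andP[? ?] /andP[? ?]]; apply/esym/h1.
  by bounds.
rewrite (h1 _ hs); case: h2 => /(_ _ hs')[x dx]; [left|right]; split=> //.
  exact: (solves_at_near _ _ _ _ _ d0 near).
exact: (solves_at_near _ _ _ _ _ d0 near).
Qed.

Lemma loop_filippov (I : set R) : continuous fL -> continuous fR ->
  filippov_solution (filippov fL fR) I loop_solution.
Proof.
move=> cL cR; apply: piecewise_filippov_solution => //; first exact: loop_solution_cont.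
exact: loop_piecewise.
Qed.

Lemma loop_range (t : R) : (exists2 s, 0 <= s <= tauR & loop_solution t = r s) \/
  (exists2 s, 0 <= s <= tauL & loop_solution t = l s).
Proof.
have [k [s [-> /andP[s0 sT]]]] := loop_decomp t.
rewrite loop_solutionE ?s0 ?ltW//= /loop_base; case: ifPn => [st|].
  by left; exists s => //; rewrite s0.
rewrite -ltNge => ts; right; exists (s - tauR) => //.
by move: sT; rewrite /T => sT; bounds.
Qed.

Lemma loop_not_constant : exists t, loop_solution t <> loop_solution 0.
Proof.
have tR := loop_tauR _ _ _ _ L.
have h0 : 0 < tauR / 2 < tauR by bounds.
have h1 : 0 <= tauR / 2 <= tauR by bounds.
have h2 : (0 : R) <= 0 <= tauR by bounds.
exists (tauR / 2) => e; have := loop_right _ _ _ _ L _ h0.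
by rewrite -(loop_solution_r _ h1) e (loop_solution_r _ h2) (loop_x0 _ _ _ _ L) ltxx.
Qed.

Lemma loop_periodic_orbit : periodic_orbit loop_solution.
Proof. by split; [exists T => //; exact: loop_periodic|exact: loop_not_constant]. Qed.

End Loops.

(** * Spirals *)

Section Trigo.
Context {R : realType}.
Implicit Types t s c x : R.
Let pi0 : 0 < pi :> R := pi_gt0 R.

Lemma unit_circle_angle c s : c ^+ 2 + s ^+ 2 = 1 ->
  exists2 t : R, 0 <= t < pi *+ 2 & cos t = c /\ sin t = s.
Proof.
move=> cs; have c1 : -1 <= c <= 1.
  by apply/andP; split; have := sqr_ge0 s; nra.
have [s0|s0] := leP 0 s.
  exists (acos c); last first.
    split; first by rewrite acosK// in_itv.
    by rewrite sin_acos// -cs addrC addKr sqrtr_sqr ger0_norm.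
  rewrite acos_ge0//=; have := acos_lepi c1; have := pi0; lra.
exists (pi *+ 2 - acos c); last first.
  have e : pi *+ 2 - acos c = - acos c + pi *+ 2 by ring.
  rewrite e cosD2pi sinD2pi cosN sinN; split; first by rewrite acosK// in_itv.
  by rewrite sin_acos// -cs addrC addKr sqrtr_sqr ltr0_norm// opprK.
have h := acos_lepi c1; have h' := acos_gt0; have h0 := pi0.
apply/andP; split; first lra.
suff : 0 < acos c by lra.
by apply: acos_gt0; case/andP: c1 => -> /= c1; rewrite lt_neqAle c1 andbT; apply/eqP => ce; move: cs; rewrite ce; nra.
Qed.

Lemma sin_gt0_0pi t : 0 < t < pi -> 0 < sin t.
Proof. exact: sin_gt0_pi. Qed.

Lemma sin_lt0_pi2pi t : pi < t < pi *+ 2 -> sin t < 0.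
Proof.
move=> /andP[h1 h2]; have -> : t = t - pi + pi by ring.
by rewrite sinDpi oppr_lt0; apply: sin_gt0_pi; bounds.
Qed.

Lemma cos_eq1 x : `|x| < pi *+ 2 -> cos x = 1 -> x = 0.
Proof.
move=> x2; have -> : x = (x / 2) *+ 2 by field.
rewrite cos_mulr2n => h.
have s0 : sin (x / 2) = 0.
  by have := cos2Dsin2 (x / 2); move: h; rewrite -[_ ^+ 2 *+ 2]mulr_natl => h h'; apply/eqP; rewrite -sqrf_eq0; apply/eqP; lra.
move: x2; rewrite ltr_norml => /andP[x1 x2].
have [y0|y0|->] := ltgtP (x / 2) 0; last by rewrite mul0rn.
  have : 0 < sin (- (x / 2)) by apply: sin_gt0_pi; bounds.
  by rewrite sinN s0; lra.
have : 0 < sin (x / 2) by apply: sin_gt0_pi; bounds.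
by rewrite s0 ltxx.
Qed.

End Trigo.

(** * Logarithmic polar coordinates about a focus *)

Section Arcs.
Context {R : realType}.
Variables (gamma xr : R).
Implicit Types (k t s a b : R) (p : R * R).
Let pi0 : 0 < pi :> R := pi_gt0 R.
Notation E t := (expR (gamma * t)).
Notation D := (1 + gamma ^+ 2).
Let D0 : 0 < D := D_gt0 gamma.

Definition gfun t : R := E t * (cos t - gamma * sin t).
Definition hfun t : R := D * (E t * sin t).
(* Since gfun' = - hfun and hfun vanishes at the multiples of pi, this is the orbit of the field
   with focus abscissa xr, translated in time so that the abscissa is extremal at these times. *)
Definition spiral_curve k t : R * R :=
  (xr - k * gfun t, 2 * gamma * (xr - k * gfun t) - k * hfun t).

Lemma gfun_der t : is_derive t 1 gfun (- hfun t).
Proof. by rewrite /gfun /hfun; der; ring. Qed.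

Lemma gfun_cont t : {for t, continuous gfun}.
Proof. exact: isd_cont (gfun_der t). Qed.

Lemma hfun_der t : is_derive t 1 hfun (2 * gamma * hfun t + D * gfun t).
Proof. by rewrite /gfun /hfun; der; ring. Qed.

Lemma hfun_cont t : {for t, continuous hfun}.
Proof. exact: isd_cont (hfun_der t). Qed.

Lemma arc_solves (alpha k t : R) : xr = alpha / D ->
  solves_at (affine_field gamma alpha 0) (spiral_curve k) t.
Proof.
move=> xrE; have -> : alpha = xr * D by rewrite xrE divfK// gt_eqF.
rewrite /solves_at /affine_field /spiral_curve /=.
have := gfun_der t; have := hfun_der t => ? ?.
by split; der; ring.
Qed.

Lemma arc_cont k : continuous (spiral_curve k).
Proof.
move=> t; have := @arc_solves (xr * D) k t; rewrite mulfK ?gt_eqF// => /(_ erefl).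
exact: solves_at_cont.
Qed.

Lemma gfun0 : gfun 0 = 1.
Proof. by rewrite /gfun mulr0 expR0 cos0 sin0; ring. Qed.
Lemma gfunpi : gfun pi = - E pi.
Proof. by rewrite /gfun cospi sinpi; ring. Qed.
Lemma gfun2pi : gfun (pi *+ 2) = E (pi *+ 2).
Proof. by rewrite /gfun cos2pi sin2pi; ring. Qed.

Lemma hfun_gt0 t : 0 < t < pi -> 0 < hfun t.
Proof. by move=> /sin_gt0_0pi h; rewrite /hfun !mulr_gt0// expR_gt0. Qed.
Lemma hfun_lt0 t : pi < t < pi *+ 2 -> hfun t < 0.
Proof. by move=> /sin_lt0_pi2pi h; rewrite /hfun pmulr_rlt0// pmulr_rlt0// expR_gt0. Qed.

Lemma gfun_dec s t : 0 <= s -> s < t -> t <= pi -> gfun t < gfun s.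
Proof.
move=> s0 st tpi; apply: (isd_gt (fun r => - hfun r)) => // r /andP[h1 h2].
  split; first exact: gfun_der.
  by rewrite oppr_lt0; apply: hfun_gt0; bounds.
exact: gfun_cont.
Qed.

Lemma gfun_inc s t : pi <= s -> s < t -> t <= pi *+ 2 -> gfun s < gfun t.
Proof.
move=> s0 st tpi; apply: (isd_lt (fun r => - hfun r)) => // r /andP[h1 h2].
  split; first exact: gfun_der.
  by rewrite oppr_gt0; apply: hfun_lt0; bounds.
exact: gfun_cont.
Qed.

(** In these coordinates t is the time along the orbit and k labels the orbit, up to the factor E (2
    pi) gained in each turn. *)
Lemma arc_polar p : exists k t, [/\ 0 <= k, 0 <= t < pi *+ 2 & p = spiral_curve k t].
Proof.
(* S and C are the values that k E(t) sin t and k E(t) cos t must take, solved from the coordinates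
   of p. Their modulus [rho] is k E(t), and their angle is t. *)
have [S SD] : exists S, S * D = 2 * gamma * p.1 - p.2.
  by exists ((2 * gamma * p.1 - p.2) / D); rewrite divfK// gt_eqF.
have [C CE] : exists C, C = xr - p.1 + gamma * S by exists (xr - p.1 + gamma * S).
pose rho := Num.sqrt (C ^+ 2 + S ^+ 2).
have rho2 : rho ^+ 2 = C ^+ 2 + S ^+ 2 by rewrite sqr_sqrtr// addr_ge0// sqr_ge0.
have pE k t : k * (E t * cos t) = C -> k * (E t * sin t) = S -> p = spiral_curve k t.
  move=> hC hS; have -> : spiral_curve k t = (xr - (C - gamma * S), 2 * gamma * (xr - (C - gamma * S)) - S * D).
    by rewrite /spiral_curve /gfun /hfun -hC -hS; congr pair; ring.
  rewrite SD CE; case: (p) => x y /=; congr pair; ring.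
have rho0 : 0 <= rho by exact: sqrtr_ge0.
have [r0|r0] := eqVneq rho 0.
  exists 0, 0; split=> //; first by rewrite lexx mulrn_wgt0.
  move: rho2; rewrite r0 expr0n /= => /esym/eqP.
  rewrite paddr_eq0 ?sqr_ge0// !sqrf_eq0 => /andP[/eqP C0 /eqP S0].
  by apply: pE; rewrite mul0r.
have [|t t2 [ct st]] := @unit_circle_angle R (C / rho) (S / rho).
  by rewrite !expr_div_n -mulrDl -rho2 divff// sqrf_eq0.
exists (rho * expR (- (gamma * t))), t; split=> //.
  by rewrite mulr_ge0// expR_ge0.
have EE : expR (- (gamma * t)) * E t = 1 by rewrite -expRD addNr expR0.
by apply: pE; rewrite -mulrA [X in _ * X]mulrA EE mul1r ?ct ?st mulrC divfK.
Qed.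

(** Moduli and then angles are compared. The size k' may vanish, so that the focus can be compared
    with a spiral. Angles that differ by 2 pi are excluded: they give a point two representations,
    with sizes in the ratio E (2 pi). *)
Lemma arc_inj k k' t t' : 0 < k -> 0 <= k' -> `|t - t'| < pi *+ 2 ->
  spiral_curve k t = spiral_curve k' t' -> k = k' /\ t = t'.
Proof.
move=> k0 k'0 tt' e; have e1 := congr1 fst e; have e2 := congr1 snd e.
rewrite /spiral_curve /= in e1 e2.
have eg : k * gfun t = k' * gfun t' by exact/oppr_inj/(addrI xr).
have eh : k * hfun t = k' * hfun t' by move: e2; rewrite eg => e2; exact/oppr_inj/(addrI _ e2).
have eS : k * E t * sin t = k' * E t' * sin t'.
  by move: eh; rewrite /hfun => eh; apply: (mulfI (lt0r_neq0 D0)); move: eh; rewrite -!mulrA !(mulrCA D).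
have eC : k * E t * cos t = k' * E t' * cos t'.
  have cE q s : q * E s * cos s = q * gfun s + gamma * (q * E s * sin s).
    by rewrite /gfun; ring.
  by rewrite cE [RHS]cE eg eS.
have K0 : 0 < k * E t by rewrite mulr_gt0// expR_gt0.
have K'0 : 0 <= k' * E t' by rewrite mulr_ge0// expR_ge0.
have eK : k * E t = k' * E t'.
  have : (k * E t) ^+ 2 = (k' * E t') ^+ 2.
    rewrite -[LHS]mulr1 -[RHS]mulr1 -{1}(cos2Dsin2 t) -(cos2Dsin2 t') !mulrDr -!exprMn.
    by rewrite eC eS.
  by move/eqP; rewrite eqrXn2// ?ltW// => /eqP.
have ct : cos t = cos t' by apply: (mulfI (lt0r_neq0 K0)); rewrite eC eK.
have st : sin t = sin t' by apply: (mulfI (lt0r_neq0 K0)); rewrite eS eK.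
have tE : t = t'.
  apply/eqP; rewrite -subr_eq0; apply/eqP; apply: cos_eq1 => //.
  by rewrite cosB ct st -!expr2 cos2Dsin2.
split=> //; move: eK; rewrite tE => /mulIf; apply.
by rewrite gt_eqF// expR_gt0.
Qed.

End Arcs.

(** * Arcs of spirals in the right half-plane *)

Section HalfPlane.
Context {R : realType}.
Variables (gamma xr : R).
Implicit Types (k t s a b : R) (p : R * R).
Let pi0 : 0 < pi :> R := pi_gt0 R.
Notation E t := (expR (gamma * t)).
Notation D := (1 + gamma ^+ 2).
Notation g := (gfun gamma).
Notation h := (hfun gamma).
Local Notation spiral := (spiral_curve gamma xr).

(* k is the size of a spiral crossing x = 0 on both sides of its farthest point t = pi. *)
Definition wide k : Prop :=
  [/\ 0 < k, xr < k, xr < k * E (pi *+ 2) & - xr < k * E pi].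
(** Equality is allowed at t = 0 and t = 2 pi. There the spiral meets Sigma at the origin,
    tangentially, which is the case of the heart. *)
Definition weakly_wide k : Prop :=
  [/\ 0 < k, xr <= k, xr <= k * E (pi *+ 2) & - xr < k * E pi].

Lemma wideW k : wide k -> weakly_wide k.
Proof. by case=> *; split=> //; exact: ltW. Qed.

Lemma arc_x_gt0 k t : (0 < (spiral k t).1) = (k * g t < xr).
Proof. by rewrite /= subr_gt0. Qed.

(** On [0, 2 pi] the function g decreases up to pi and then increases, so k g takes the value xr
    once on each branch and is smaller exactly in between. *)
Lemma weakly_wide_arc k : weakly_wide k -> exists a b,
  [/\ 0 <= a < pi, pi < b <= pi *+ 2, k * g a = xr, k * g b = xr &
      forall t, 0 <= t <= pi *+ 2 -> (k * g t < xr) = (a < t < b)].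
Proof.
move=> [k0 k1 k2 k3].
have ckg t : {for t, continuous (fun t => k * g t)}.
  by apply: cvgM; [exact: cvg_cst|exact: gfun_cont].
have kpi : k * g pi < xr by rewrite gfunpi; lra.
have [|a /andP[a0 api] ea] := ivt xr (ltW pi0) (fun t _ => ckg t).
  by right; rewrite gfun0 mulr1 k1 ltW.
have pi2 : pi <= pi *+ 2 :> R by have := pi0; lra.
have [|b /andP[b0 b2] eb] := ivt xr pi2 (fun t _ => ckg t).
  by left; rewrite gfun2pi k2 ltW.
have {}api : a < pi by rewrite lt_neqAle api andbT; apply/eqP => e; move: kpi; rewrite -e ea ltxx.
have {}b0 : pi < b by rewrite lt_neqAle b0 andbT; apply/eqP => e; move: kpi; rewrite e eb ltxx.
exists a, b; split; rewrite ?a0 ?b0//.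
move=> t /andP[t0 t2]; apply/idP/andP => [kt|[t1 t3]].
  split; rewrite ltNge; apply/negP => ht.
    have : k * g a <= k * g t.
      rewrite ler_pM2l//; move: ht; rewrite le_eqVlt => /predU1P[->//|ht].
      by apply/ltW/gfun_dec => //; exact: ltW.
    by rewrite ea; lra.
  have : k * g b <= k * g t.
    rewrite ler_pM2l//; move: ht; rewrite le_eqVlt => /predU1P[->//|ht].
    by apply/ltW/gfun_inc => //; exact: ltW.
  by rewrite eb; lra.
have [tpi|pit] := leP t pi.
  by rewrite -ea ltr_pM2l//; apply: gfun_dec.
by rewrite -eb ltr_pM2l//; apply: gfun_inc => //; exact: ltW.
Qed.

Lemma wide_arc k : wide k -> exists a b,
  [/\ 0 < a < pi, pi < b < pi *+ 2, k * g a = xr, k * g b = xr &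
      forall t, 0 <= t <= pi *+ 2 -> (k * g t < xr) = (a < t < b)].
Proof.
move=> kw; have [a [b [/andP[a0 a1] /andP[b0 b1] ea eb hab]]] := weakly_wide_arc _ (wideW _ kw).
have [k0 k1 k2 _] := kw.
exists a, b; split=> //; rewrite ?a1 ?b0 ?andbT/=.
  by rewrite lt_neqAle a0 andbT; apply/eqP => e; move: k1; rewrite -ea -e gfun0 mulr1 ltxx.
by rewrite lt_neqAle b1 andbT; apply/eqP => e; move: k2; rewrite -eb e gfun2pi ltxx.
Qed.

Lemma spiral_x_ge0 k a b : weakly_wide k -> 0 <= a < pi -> pi < b <= pi *+ 2 ->
  k * g a = xr -> k * g b = xr ->
  (forall t, 0 <= t <= pi *+ 2 -> (k * g t < xr) = (a < t < b)) ->
  forall t, 0 <= t <= pi *+ 2 -> (0 <= (spiral k t).1) = (a <= t <= b).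
Proof.
move=> [k0 _ _ _] /andP[a0 a1] /andP[b1 b2] ea eb hab t t02.
rewrite /= subr_ge0; have /andP[t0 t2] := t02.
rewrite le_eqVlt hab//; apply/orP/andP => [[/eqP e|/andP[h1 h2]]|[]]; last first.
- rewrite le_eqVlt => /predU1P[<- _|h1]; first by left; rewrite ea.
  rewrite le_eqVlt => /predU1P[->|h2]; first by left; rewrite eb.
  by right; rewrite h1.
- by rewrite !ltW.
- split; rewrite leNgt; apply/negP => ht.
    have : k * g a < k * g t by rewrite ltr_pM2l//; apply: gfun_dec => //; exact: ltW.
    by rewrite ea e ltxx.
  have : k * g b < k * g t by rewrite ltr_pM2l//; apply: gfun_inc => //; exact: ltW.
  by rewrite eb e ltxx.
Qed.

Lemma arc_y k t : k * g t = xr -> spiral k t = (0, - (k * h t)).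
Proof. by move=> e; rewrite /spiral e subrr mulr0 sub0r. Qed.

(** When the focus is not in the open right half-plane, every spiral that reaches this half-plane
    also leaves it in both time directions. Only the reach at the farthest point t = pi has to be
    checked. *)
Lemma polar_half_plane p : 0 <= p.1 -> xr <= 0 -> p <> (0, 0) ->
  exists k t, [/\ wide k, 0 <= t < pi *+ 2 & p = spiral k t].
Proof.
move=> p0 x0 pn0; have [k [t [k0 t2 e]]] := arc_polar gamma xr p.
exists k, t; split => //.
have hx : k * g t <= xr by move: p0; rewrite e /= subr_ge0.
have {}k0 : 0 < k.
  rewrite lt_neqAle k0 andbT; apply/eqP => k00; move: hx; rewrite -k00 mul0r => x0'.
  have x00 : xr = 0 by apply/le_anti; rewrite x0.
  by apply: pn0; rewrite e -k00 /spiral_curve x00; congr pair; ring.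
have kE t' : 0 < k * E t' by rewrite mulr_gt0// expR_gt0.
have k1 : 0 < k * E (pi *+ 2) by [].
split=> //; [lra|lra|].
rewrite ltNge; apply/negP => hk.
(* Otherwise the spiral does not get beyond Sigma, so p can only be its farthest point, at angle pi;
   as h vanishes there, p would be the origin. *)
have tpi : t = pi.
  have [tp|tp|//] := ltgtP t pi.
    have : k * g pi < k * g t.
      by rewrite ltr_pM2l//; apply: gfun_dec => //; case/andP: t2.
    by rewrite gfunpi; lra.
  have : k * g pi < k * g t.
    by rewrite ltr_pM2l//; apply: gfun_inc => //; case/andP: t2 => _ /ltW.
  by rewrite gfunpi; lra.
apply: pn0; rewrite e arc_y.
  by rewrite tpi /hfun sinpi !mulr0 oppr0.
by apply/le_anti; rewrite hx /= tpi gfunpi; lra.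
Qed.

(** Below the origin h > 0, so the angle lies in ]0, pi[ and xr < k. With a real focus the spiral
    must also come back to Sigma, xr < k E (2 pi), which gamma >= 0 guarantees; for gamma < 0 it may
    wind into the focus. *)
Lemma polar_sigma_neg y : y < 0 -> (0 < xr -> 0 <= gamma) ->
  exists k t, [/\ wide k, 0 <= t < pi *+ 2 & (0, y) = spiral k t].
Proof.
move=> y0 hg; have [k [t [k0 t2 e]]] := arc_polar gamma xr (0, y).
exists k, t; split => //.
have hx : k * g t = xr by have := congr1 fst e; rewrite /=; lra.
have hy : 0 < k * h t by move: e; rewrite arc_y// => -[]; lra.
have {}k0 : 0 < k by rewrite lt_neqAle k0 andbT; apply/eqP => k00; move: hy; rewrite -k00 mul0r ltxx.
have ht : 0 < h t by rewrite -(pmulr_rgt0 _ k0).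
have tpi : 0 < t < pi.
  case/andP: t2 => t0 t2; apply/andP; split.
    rewrite lt_neqAle t0 andbT; apply/eqP => e0; move: ht.
    by rewrite -e0 /hfun sin0 !mulr0 ltxx.
  rewrite ltNge le_eqVlt; apply/negP => /predU1P[e0|pt].
    by move: ht; rewrite -e0 /hfun sinpi !mulr0 ltxx.
  by have := @hfun_lt0 _ gamma t; rewrite pt t2 => /(_ isT); lra.
have [t0 t1] := andP tpi.
have g1 : g t < 1 by rewrite -(gfun0 gamma); apply: gfun_dec => //; exact: ltW.
have g2 : - E pi < g t by rewrite -gfunpi; apply: gfun_dec => //; exact: ltW.
have k1 : xr < k by rewrite -hx gtr_pMr.
split=> //.
  have [x0|x0] := ltP 0 xr; last by apply: le_lt_trans x0 _; rewrite mulr_gt0// expR_gt0.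
  have E1 : 1 <= E (pi *+ 2).
    by rewrite -[leLHS]expR0 ler_expR mulr_ge0 ?hg// mulrn_wge0// ltW.
  by apply: (lt_le_trans k1); rewrite ler_peMr// ltW.
by rewrite -hx -mulrN ltr_pM2l//; lra.
Qed.

(** The time-reversed counterpart: above the origin the angle lies in ]pi, 2 pi[, and xr < k E (2
    pi) is the inequality that comes for free. *)
Lemma polar_sigma_pos y : 0 < y -> (0 < xr -> gamma <= 0) ->
  exists k t, [/\ wide k, 0 <= t < pi *+ 2 & (0, y) = spiral k t].
Proof.
move=> y0 hg; have [k [t [k0 t2 e]]] := arc_polar gamma xr (0, y).
exists k, t; split => //.
have hx : k * g t = xr by have := congr1 fst e; rewrite /=; lra.
have hy : k * h t < 0 by move: e; rewrite arc_y// => -[]; lra.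
have {}k0 : 0 < k by rewrite lt_neqAle k0 andbT; apply/eqP => k00; move: hy; rewrite -k00 mul0r ltxx.
have ht : h t < 0 by rewrite -(pmulr_rlt0 _ k0).
have tpi : pi < t < pi *+ 2.
  case/andP: t2 => t0 t2; rewrite t2 andbT ltNge le_eqVlt; apply/negP => /predU1P[e0|pt].
    by move: ht; rewrite e0 /hfun sinpi !mulr0 ltxx.
  move: t0; rewrite le_eqVlt => /predU1P[e0|t0].
    by move: ht; rewrite -e0 /hfun sin0 !mulr0 ltxx.
  by have := @hfun_gt0 _ gamma t; rewrite pt t0 => /(_ isT); lra.
have [t0 t1] := andP tpi.
have g1 : g t < E (pi *+ 2) by rewrite -gfun2pi; apply: gfun_inc => //; exact: ltW.
have g2 : - E pi < g t by rewrite -gfunpi; apply: gfun_inc => //; exact: ltW.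
have k1 : xr < k * E (pi *+ 2) by rewrite -hx ltr_pM2l.
split=> //.
  have [x0|x0] := ltP 0 xr; last by apply: le_lt_trans x0 _.
  have E1 : E (pi *+ 2) <= 1.
    by rewrite -[leRHS]expR0 ler_expR mulr_le0_ge0 ?hg// mulrn_wge0// ltW.
  by apply: (lt_le_trans k1); rewrite ler_piMr// ltW.
by rewrite -hx -mulrN ltr_pM2l//; lra.
Qed.

Lemma arc_bound (K : R) : exists M : R, forall k t, 0 <= k <= K -> 0 <= t <= pi *+ 2 ->
  `|spiral k t| <= M.
Proof.
pose M := expR (`|gamma| * (pi *+ 2)).
pose G := M * (1 + `|gamma|).
pose X := `|xr| + K * G.
exists (Num.max X (2 * `|gamma| * X + K * (D * M))) => k t /andP[k0 kK] /andP[t0 t2].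
have EM : E t <= M.
  rewrite ler_expR; apply: (@le_trans _ _ (`|gamma| * t)).
    by rewrite ler_wpM2r// ler_norm.
  by rewrite ler_wpM2l.
have M0 : 0 <= M by exact: expR_ge0.
have Et0 : 0 <= E t by exact: expR_ge0.
have hg : `|g t| <= G.
  rewrite /gfun normrM ger0_norm//; apply: ler_pM => //.
  apply: le_trans (ler_normB _ _) _; rewrite lerD ?cos_max// normrM.
  by rewrite ler_piMr// sin_max.
have hh : `|h t| <= D * M.
  have D0 : 0 <= D by exact: ltW (D_gt0 gamma).
  rewrite /hfun normrM (ger0_norm D0) ler_wpM2l// normrM ger0_norm//.
  by rewrite -[M]mulr1 ler_pM// sin_max.
have hX : `|xr - k * g t| <= X.
  apply: le_trans (ler_normB _ _) _; rewrite lerD// normrM ger0_norm//.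
  by apply: ler_pM.
rewrite prod_normE /= ge_max; apply/andP; split; rewrite le_max.
  by rewrite hX.
apply/orP; right; apply: le_trans (ler_normB _ _) _; rewrite lerD//.
  rewrite normrM ler_pM// normrM ger0_norm//.
by rewrite normrM ger0_norm//; apply: ler_pM.
Qed.

Lemma polar_far : exists r : R, forall p, 0 <= p.1 -> r < `|p| ->
  exists k t, [/\ wide k, 0 <= t < pi *+ 2 & p = spiral k t].
Proof.
have [x0|x0] := leP xr 0.
  exists 0 => p p0; rewrite normr_gt0 => /eqP pn0; exact: polar_half_plane.
have E0 := expR_gt0 (gamma * (pi *+ 2)).
(* Beyond this size both xr < k and xr < k E (2 pi) hold; spirals of size at most K stay in a
   bounded region. *)
pose K := xr * Num.max 1 (E (pi *+ 2))^-1.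
have [M hM] := arc_bound K.
exists M => p p0 pM; have [k [t [k0 t2 e]]] := arc_polar gamma xr p.
exists k, t; split => //.
have kK : K < k.
  rewrite ltNge; apply/negP => kK; have := hM k t; rewrite k0 kK => /(_ isT).
  by case/andP: t2 => -> /ltW -> => /(_ isT); rewrite -e; lra.
have K1 : xr <= K by apply: ler_peMr; [exact: ltW|rewrite le_max lexx].
have K2 : xr <= K * E (pi *+ 2).
  rewrite -[leLHS]mulr1 -mulrA; rewrite ler_pM2l// -ler_pdivrMr// div1r.
  by rewrite le_max lexx orbT.
have kp : 0 < k by move: (kK); lra.
split=> //; first by lra.
  by apply: (le_lt_trans K2); rewrite ltr_pM2r.
by have : 0 < k * E pi by [rewrite mulr_gt0// expR_gt0]; lra.
Qed.
End HalfPlane.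

(** * Orbits through the points of a crossing loop *)

Section CrossingLoops.
Context {R : realType}.
Variables (gammaL gammaR alphaL alphaR : R).
Let fL := affine_field gammaL alphaL 0.
Let fR := affine_field gammaR alphaR 0.
Let F := filippov fL fR.
Implicit Types (X r l : R -> R * R) (p : R * R).

Lemma filippov_tame0 X : filippov_solution F setT X -> tame fL fR 0 X.
Proof.
move=> h; have := @filippov_tame R gammaL gammaR alphaL alphaR 0 X.
by rewrite oppr0 normr0; apply.
Qed.

Lemma loop_filippov0 (I : set R) r l tauR tauL : loop fL fR r l tauR tauL ->
  filippov_solution F I (loop_solution r l tauR tauL).
Proof. by move=> L; apply: loop_filippov L _ _ _; exact: affine_field_cont. Qed.

Definition on_crossing_loop p : Prop := exists r l tauR tauL,
  [/\ loop fL fR r l tauR tauL, (r 0).2 < 0, 0 < (l 0).2 &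
      exists t, loop_solution r l tauR tauL t = p].

Lemma crossing_loop_sigma r l tauR tauL t : loop fL fR r l tauR tauL ->
  (r 0).2 < 0 -> 0 < (l 0).2 -> (loop_solution r l tauR tauL t).1 = 0 ->
  (loop_solution r l tauR tauL t).2 != 0.
Proof.
move=> L r0 l0.
have [[s /andP[s0 s1] ->]|[s /andP[s0 s1] ->]] := loop_range _ _ _ _ _ _ L t => x0.
  have [->|sn0] := eqVneq s 0; first by rewrite lt_eqF.
  have [->|sn1] := eqVneq s tauR; first by rewrite (loop_rl _ _ _ _ _ _ L) gt_eqF.
  have hs : 0 < s < tauR by apply/andP; split; rewrite lt_neqAle ?s0 ?s1 ?sn1// eq_sym sn0.
  by have := loop_right _ _ _ _ _ _ L s hs; rewrite x0 ltxx.
have [->|sn0] := eqVneq s 0; first by rewrite gt_eqF.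
have [->|sn1] := eqVneq s tauL; first by rewrite (loop_lr _ _ _ _ _ _ L) lt_eqF.
have hs : 0 < s < tauL by apply/andP; split; rewrite lt_neqAle ?s0 ?s1 ?sn1// eq_sym sn0.
by have := loop_left _ _ _ _ _ _ L s hs; rewrite x0 ltxx.
Qed.

(** For b = 0 the origin is the only point of Sigma at which [tame] says nothing, and a loop with
    corners of opposite heights avoids it. *)
Lemma crossing_loop_unique r l tauR tauL t X : loop fL fR r l tauR tauL ->
  (r 0).2 < 0 -> 0 < (l 0).2 -> filippov_solution F setT X ->
  forall t0, X t0 = loop_solution r l tauR tauL t ->
  X = fun s => loop_solution r l tauR tauL (s + (t - t0)).
Proof.
move=> L r0 l0 sX t0 e; apply/funext => s; apply/esym.
have tL := filippov_tame0 _ (loop_filippov0 setT _ _ _ _ L).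
apply: (tame_unique _ _ _ _ _ _ _ _ _ t0 (tame_shift _ _ _ _ _ _ _ _ (t - t0) tL) (filippov_tame0 _ sX)).
  by rewrite e; congr loop_solution; ring.
move=> u x0; rewrite normr_gt0; exact: crossing_loop_sigma.
Qed.

Lemma on_crossing_loop_orbit (Q : (R -> R * R) -> Prop) p :
  (forall r l tauR tauL t, loop fL fR r l tauR tauL -> (r 0).2 < 0 -> 0 < (l 0).2 ->
     Q (fun s => loop_solution r l tauR tauL (s + t))) ->
  on_crossing_loop p -> orbit_through F Q p.
Proof.
move=> hQ [r [l [tauR [tauL [L r0 l0 [t <-]]]]]]; split.
  exists (fun s => loop_solution (fun s => r s) l tauR tauL (s + t)); last by rewrite add0r.
  have cX : continuous (fun s => loop_solution r l tauR tauL (s + t)).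
    move=> s; apply: (@continuous_comp _ _ _ (fun s => s + t)).
      by apply: cvgD; [exact: cvg_id|exact: cvg_cst].
    exact: loop_solution_cont L _.
  apply: piecewise_filippov_solution => //; [exact: affine_field_cont|exact: affine_field_cont|].
  move=> s; have [e e0 he] := loop_piecewise _ _ _ _ _ _ L (s + t); exists e => // u us.
  have {}us : 0 < `|u + t - (s + t)| < e by rewrite opprD addrACA subrr addr0.
  by case: (he _ us) => -[x0 d]; [left|right]; split=> //; exact: solves_at_shift.
move=> X sX X0.
have := crossing_loop_unique _ _ _ _ t _ L r0 l0 sX 0 (esym (esym X0)).
by rewrite subr0 => ->; exact: hQ.
Qed.

Lemma periodic_shift X t : periodic_orbit X -> periodic_orbit (fun s => X (s + t)).
Proof.
move=> [[T T0 hT] [u hu]]; split; first by exists T => // s; rewrite addrAC hT.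
have [e|ne] := pselect (X (0 + t) = X 0).
  by exists (u - t); rewrite subrK e.
by exists (- t); rewrite addNr => /esym.
Qed.

Lemma on_crossing_loop_periodic p : on_crossing_loop p -> orbit_through F periodic_orbit p.
Proof.
apply: on_crossing_loop_orbit => r l tauR tauL t L r0 l0.
exact/periodic_shift/(loop_periodic_orbit _ _ _ _ _ _ L).
Qed.

Lemma on_crossing_loop_crossing p : on_crossing_loop p -> crossing_periodic_set fL fR p.
Proof.
apply: on_crossing_loop_orbit => r l tauR tauL t L r0 l0; split.
- exact/periodic_shift/(loop_periodic_orbit _ _ _ _ _ _ L).
- exists (- t); rewrite addNr (loop_solution_r _ _ _ _ _ _ L) ?(loop_x0 _ _ _ _ _ _ L)//.
  by rewrite lexx ltW// (loop_tauR _ _ _ _ _ _ L).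
(* For b = 0 both horizontal velocities on Sigma are - y, and their product is y^2. *)
- move=> s x0; split=> //; rewrite /fL /fR /affine_field /= x0 !mulr0 !sub0r !addr0 mulrNN.
  by rewrite -expr2 exprn_even_gt0//; exact: crossing_loop_sigma x0.
Qed.

(** The constant solution is one of the orbits through p and is not a periodic orbit. This also
    covers points of Sigma where only a convex combination of the fields vanishes. *)
Lemma not_through_equilibrium p : F p (0, 0) -> ~ orbit_through F periodic_orbit p.
Proof.
move=> /constant_filippov_solution s0 [_ h].
by have [_ [t]] := h _ (s0 setT) erefl.
Qed.

End CrossingLoops.

(** * Loops of a focus and its mirror image *)

Section ReversibleLoops.
Context {R : realType}.
Variables (gamma alpha : R).
Let fL := affine_field (- gamma) (- alpha) 0.
Let fR := affine_field gamma alpha 0.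
Notation xr := (alpha / (1 + gamma ^+ 2)).
Notation spiral := (spiral_curve gamma xr).
Notation g := (gfun gamma).
Notation h := (hfun gamma).
Implicit Types (k t a b : R) (p : R * R).

Lemma flip_xK : involutive (@flip_x R).
Proof. by case=> x y; rewrite /flip_x /= opprK. Qed.

Definition right_half k a t := spiral k (a + t).
Definition left_half k b t := flip_x (spiral k (b - t)).

Lemma right_half_solves k a t : solves_at fR (right_half k a) t.
Proof.
have -> : right_half k a = (fun s => spiral k (s + a)).
  by apply/funext => s; rewrite /right_half (addrC a).
by apply: solves_at_shift; exact: arc_solves.
Qed.

Lemma left_half_solves k b t : solves_at fL (left_half k b) t.
Proof.
have [d1 d2] : solves_at fR (spiral k) (b - t) by exact: arc_solves.
have d : is_derive t 1 (fun s : R => b - s) (-1 : R) by der; ring.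
rewrite /left_half /flip_x; split.
  refine (isd_eq (isd_opp (isd_comp d d1)) _).
  by rewrite /fL /fR /affine_field /=; ring.
refine (isd_eq (isd_comp d d2) _).
by rewrite /fL /fR /affine_field /=; ring.
Qed.

Lemma reversible_loop k a b : 0 <= a < pi -> pi < b <= pi *+ 2 ->
  k * g a = xr -> k * g b = xr ->
  (forall t, 0 <= t <= pi *+ 2 -> (k * g t < xr) = (a < t < b)) ->
  loop fL fR (right_half k a) (left_half k b) (b - a) (b - a).
Proof.
move=> /andP[a0 a1] /andP[b1 b2] ea eb hab.
have xa : spiral k a = (0, - (k * h a)) by exact: arc_y.
have xb : spiral k b = (0, - (k * h b)) by exact: arc_y.
split; rewrite /right_half /left_half ?addr0 ?subr0 ?subKr ?xa ?xb /flip_x /= ?oppr0 //.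
- by lra.
- by lra.
- exact: right_half_solves.
- exact: left_half_solves.
- by have -> : a + (b - a) = b by [ring]; rewrite xb.
- move=> t /andP[t0 t1]; rewrite subr_gt0 hab; bounds.
- move=> t /andP[t0 t1]; rewrite oppr_lt0 subr_gt0 hab; bounds.
Qed.

Lemma reversible_loop_range k a b t : 0 <= a < pi -> pi < b <= pi *+ 2 ->
  k * g a = xr -> k * g b = xr ->
  (forall t, 0 <= t <= pi *+ 2 -> (k * g t < xr) = (a < t < b)) ->
  a <= t <= b ->
  (exists s, loop_solution (right_half k a) (left_half k b) (b - a) (b - a) s = spiral k t) /\
  (exists s, loop_solution (right_half k a) (left_half k b) (b - a) (b - a) s = flip_x (spiral k t)).
Proof.
move=> ha hb ea eb hab /andP[t1 t2]; have L := reversible_loop _ _ _ ha hb ea eb hab.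
split.
  exists (t - a); rewrite (loop_solution_r _ _ _ _ _ _ L); last by bounds.
  by rewrite /right_half; congr spiral; ring.
exists ((b - a) + (b - t)); rewrite (loop_solution_l _ _ _ _ _ _ L); last by bounds.
by rewrite /left_half; congr (flip_x (spiral _ _)); ring.
Qed.

Lemma wide_on_crossing_loop k t : wide gamma xr k -> 0 <= t <= pi *+ 2 ->
  0 <= (spiral k t).1 ->
  on_crossing_loop (- gamma) gamma (- alpha) alpha (spiral k t) /\
  on_crossing_loop (- gamma) gamma (- alpha) alpha (flip_x (spiral k t)).
Proof.
move=> kw t02; have [a [b [ha hb ea eb hab]]] := wide_arc _ _ _ kw.
have ha' : 0 <= a < pi by case/andP: ha => /ltW ->.
have hb' : pi < b <= pi *+ 2 by case/andP: hb => -> /ltW ->.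
rewrite (spiral_x_ge0 _ _ _ _ _ (wideW _ _ _ kw) ha' hb' ea eb hab _ t02) => tab.
have L := reversible_loop _ _ _ ha' hb' ea eb hab.
have [k0 _ _ _] := kw.
have [s1 s2] := reversible_loop_range _ _ _ _ ha' hb' ea eb hab tab.
have r0 : (right_half k a 0).2 < 0.
  by rewrite /right_half addr0 (arc_y _ _ _ _ ea) /= oppr_lt0 mulr_gt0// hfun_gt0.
have l0 : 0 < (left_half k b 0).2.
  by rewrite /left_half subr0 (arc_y _ _ _ _ eb) /= oppr_gt0 pmulr_rlt0// hfun_lt0.
by split; exists (right_half k a), (left_half k b), (b - a), (b - a).
Qed.

End ReversibleLoops.

(** * Two centers *)

Section SigmaArcs.
Context {R : realType}.
Variables (gamma xr : R).
Notation g := (gfun gamma).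
Notation h := (hfun gamma).
Notation spiral := (spiral_curve gamma xr).

Definition wide_ends (k a b : R) : Prop :=
  [/\ 0 < a < pi, pi < b < pi *+ 2, k * g a = xr, k * g b = xr &
      forall t, 0 <= t <= pi *+ 2 -> (k * g t < xr) = (a < t < b)].

Lemma wide_ends_x_ge0 k a b t : wide gamma xr k -> wide_ends k a b ->
  0 <= t <= pi *+ 2 -> (0 <= (spiral k t).1) = (a <= t <= b).
Proof.
move=> kw [ha hb ea eb hab].
have ha' : 0 <= a < pi by case/andP: ha => /ltW ->.
have hb' : pi < b <= pi *+ 2 by case/andP: hb => -> /ltW ->.
exact: (spiral_x_ge0 _ _ _ _ _ (wideW _ _ _ kw) ha' hb' ea eb hab).
Qed.

Lemma wide_ends_sigma k a b t : wide gamma xr k -> wide_ends k a b ->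
  0 <= t <= pi *+ 2 -> k * g t = xr -> t = a \/ t = b.
Proof.
move=> kw kab t02 e; have := wide_ends_x_ge0 _ _ _ _ kw kab t02.
rewrite /= e subrr lexx => /esym/andP[at_ tb].
have [_ _ _ _ hab] := kab; have := hab t t02; rewrite e ltxx => /esym/negbT.
rewrite negb_and -!leNgt => /orP[?|?]; [left|right]; apply/le_anti; apply/andP; split=> //.
Qed.

Lemma sigma_neg_wide_ends y : y < 0 -> (0 < xr -> 0 <= gamma) ->
  exists k a b, [/\ wide gamma xr k, wide_ends k a b & (0, y) = spiral k a].
Proof.
move=> y0 hg; have [k [t [kw t02 e]]] := polar_sigma_neg _ _ _ y0 hg.
have [a [b kab]] := wide_arc _ _ _ kw; exists k, a, b; split=> //.
have t02' : 0 <= t <= pi *+ 2 by case/andP: t02 => -> /ltW.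
have eg : k * g t = xr by have := congr1 fst e; rewrite /=; lra.
have [<-//|tb] := wide_ends_sigma _ _ _ _ kw kab t02' eg.
have [k0 _ _ _] := kw; have [_ /hfun_lt0 hb _ eb _] := kab.
move: e; rewrite tb arc_y// => -[ey]; exfalso.
by have := hb gamma; rewrite -(pmulr_rlt0 _ k0); lra.
Qed.

Lemma sigma_pos_wide_ends y : 0 < y -> (0 < xr -> gamma <= 0) ->
  exists k a b, [/\ wide gamma xr k, wide_ends k a b & (0, y) = spiral k b].
Proof.
move=> y0 hg; have [k [t [kw t02 e]]] := polar_sigma_pos _ _ _ y0 hg.
have [a [b kab]] := wide_arc _ _ _ kw; exists k, a, b; split=> //.
have t02' : 0 <= t <= pi *+ 2 by case/andP: t02 => -> /ltW.
have eg : k * g t = xr by have := congr1 fst e; rewrite /=; lra.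
have [ta|<-//] := wide_ends_sigma _ _ _ _ kw kab t02' eg.
have [k0 _ _ _] := kw; have [/hfun_gt0 ha _ ea _ _] := kab.
move: e; rewrite ta arc_y// => -[ey]; exfalso.
by have := ha gamma; rewrite -(pmulr_rgt0 _ k0); lra.
Qed.

End SigmaArcs.

(** * Loops made of two circular arcs *)

Section CenterLoops.
Context {R : realType}.
Variables (alphaL alphaR : R).
Let fL := affine_field 0 alphaL 0.
Let fR := affine_field 0 alphaR 0.
Notation xr a := (a / (1 + 0 ^+ 2)).
Implicit Types (k t a b : R) (p : R * R).

Lemma solves_at_opp gamma alpha (X : R -> R * R) t :
  solves_at (affine_field gamma (- alpha) 0) X t ->
  solves_at (affine_field gamma alpha 0) (fun s => - X s) t.
Proof.
move=> [d1 d2]; split; [apply: (isd_eq (isd_opp d1))|apply: (isd_eq (isd_opp d2))].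
  by rewrite /affine_field /=; ring.
by rewrite /affine_field /=; ring.
Qed.

(** For gamma = 0 the two ends have the same cosine, and their sines have opposite signs: an arc
    that starts at (0, y) ends at (0, - y). *)
Lemma circle_symmetry (x k a b : R) : 0 < k -> wide_ends 0 x k a b -> hfun 0 b = - hfun 0 a.
Proof.
move=> k0 [ha hb ea eb _].
have : gfun 0 a = gfun 0 b by apply: (mulfI (lt0r_neq0 k0)); rewrite ea eb.
have sa := sin_gt0_0pi _ ha; have sb := sin_lt0_pi2pi _ hb.
rewrite /gfun /hfun !mul0r expR0 !subr0 !mul1r => ec.
rewrite -mulrN; congr (_ * _); apply/eqP; rewrite -subr_eq0 opprK.
have : (sin b + sin a) * (sin a - sin b) = 0.
  by have := cos2Dsin2 a; have := cos2Dsin2 b; rewrite ec; nra.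
by move/eqP; rewrite mulf_eq0 => /orP[//|]; rewrite subr_eq0 => /eqP; lra.
Qed.

(** The left arc is a right arc of the field with parameter - alphaL, rotated by p |-> - p. As both
    arcs exchange (0, y) and (0, - y), arcs of different sizes fit together once their ends are at
    the same distance from the origin. *)
Lemma center_loop kR a b kL a' b' : wide 0 (xr alphaR) kR -> wide 0 (xr (- alphaL)) kL ->
  wide_ends 0 (xr alphaR) kR a b -> wide_ends 0 (xr (- alphaL)) kL a' b' ->
  kR * hfun 0 a = kL * hfun 0 a' ->
  loop fL fR (right_half 0 alphaR kR a) (fun t => - right_half 0 (- alphaL) kL a' t)
       (b - a) (b' - a').
Proof.
move=> [kR0 _ _ _] [kL0 _ _ _] abR abL eh.
have hR := circle_symmetry _ _ _ _ kR0 abR; have hL := circle_symmetry _ _ _ _ kL0 abL.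
have [/andP[a0 a1] /andP[b0 b1] ea eb hab] := abR.
have [/andP[a0' a1'] /andP[b0' b1'] ea' eb' hab'] := abL.
have eab : a + (b - a) = b by ring.
have eab' : a' + (b' - a') = b' by ring.
have oE (x y : R) : - (x, y) = (- x, - y) by [].
split; rewrite /right_half ?addr0 ?eab ?eab' ?(arc_y _ _ _ _ ea) ?(arc_y _ _ _ _ eb)
  ?(arc_y _ _ _ _ ea') ?(arc_y _ _ _ _ eb') ?oE ?oppr0 ?hR ?hL //.
- by lra.
- by lra.
- exact: right_half_solves.
- by move=> t; apply: solves_at_opp; exact: right_half_solves.
- by rewrite opprK mulrN opprK eh.
- by rewrite mulrN !opprK eh.
- move=> t /andP[t0 t1]; rewrite subr_gt0 hab; bounds.
- move=> t /andP[t0 t1]; rewrite oppr_lt0 subr_gt0 hab'; bounds.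
Qed.

Lemma center_loop_points kR a b kL a' b' t : wide 0 (xr alphaR) kR -> wide 0 (xr (- alphaL)) kL ->
  wide_ends 0 (xr alphaR) kR a b -> wide_ends 0 (xr (- alphaL)) kL a' b' ->
  kR * hfun 0 a = kL * hfun 0 a' ->
  (a <= t <= b -> on_crossing_loop 0 0 alphaL alphaR (spiral_curve 0 (xr alphaR) kR t)) /\
  (a' <= t <= b' -> on_crossing_loop 0 0 alphaL alphaR (- spiral_curve 0 (xr (- alphaL)) kL t)).
Proof.
move=> wR wL abR abL eh; have L := center_loop _ _ _ _ _ _ wR wL abR abL eh.
have [kR0 _ _ _] := wR; have [kL0 _ _ _] := wL.
have [ha _ ea _ _] := abR; have [ha' _ ea' _ _] := abL.
have r0 : (right_half 0 alphaR kR a 0).2 < 0.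
  by rewrite /right_half addr0 (arc_y _ _ _ _ ea) /= oppr_lt0 mulr_gt0// hfun_gt0.
have l0 : 0 < (- right_half 0 (- alphaL) kL a' 0).2.
  by rewrite /right_half addr0 (arc_y _ _ _ _ ea') /= opprK mulr_gt0// hfun_gt0.
split=> /andP[t1 t2].
  exists (right_half 0 alphaR kR a), (fun t => - right_half 0 (- alphaL) kL a' t), (b - a), (b' - a').
  split=> //; exists (t - a); rewrite (loop_solution_r _ _ _ _ _ _ L); last by bounds.
  by rewrite /right_half; congr spiral_curve; ring.
exists (right_half 0 alphaR kR a), (fun t => - right_half 0 (- alphaL) kL a' t), (b - a), (b' - a').
split=> //; exists ((b - a) + (t - a')); rewrite (loop_solution_l _ _ _ _ _ _ L); last by bounds.
by rewrite /right_half; congr (- spiral_curve _ _ _ _); ring.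
Qed.

Lemma center_right_on_loop k t : wide 0 (xr alphaR) k -> 0 <= t <= pi *+ 2 ->
  0 <= (spiral_curve 0 (xr alphaR) k t).1 ->
  on_crossing_loop 0 0 alphaL alphaR (spiral_curve 0 (xr alphaR) k t).
Proof.
move=> kw t02; have [a [b kab]] := wide_arc _ _ _ kw.
rewrite (wide_ends_x_ge0 _ _ _ _ _ _ kw kab t02) => tab.
have [k0 _ _ _] := kw; have [/hfun_gt0 ha _ _ _ _] := kab.
have y0 : - (k * hfun 0 a) < 0 by rewrite oppr_lt0 mulr_gt0.
(* The matching left arc is the one through the starting point of the right arc; its existence is
   unconditional because gamma = 0. *)
have [|k' [a' [b' [kw' kab' e]]]] := sigma_neg_wide_ends 0 (xr (- alphaL)) _ y0 _; first by [].
have [_ _ ea' _ _] := kab'.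
have eh : k * hfun 0 a = k' * hfun 0 a' by move: e; rewrite arc_y// => -[/oppr_inj].
by have [h _] := center_loop_points _ _ _ _ _ _ t kw kw' kab kab' eh; exact: h.
Qed.

Lemma center_left_on_loop k t : wide 0 (xr (- alphaL)) k -> 0 <= t <= pi *+ 2 ->
  0 <= (spiral_curve 0 (xr (- alphaL)) k t).1 ->
  on_crossing_loop 0 0 alphaL alphaR (- spiral_curve 0 (xr (- alphaL)) k t).
Proof.
move=> kw t02; have [a [b kab]] := wide_arc _ _ _ kw.
rewrite (wide_ends_x_ge0 _ _ _ _ _ _ kw kab t02) => tab.
have [k0 _ _ _] := kw; have [/hfun_gt0 ha _ _ _ _] := kab.
have y0 : - (k * hfun 0 a) < 0 by rewrite oppr_lt0 mulr_gt0.
have [|k' [a' [b' [kw' kab' e]]]] := sigma_neg_wide_ends 0 (xr alphaR) _ y0 _; first by [].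
have [_ _ ea' _ _] := kab'.
have eh : k' * hfun 0 a' = k * hfun 0 a by move: e; rewrite arc_y// => -[/oppr_inj].
by have [_ h] := center_loop_points _ _ _ _ _ _ t kw' kw kab' kab eh; exact: h.
Qed.

End CenterLoops.

(** * Reversing symmetries and rotation of Filippov systems *)

Section Reversibility.
Context {R : realType}.
Variables (fL fR : R * R -> R * R).
Let F := filippov fL fR.

Lemma pair_oppE (x y : R) : - (x, y) = (- x, - y). Proof. by []. Qed.

Lemma pair_combE (s r : R) (u w : R * R) :
  s *: u + r *: w = (s * u.1 + r * w.1, s * u.2 + r * w.2).
Proof. by []. Qed.

Lemma flip_yK : involutive (@flip_y R).
Proof. by case=> x y; rewrite /flip_y /= opprK. Qed.

Lemma reversible_involution (S : R * R -> R * R) : involutive S ->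
  (forall v, S (- v) = - S v) -> (forall p v, F p v -> F (S p) (- S v)) -> reversible F S.
Proof.
move=> SK SN h p; apply/seteqP; split=> v.
  by move=> /h; rewrite SK => hv; exists (- S v) => //; rewrite SN SK opprK.
by move=> [w /h hw <-].
Qed.

Lemma reversible_flip_y : (forall p, fL (flip_y p) = - flip_y (fL p)) ->
  (forall p, fR (flip_y p) = - flip_y (fR p)) -> reversible F flip_y.
Proof.
move=> hL hR; apply: reversible_involution; [exact: flip_yK| |].
  by case=> x y; rewrite /flip_y !pair_oppE /= opprK.
move=> p v [[p0 ->]|[p0 ->]|[p0 [s s01 ->]]].
- by apply: Or31; rewrite hL.
- by apply: Or32; rewrite hR.
- apply: Or33; split=> //; exists s => //; rewrite hL hR.
  case: (fL p) (fR p) => [a b] [c d]; rewrite !pair_combE /flip_y !pair_oppE /=.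
  by congr pair; ring.
Qed.

Lemma reversible_flip_x : (forall p, fL (flip_x p) = - flip_x (fR p)) ->
  (forall p, fR (flip_x p) = - flip_x (fL p)) -> reversible F flip_x.
Proof.
move=> hL hR; apply: reversible_involution; [exact: flip_xK| |].
  by case=> x y; rewrite /flip_x !pair_oppE.
move=> p v [[p0 ->]|[p0 ->]|[p0 [s /andP[s0 s1] ->]]].
- by apply: Or32; rewrite hR /= oppr_gt0.
- by apply: Or31; rewrite hL /= oppr_lt0.
- apply: Or33; split; first by rewrite /= p0 oppr0.
  (* The reflection exchanges the two fields, hence also their weights. *)
  exists (1 - s); first by bounds.
  rewrite hL hR; case: (fL p) (fR p) => [a b] [c d]; rewrite !pair_combE /flip_x !pair_oppE /=.
  by congr pair; ring.
Qed.

Lemma primitive_filippov_solution (G : R * R -> set (R * R)) (X v : R -> R * R) :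
  primitive (fun t => (X t).1) (fun t => (v t).1) ->
  primitive (fun t => (X t).2) (fun t => (v t).2) ->
  {ae @lebesgue_measure R, forall t, G (X t) (v t)} -> filippov_solution G setT X.
Proof.
move=> p1 p2 h; exists v; split; last by apply: ae_mono h => u.
by move=> s t st _; have [i1 e1] := p1 _ _ st; have [i2 e2] := p2 _ _ st.
Qed.

(** The rotation p |-> - p exchanges the half-planes and keeps the direction of time; it reduces a
    virtual right center to a virtual left one. *)
Lemma filippov_solution_opp (gL gR : R * R -> R * R) (X : R -> R * R) :
  (forall p, gL (- p) = - fR p) -> (forall p, gR (- p) = - fL p) ->
  filippov_solution F setT X -> filippov_solution (filippov gL gR) setT (fun t => - X t).
Proof.
move=> hL hR /filippov_solution_primitive[v [p1 p2 h]].
apply: (@primitive_filippov_solution _ _ (fun t => - v t)).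
- exact: (primitiveN _ _ p1).
- exact: (primitiveN _ _ p2).
apply: ae_mono h => t [[x0 ->]|[x0 ->]|[x0 [s /andP[s0 s1] ->]]].
- by apply: Or32; rewrite hR /= oppr_gt0.
- by apply: Or31; rewrite hL /= oppr_lt0.
apply: Or33; split; first by rewrite /= x0 oppr0.
exists (1 - s); first by bounds.
rewrite hL hR; case: (fL _) (fR _) => [a b] [c d]; rewrite !pair_combE !pair_oppE /=.
by congr pair; ring.
Qed.

End Reversibility.

(** * A single linear center *)

Section Centers.
Context {R : realType}.

Lemma smooth_solution_flow (gamma alpha beta : R) (X : R -> R * R) :
  smooth_solution (affine_field gamma alpha beta) X ->
  forall t, X t = flow gamma alpha beta (X 0) t.
Proof.
move=> /smooth_solutionP h t; rewrite -{2}(subr0 t).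
have cX s : {for s, continuous X} := solves_at_cont _ _ _ (h s).
have [t0|t0] := leP 0 t.
  by apply: (@flow_unique _ _ _ _ X 0 t); rewrite ?lexx ?t0//.
by apply: (@flow_unique _ _ _ _ X t 0); rewrite ?lexx ?ltW//.
Qed.

Variable alpha : R.
Notation xc := (alpha / (1 + 0 ^+ 2)).

Lemma flow_center (p : R * R) t : flow 0 alpha 0 p t =
  (xc + ((p.1 - xc) * cos t - p.2 * sin t), p.2 * cos t + (p.1 - xc) * sin t).
Proof. by rewrite /flow /focus /= !mul0r expR0; congr pair; ring. Qed.

Lemma linear_center : linear_center_at (affine_field 0 alpha 0) (xc, 0).
Proof.
have e : (1 + 0 ^+ 2 : R) * xc - alpha = 0 by rewrite mulrCA divff ?mulr1 ?subrr// gt_eqF// D_gt0.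
split; first by rewrite /affine_field /= e; congr pair; ring.
move=> X /smooth_solution_flow hX X0; split.
  exists (pi *+ 2); first by rewrite mulrn_wgt0// pi_gt0.
  by move=> t; rewrite hX [RHS]hX !flow_center cosD2pi sinD2pi.
exists pi; rewrite hX flow_center cospi sinpi => e'; apply: X0.
move: e'; case: (X 0) => x y /= [e1 e2]; congr pair; lra.
Qed.

Lemma center_symmetric : symmetric_wrt_x_axis (affine_field 0 alpha 0).
Proof.
move=> X /smooth_solution_flow hX.
suff key t : exists s, X s = flip_y (X t).
  apply/seteqP; split=> p.
    by move=> [q [t _ <-] <-]; have [s e] := key t; exists s.
  by move=> [t _ <-]; have [s e] := key t; exists (X s); [exists s|rewrite e flip_yK].
pose u := (X 0).1 - xc; pose v := - (X 0).2.
have hX' r : X r = (xc + (u * cos r + v * sin r), u * sin r - v * cos r).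
  by rewrite hX flow_center /u /v; congr pair; ring.
have [rho [th [eu ev]]] : exists rho th, u = rho * cos th /\ v = rho * sin th.
  pose rho := Num.sqrt (u ^+ 2 + v ^+ 2).
  have rho2 : rho ^+ 2 = u ^+ 2 + v ^+ 2 by rewrite sqr_sqrtr// addr_ge0// sqr_ge0.
  have [r0|r0] := eqVneq rho 0.
    exists 0, 0; move: rho2; rewrite r0 expr0n /= => /esym/eqP.
    by rewrite paddr_eq0 ?sqr_ge0// !sqrf_eq0 !mul0r => /andP[/eqP -> /eqP ->].
  have [|th _ [ct st]] := @unit_circle_angle R (u / rho) (v / rho).
    by rewrite [X in X + _]expr_div_n [X in _ + X]expr_div_n -mulrDl -rho2 divff// sqrf_eq0.
  by exists rho, th; rewrite ct st ![rho * _]mulrC !divfK.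
(* The orbit is the circle with angle t - th about the center, so reflection in the x-axis replaces
   the time t by 2 th - t. *)
exists (th - (t - th)); rewrite !hX' /flip_y /= eu ev; congr pair.
  have -> : rho * cos th * cos (th - (t - th)) + rho * sin th * sin (th - (t - th)) =
    rho * cos (th - (th - (t - th))) by rewrite [in RHS]cosB; ring.
  have -> : rho * cos th * cos t + rho * sin th * sin t = rho * cos (t - th) by rewrite [in RHS]cosB; ring.
  by congr (_ + _ * cos _); ring.
have -> : rho * cos th * sin (th - (t - th)) - rho * sin th * cos (th - (t - th)) =
    rho * sin (th - (t - th) - th) by rewrite [in RHS]sinB; ring.
have -> : rho * cos th * sin t - rho * sin th * cos t = rho * sin (t - th) by rewrite [in RHS]sinB; ring.
by rewrite -mulrN -sinN; congr (_ * sin _); ring.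
Qed.

End Centers.

(** * Two centers: the annulus and the global center *)

Section CenterAnnulus.
Context {R : realType}.
Notation xr a := (a / (1 + 0 ^+ 2)).

Lemma xrN (gamma a : R) : (- a) / (1 + gamma ^+ 2) = - (a / (1 + gamma ^+ 2)).
Proof. by rewrite mulNr. Qed.

Lemma center_annulus (alphaL alphaR : R) :
  has_period_annulus_at_infinity (affine_field 0 alphaL 0) (affine_field 0 alphaR 0).
Proof.
have [rR hR] := polar_far 0 (xr alphaR); have [rL hL] := polar_far 0 (xr (- alphaL)).
exists (Num.max rR rL) => p; rewrite gt_max => /andP[pR pL].
apply: on_crossing_loop_crossing.
have [p0|p0] := leP 0 p.1.
  have [k [t [kw /andP[t0 t2] e]]] := hR _ p0 pR; rewrite e.
  by apply: center_right_on_loop; rewrite -?e// t0 ltW.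
have p0' : 0 <= (- p).1 by rewrite oppr_ge0 ltW.
have [|k [t [kw /andP[t0 t2] e]]] := hL _ p0'; first by rewrite normrN.
by rewrite -(opprK p) e; apply: center_left_on_loop; rewrite -?e// t0 ltW.
Qed.

Section Origin.
Variables (alphaL alphaR : R).
Hypotheses (aL : 0 < alphaL) (aR : 0 < alphaR).
Let F := filippov (affine_field 0 alphaL 0) (affine_field 0 alphaR 0).

(* The common tangency at the origin is invisible for the left field and visible for the right one. *)
Lemma origin_touching (Y : R -> R * R) (s : R) : filippov_solution F setT Y -> Y s = (0, 0) ->
  exists2 e : R, 0 < e & forall u, 0 < `|u - s| < e -> 0 < (Y u).1.
Proof.
move=> /filippov_solution_primitive[v [p1 p2 h]] Ys.
have c1 := primitive_cont _ _ p1; have c2 := primitive_cont _ _ p2.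
(* For gamma = 0 and b = 0 both fields have horizontal velocity - y, so the abscissa is
   differentiable even on Sigma. *)
have d1 (u : R) : is_derive u (1 : R) (fun t => (Y t).1) (- (Y u).2).
  apply: (primitive_der _ _ (fun u => - (Y u).2) u 1 p1) => //.
    by apply: cvgN; exact: c2.
  apply: ae_mono h => t ht _; move: ht.
  apply: (filippov_convex _ _ (fun w => w.1 = - (Y t).2)).
  - by move=> u' w r _; rewrite pair_combE /= => -> ->; ring.
  - by rewrite /affine_field /=; ring.
  - by rewrite /affine_field /=; ring.
pose m := Num.min alphaL alphaR / 2.
have m0 : 0 < m by rewrite divr_gt0// lt_min aL.
have mL : m < alphaL.
  have : Num.min alphaL alphaR <= alphaL by rewrite ge_min lexx.
  by move: m0; rewrite /m; lra.
have mR : m < alphaR.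
  have : Num.min alphaL alphaR <= alphaR by rewrite ge_min lexx orbT.
  by move: m0; rewrite /m; lra.
have cx : {for s, continuous (fun t => - (1 + 0 ^+ 2) * (Y t).1)}.
  by apply: cvgM; [exact: cvg_cst|exact: c1].
have [|eL eL0 hL] := near_cont_gt0 _ _ (m - alphaL) cx; first by rewrite Ys /=; lra.
have [|eR eR0 hR] := near_cont_gt0 _ _ (m - alphaR) cx; first by rewrite Ys /=; lra.
exists (Num.min eL eR); first by rewrite lt_min eL0.
(* Near the origin both vertical velocities are below - m. So y > 0 just before s and y < 0 just
   after, and x' = - y makes x have a strict minimum at s. *)
have dec a b : a <= b -> `|a - s| < Num.min eL eR -> `|b - s| < Num.min eL eR ->
    (Y b).2 - (Y a).2 <= - m * (b - a).
  move=> ab; rewrite !lt_min !ltr_distlC => /andP[/andP[? ?] /andP[? ?]] /andP[/andP[? ?] /andP[? ?]].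
  apply: (primitive_le _ _ _ _ _ p2 ab); apply: ae_mono h => t ht /andP[? ?].
  have : - (1 + 0 ^+ 2) * (Y t).1 > m - alphaL by apply: hL; rewrite ltr_distlC; bounds.
  have : - (1 + 0 ^+ 2) * (Y t).1 > m - alphaR by apply: hR; rewrite ltr_distlC; bounds.
  move=> h1 h2; move: ht; apply: (filippov_convex _ _ (fun w => w.2 <= - m)).
  - by move=> u' w r /andP[r0 r1]; rewrite pair_combE /=; nra.
  - by rewrite /affine_field /=; lra.
  - by rewrite /affine_field /=; lra.
have ss : `|s - s| < Num.min eL eR by rewrite subrr normr0 lt_min eL0.
move=> u /andP[us ue].
have near t : Num.min s u <= t <= Num.max s u -> `|t - s| < Num.min eL eR.
  move=> /andP[t1 t2]; apply: le_lt_trans ue.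
  move: t1 t2; case: (leP s u) => su t1 t2.
    by rewrite !ger0_norm ?subr_ge0//; lra.
  by rewrite !ler0_norm ?subr_le0//; lra.
have [su|su|su] := ltgtP s u; last by move: us; rewrite su subrr normr0 ltxx.
- have -> : 0 = (Y s).1 by rewrite Ys.
  apply: (@isd_lt _ (fun t => (Y t).1) (fun t => - (Y t).2) _ _ su) => t /andP[t1 t2]; last exact: c1.
  split; first exact: d1.
  have nt : `|t - s| < Num.min eL eR by apply: near; rewrite (min_l (ltW su)) (max_r (ltW su)) !ltW.
  have := dec s t (ltW t1) ss nt; rewrite Ys /= subr0 => h'.
  have : 0 < m * (t - s) by rewrite mulr_gt0// subr_gt0.
  lra.
- have -> : 0 = (Y s).1 by rewrite Ys.
  apply: (@isd_gt _ (fun t => (Y t).1) (fun t => - (Y t).2) _ _ su) => t /andP[t1 t2]; last exact: c1.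
  split; first exact: d1.
  have nt : `|t - s| < Num.min eL eR by apply: near; rewrite (min_r (ltW su)) (max_l (ltW su)) !ltW.
  have := dec t s (ltW t2) nt ss; rewrite Ys /= => h'.
  have : 0 < m * (s - t) by rewrite mulr_gt0// subr_gt0.
  lra.
Qed.

(** These circles about the real right center do not enter the left half-plane. The largest touches
    Sigma at the origin, where the general uniqueness argument is silent and [origin_touching]
    replaces it. *)
Lemma inner_circle_orbit (k t0 : R) : 0 < k <= xr alphaR ->
  orbit_through F periodic_orbit (spiral_curve 0 (xr alphaR) k t0).
Proof.
move=> /andP[k0 kx]; pose C s := spiral_curve 0 (xr alphaR) k (s + t0).
have gE t : gfun 0 t = cos t by rewrite /gfun !mul0r expR0 subr0 mul1r.
have hE t : hfun 0 t = (1 + 0 ^+ 2) * sin t by rewrite /hfun mul0r expR0 mul1r.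
have dC s : solves_at (affine_field 0 alphaR 0) C s.
  by apply: solves_at_shift; exact: arc_solves.
have cC : continuous C by move=> s; exact: solves_at_cont (dC s).
have x0 s : 0 <= (C s).1.
  rewrite /C /= gE subr_ge0 (le_trans _ kx)// ler_piMr ?cos_le1//; exact: ltW.
have x0E s : (C s).1 = 0 -> C s = (0, 0) /\ cos (s + t0) = 1.
  rewrite /C /= gE => e; have c1 : cos (s + t0) = 1.
    apply/le_anti; rewrite cos_le1 /= -(ler_pM2l k0) mulr1; lra.
  split=> //; rewrite /spiral_curve gE hE e.
  have -> : sin (s + t0) = 0 by apply: cos1sin0; rewrite c1 normr1.
  by rewrite !mulr0 subr0.
have xnear s : exists2 e : R, 0 < e & forall u, 0 < `|u - s| < e -> 0 < (C u).1.
  have := x0 s; rewrite le_eqVlt => /predU1P[/esym/x0E[_ c1]|xs].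
    exists (pi *+ 2); first by rewrite mulrn_wgt0// pi_gt0.
    move=> u /andP[us u2]; rewrite lt_neqAle x0 andbT; apply/eqP => /esym/x0E[_ c2].
    have s1 : sin (s + t0) = 0 by apply: cos1sin0; rewrite c1 normr1.
    have : u - s = 0.
      apply: cos_eq1 => //; have -> : u - s = (u + t0) - (s + t0) by ring.
      by rewrite cosB c1 c2 s1; ring.
    by move=> e; move: us; rewrite e normr0 ltxx.
  have [e e0 he] := pos_nbhd _ _ cC xs.
  by exists e => // u /andP[_]; exact: he.
have sC : filippov_solution F setT C.
  apply: piecewise_filippov_solution => //; [exact: affine_field_cont|exact: affine_field_cont|].
  by move=> s; have [e e0 he] := xnear s; exists e => // u /he; left.
have C0 : C 0 = spiral_curve 0 (xr alphaR) k t0 by rewrite /C add0r.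
split; first by exists C.
move=> X sX X0; suff -> : X = C.
  split.
    exists (pi *+ 2); first by rewrite mulrn_wgt0// pi_gt0.
    by move=> t; rewrite /C addrAC /spiral_curve !gE !hE cosD2pi sinD2pi.
  exists pi; rewrite /C (addrC pi) (add0r t0) /spiral_curve !gE !hE cosDpi sinDpi => -[e1 e2].
  have ec : cos t0 = 0 by apply: (mulfI (lt0r_neq0 k0)); lra.
  have es : sin t0 = 0.
    have := D_gt0 (0 : R) => D0; apply: (mulfI (lt0r_neq0 D0)); apply: (mulfI (lt0r_neq0 k0)).
    by move: e2; rewrite ec; lra.
  by have := cos2Dsin2 t0; rewrite ec es !expr0n addr0 => /eqP; rewrite eq_sym oner_eq0.
have tX := filippov_tame0 _ _ _ _ _ sX; have tC := filippov_tame0 _ _ _ _ _ sC.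
have [cX XR _ _ _] := tX.
apply/funext; apply: (agree_everywhere _ _ 0) => //; first by rewrite X0 C0.
move=> s es; have := x0 s; rewrite le_eqVlt => /predU1P[/esym/x0E[Cs _]|xs]; last first.
  apply: (tame_local _ _ _ _ _ _ _ _ _ _ tX tC es); rewrite es => e.
  by move: xs; rewrite e ltxx.
have [e e0 he] := origin_touching _ _ sX (etrans es Cs).
have right u : s < u < s + e -> solves_at (affine_field 0 alphaR 0) X u /\ solves_at (affine_field 0 alphaR 0) C u.
  by move=> /andP[? ?]; split=> //; apply/XR/he; rewrite gtr0_norm ?subr_gt0//; bounds.
have left u : s - e < u < s -> solves_at (affine_field 0 alphaR 0) X u /\ solves_at (affine_field 0 alphaR 0) C u.
  by move=> /andP[? ?]; split=> //; apply/XR/he; rewrite ltr0_norm ?subr_lt0//; bounds.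
exists e => // u; rewrite ltr_distlC => /andP[? ?]; have [su|us] := leP s u.
  have h := agree_right _ _ _ _ _ _ _ cX cC es right u.
  by apply: h; bounds.
have h := agree_left _ _ _ _ _ _ _ cX cC es left u.
by apply: h; bounds.
Qed.
End Origin.

Lemma center_global_virtual_left (alphaL alphaR : R) : 0 < xr alphaL ->
  global_center_at (filippov (affine_field 0 alphaL 0) (affine_field 0 alphaR 0))
    (Num.max (xr alphaR) 0, 0).
Proof.
move=> xL; have D0 := D_gt0 (0 : R).
have aL : 0 < alphaL by move: xL; rewrite pmulr_lgt0// invr_gt0.
have xE a : (1 + 0 ^+ 2 : R) * xr a = a by rewrite mulrC divfK// gt_eqF.
move=> p; split=> [|pc].
  move=> h pc; move: h; rewrite pc; apply: not_through_equilibrium.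
  have [xR|xR] := leP (xr alphaR) 0.
    (* With two virtual or boundary sides the center is the origin; this weight makes the vertical
       velocities - alphaL and - alphaR cancel. *)
    apply: Or33; split=> //; exists (- xr alphaR / (xr alphaL - xr alphaR)).
      have d0 : 0 < xr alphaL - xr alphaR by lra.
      apply/andP; split; first by apply: divr_ge0; lra.
      by rewrite (ler_pdivrMr _ _ d0) mul1r; lra.
    have := xE alphaL; have := xE alphaR; move: xL xR.
    move: (xr alphaL) (xr alphaR) => u w u0 w0 <- <-.
    rewrite pair_combE /affine_field /=; congr pair; first by ring.
    by field; rewrite gt_eqF//; lra.
  by apply: Or32; split=> //; rewrite /affine_field /= xE; congr pair; ring.
have [p0|p0] := ltP p.1 0.
  have p0' : 0 <= (- p).1 by rewrite oppr_ge0 ltW.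
  have [||k [t [kw /andP[t0 t2] e]]] := polar_half_plane 0 (xr (- alphaL)) _ p0'.
  - by rewrite xrN oppr_le0 ltW.
  - by move/(congr1 fst) => /= h; move: p0; lra.
  apply: on_crossing_loop_periodic; rewrite -(opprK p) e.
  by apply: center_left_on_loop; rewrite -?e// t0 ltW.
have [xR|xR] := leP (xr alphaR) 0.
  have pn0 : p <> (0, 0) by move: pc; rewrite (max_r xR).
  have [k [t [kw /andP[t0 t2] e]]] := polar_half_plane 0 _ _ p0 xR pn0.
  apply: on_crossing_loop_periodic; rewrite e.
  by apply: center_right_on_loop; rewrite -?e// t0 ltW.
have [k [t [k0 /andP[t0 t2] e]]] := arc_polar 0 (xr alphaR) p.
have {}k0 : 0 < k.
  rewrite lt_neqAle k0 andbT; apply/eqP => kk; apply: pc.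
  by rewrite (max_l (ltW xR)) e -kk /spiral_curve; congr pair; ring.
rewrite e; have [kx|kx] := leP k (xr alphaR).
  apply: inner_circle_orbit => //; last by rewrite k0.
  by move: xR; rewrite pmulr_lgt0// invr_gt0.
apply: on_crossing_loop_periodic; apply: center_right_on_loop; rewrite -?e// ?t0 ?ltW//.
by split=> //; rewrite mul0r expR0 mulr1//; lra.
Qed.

Lemma center_global (alphaL alphaR : R) : 0 < xr alphaL \/ xr alphaR < 0 ->
  global_center (filippov (affine_field 0 alphaL 0) (affine_field 0 alphaR 0)).
Proof.
case=> [xL|xR]; first by eexists; exact: center_global_virtual_left.
have : 0 < xr (- alphaR) by rewrite xrN oppr_gt0.
move=> /(@center_global_virtual_left _ (- alphaL)); set c := (_, _) => h.
have fE (a : R) (p : R * R) : affine_field 0 (- a) 0 (- p) = - affine_field 0 a 0 p.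
  by rewrite /affine_field pair_oppE /=; congr pair; ring.
have fE' (a : R) (p : R * R) : affine_field 0 a 0 (- p) = - affine_field 0 (- a) 0 p.
  by rewrite /affine_field pair_oppE /=; congr pair; ring.
have tr (a b : R) (p : R * R) : orbit_through (filippov (affine_field 0 a 0) (affine_field 0 b 0)) periodic_orbit p ->
    orbit_through (filippov (affine_field 0 (- b) 0) (affine_field 0 (- a) 0)) periodic_orbit (- p).
  move=> [[X sX X0] hX]; split.
    have sX' := filippov_solution_opp _ _ _ _ _ (fE b) (fE a) sX.
    by exists (fun t => - X t); rewrite ?X0.
  move=> Y sY Y0; have sY' := filippov_solution_opp _ _ _ _ _ (fE' a) (fE' b) sY.
  have [|[T T0 hT] [t ht]] := hX _ sY'; first by rewrite Y0 opprK.
  split; first by exists T => // s; apply: oppr_inj; exact: hT.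
  by exists t => e; apply: ht; rewrite e.
exists (- c) => p; split=> [hp pc|pc].
  have := (h (- p)).1; apply; last by rewrite pc opprK.
  by have := tr _ _ _ hp.
have npc : - p <> c by move=> e; apply: pc; rewrite -e opprK.
by have := tr _ _ _ ((h (- p)).2 npc); rewrite !opprK.
Qed.

End CenterAnnulus.

(** * Mirrored foci *)

Section Foci.
Context {R : realType}.

Lemma affine_focus_at (gamma alpha beta : R) : gamma <> 0 ->
  focus_at (affine_field gamma alpha beta)
    (alpha / (1 + gamma ^+ 2), 2 * gamma * (alpha / (1 + gamma ^+ 2)) + beta).
Proof.
move=> g0; have D0 := D_gt0 gamma; split.
  by rewrite affine_field_focus /focus /= !subrr; congr pair; ring.
exists (gamma +i* 1)%C; split=> //=; last exact/eqP/oner_neq0.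
(* A left eigenvector, since [eigenvalue] refers to row vectors. *)
apply/eigenvalueP; exists (\row_j if j == 0 then (- gamma -i* 1)%C else 1); last first.
  apply/eqP => /rowP /(_ 1); rewrite !mxE /= => /eqP; exact/negP/oner_neq0.
apply/rowP => j; rewrite !mxE !big_ord_recl big_ord0 !mxE /=.
case: j => [[|[|//]]] ? /=; rewrite /affine_field /=; apply/eqP; rewrite eq_complex /=;
  apply/andP; split; apply/eqP; simpc; rewrite /=; ring.
Qed.

End Foci.

Section ReversibleSystem.
Context {R : realType}.
Variables (gamma alpha : R).
Let fL := affine_field (- gamma) (- alpha) 0.
Let fR := affine_field gamma alpha 0.
Let F := filippov fL fR.
Notation xr := (alpha / (1 + gamma ^+ 2)).

Lemma reversible_system : reversible F flip_x.
Proof.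
by apply: reversible_flip_x => p; rewrite /fL /fR /affine_field /flip_x pair_oppE /=;
  congr pair; ring.
Qed.

Lemma reversible_nonlinear : gamma <> 0 -> nonlinear F.
Proof.
move=> g0 [a [b [c [a' [b' [c' h]]]]]]; apply: g0.
have hR x : 0 < x -> (fR (x, 0)).1 = a * x + c.
  move=> x0; have : F (x, 0) (fR (x, 0)) by apply: Or32.
  rewrite h; last by move=> /= e; move: x0; rewrite e ltxx.
  by move=> e; rewrite e /= mulr0 addr0.
have hL x : x < 0 -> (fL (x, 0)).1 = a * x + c.
  move=> x0; have : F (x, 0) (fL (x, 0)) by apply: Or31.
  rewrite h; last by move=> /= e; move: x0; rewrite e ltxx.
  by move=> e; rewrite e /= mulr0 addr0.
(* On the x-axis the horizontal velocity is 2 gamma x on the right and - 2 gamma x on the left. Two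
   points on each side force the slopes to agree. *)
have h1 := hR 1 ltr01; have h2 := hR 2 (ltr0n _ 2).
have h3 := hL (-1) (ltrN10 R); have h4 : (fL (-2, 0)).1 = a * -2 + c by apply: hL; rewrite oppr_lt0 ltr0n.
move: h1 h2 h3 h4; rewrite /fL /fR /affine_field /=; lra.
Qed.

Lemma reversible_annulus : has_period_annulus_at_infinity fL fR.
Proof.
have [r hr] := polar_far gamma xr.
exists r => p pr; apply: on_crossing_loop_crossing.
have [p0|p0] := leP 0 p.1.
  have [k [t [kw /andP[t0 t2] e]]] := hr _ p0 pr; rewrite e.
  by apply: (wide_on_crossing_loop _ _ _ _ kw _ _).1; rewrite -?e// t0 ltW.
have p0' : 0 <= (flip_x p).1 by rewrite oppr_ge0 ltW.
have [|k [t [kw /andP[t0 t2] e]]] := hr _ p0'.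
  by move: pr; rewrite !prod_normE /= normrN.
by rewrite -(flip_xK p) e; apply: (wide_on_crossing_loop _ _ _ _ kw _ _).2; rewrite -?e// t0 ltW.
Qed.

Lemma reversible_origin : F (0, 0) (0, 0).
Proof.
apply: Or33; split=> //; exists 2^-1; first by bounds.
by rewrite pair_combE /fL /fR /affine_field /=; congr pair; field.
Qed.

Lemma reversible_global_center : xr <= 0 -> global_center_at F (0, 0).
Proof.
move=> x0 p; split=> [h pc|pc].
  by move: h; rewrite pc; apply: not_through_equilibrium; exact: reversible_origin.
apply: on_crossing_loop_periodic.
have [p0|p0] := leP 0 p.1.
  have [k [t [kw /andP[t0 t2] e]]] := polar_half_plane gamma _ _ p0 x0 pc; rewrite e.
  by apply: (wide_on_crossing_loop _ _ _ _ kw _ _).1; rewrite -?e// t0 ltW.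
have p0' : 0 <= (flip_x p).1 by rewrite oppr_ge0 ltW.
have [|k [t [kw /andP[t0 t2] e]]] := polar_half_plane gamma _ _ p0' x0 _.
  by move/(congr1 fst) => /= h; move: p0; lra.
by rewrite -(flip_xK p) e; apply: (wide_on_crossing_loop _ _ _ _ kw _ _).2; rewrite -?e// t0 ltW.
Qed.

End ReversibleSystem.

(** * First zeros and visits to both half-axes *)

Section FirstZero.
Context {R : realType}.

Lemma first_zero (f : R -> R) (a b : R) : a <= b ->
  (forall t, a <= t <= b -> {for t, continuous f}) -> f a < 0 -> 0 <= f b ->
  exists z, [/\ a < z <= b, f z = 0 & forall t, a <= t < z -> f t < 0].
Proof.
move=> ab cf fa fb; pose S := [set t | a <= t <= b /\ 0 <= f t].
have Sb : S b by split=> //; rewrite ab lexx.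
have hS : has_inf S by split; [exists b|exists a => t [/andP[]]].
pose z := inf S.
have az : a <= z by apply: lb_le_inf; [exists b|move=> t [/andP[]]].
have zb : z <= b by apply: ge_inf => //; case: hS.
have zab : a <= z <= b by rewrite az zb.
have below t : a <= t < z -> f t < 0.
  move=> /andP[at_ tz]; rewrite ltNge; apply/negP => ft.
  have : z <= t by apply: ge_inf; [case: hS|split=> //; rewrite at_ (le_trans (ltW tz) zb)].
  by rewrite leNgt tz.
have fz0 : 0 <= f z.
  rewrite leNgt; apply/negP => fz.
  have c : {for z, continuous (fun t => - f t)} by apply: cvgN; exact: cf.
  have [|e e0 he] := near_cont_gt0 _ _ 0 c; first by rewrite oppr_gt0.
  have [t [tab ft] tz] := inf_adherent e0 hS.
  have zt : z <= t by apply: ge_inf; [case: hS|split].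
  have : 0 < - f t by apply: he; rewrite ger0_norm ?subr_ge0// ltrBlDl.
  by rewrite oppr_gt0 ltNge ft.
have {}az : a < z.
  rewrite lt_neqAle az andbT; apply/eqP => e; move: fz0; rewrite -e; lra.
exists z; split=> //; first by rewrite az zb.
apply/le_anti; rewrite fz0 andbT leNgt; apply/negP => fz.
have [e e0 he] := near_cont_gt0 _ _ 0 (cf _ zab) fz.
pose t := Num.max a (z - e / 2).
have tz : t < z by rewrite gt_max az /=; lra.
have at_ : a <= t by rewrite le_max lexx.
have := below t; rewrite at_ tz => /(_ isT).
have : 0 < f t.
  apply: he; rewrite ltr0_norm ?subr_lt0//.
  have : z - e / 2 <= t by rewrite le_max lexx orbT.
  lra.
by move=> h1 h2; lra.
Qed.

Lemma first_zero_down (f : R -> R) (a b : R) : a <= b ->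
  (forall t, a <= t <= b -> {for t, continuous f}) -> 0 < f a -> f b <= 0 ->
  exists z, [/\ a < z <= b, f z = 0 & forall t, a <= t < z -> 0 < f t].
Proof.
move=> ab cf fa fb; have [|||z [h1 h2 h3]] := @first_zero (fun t => - f t) a b ab.
- by move=> t /cf c; apply: cvgN.
- by rewrite oppr_lt0.
- by rewrite oppr_ge0.
- by exists z; split=> //; [apply: oppr_inj; rewrite h2 oppr0|move=> t /h3; rewrite oppr_lt0].
Qed.

End FirstZero.

Section Hits.
Context {R : realType}.
Variables (fL fR : R * R -> R * R).

(** After a crossing to the left x is negative, and just before the same crossing one period later
    it is positive. At the first zero in between y cannot be positive, for a leftward crossing comes
    from x > 0. The other direction is symmetric. *)
Lemma crossing_periodic_hits (X : R -> R * R) :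
  tame fL fR 0 X -> periodic_orbit X -> (exists t, (X t).1 = 0) ->
  (forall t, (X t).1 = 0 -> (X t).2 != 0) ->
  (exists2 t, (X t).1 = 0 & (X t).2 < 0) /\ (exists2 t, (X t).1 = 0 & 0 < (X t).2).
Proof.
move=> [cX XR XL Xr Xl] [[T T0 hT] _] [t0 x0] hn.
have c1 t : {for t, continuous (fun s => (X s).1)} by have /cont_pair[] := cX t.
have neg t : (X t).1 = 0 -> 0 < (X t).2 -> exists2 t, (X t).1 = 0 & (X t).2 < 0.
  move=> xt yt; have [e e0 he] := Xl _ xt yt.
  pose d := Num.min e T / 3.
  have d0 : 0 < d by rewrite divr_gt0// lt_min e0.
  have de : d < e by have : Num.min e T <= e by [rewrite ge_min lexx]; move: d0; rewrite /d; lra.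
  have dT : 2 * d < T by have : Num.min e T <= T by [rewrite ge_min lexx orbT]; move: d0; rewrite /d; lra.
  have h1 : (X (t + d)).1 < 0 by apply: (he _).1; bounds.
  have h2 : 0 <= (X (t + T - d)).1.
    by rewrite addrAC hT ltW//; apply: (he _).2; bounds.
  have [||z [/andP[z1 z2] xz hz]] := first_zero (fun s => (X s).1) (t + d) (t + T - d) _ _ h1 h2.
  - by lra.
  - by move=> s _; exact: c1.
  exists z => //; rewrite lt_neqAle hn//= leNgt; apply/negP => yz.
  have [e' e'0 he'] := Xl _ xz yz.
  pose s := Num.max (t + d) (z - e' / 2).
  have sz : s < z by rewrite gt_max z1 /=; lra.
  have s1 : z - e' / 2 <= s by rewrite le_max lexx orbT.
  have s2 : t + d <= s by rewrite le_max lexx.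
  have : (X s).1 < 0 by apply: hz; rewrite s2.
  have : 0 < (X s).1 by apply: (he' _).2; rewrite sz andbT; lra.
  lra.
have pos t : (X t).1 = 0 -> (X t).2 < 0 -> exists2 t, (X t).1 = 0 & 0 < (X t).2.
  move=> xt yt; have [|e e0 he] := Xr _ xt _; first by rewrite oppr0.
  pose d := Num.min e T / 3.
  have d0 : 0 < d by rewrite divr_gt0// lt_min e0.
  have de : d < e by have : Num.min e T <= e by [rewrite ge_min lexx]; move: d0; rewrite /d; lra.
  have dT : 2 * d < T by have : Num.min e T <= T by [rewrite ge_min lexx orbT]; move: d0; rewrite /d; lra.
  have h1 : 0 < (X (t + d)).1 by apply: (he _).1; bounds.
  have h2 : (X (t + T - d)).1 <= 0.
    by rewrite addrAC hT ltW//; apply: (he _).2; bounds.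
  have [||z [/andP[z1 z2] xz hz]] := first_zero_down (fun s => (X s).1) (t + d) (t + T - d) _ _ h1 h2.
  - by lra.
  - by move=> s _; exact: c1.
  exists z => //; rewrite lt_neqAle eq_sym hn//= leNgt; apply/negP => yz.
  have [|e' e'0 he'] := Xr _ xz _; first by rewrite oppr0.
  pose s := Num.max (t + d) (z - e' / 2).
  have sz : s < z by rewrite gt_max z1 /=; lra.
  have s1 : z - e' / 2 <= s by rewrite le_max lexx orbT.
  have s2 : t + d <= s by rewrite le_max lexx.
  have : 0 < (X s).1 by apply: hz; rewrite s2.
  have : (X s).1 < 0 by apply: (he' _).2; rewrite sz andbT; lra.
  lra.
have := hn _ x0; rewrite neq_lt => /orP[y0|y0].
  by split; [exists t0|exact: pos x0 y0].
by split; [exact: neg x0 y0|exists t0].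
Qed.

End Hits.

(** * Injectivity of loops over one period *)

Section LoopMore.
Context {R : realType}.
Variables (fL fR : R * R -> R * R) (r l : R -> R * R) (tauR tauL : R).
Hypothesis L : loop fL fR r l tauR tauL.
Let X := loop_solution r l tauR tauL.
Let T := tauR + tauL.

Lemma loop_periodicZ (k : int) t : X (t + T * k%:~R) = X t.
Proof.
have [j [s [-> /andP[s0 sT]]]] := loop_decomp _ _ _ _ _ _ L t.
have -> : s + (tauR + tauL) * j%:~R + T * k%:~R = s + (tauR + tauL) * (j + k)%:~R.
  by rewrite intrD /T; ring.
by rewrite /X !(loop_solutionE _ _ _ _ _ _ L) ?s0 ?ltW.
Qed.

Lemma loop_shift_filippov (I : set R) c : continuous fL -> continuous fR ->
  filippov_solution (filippov fL fR) I (fun t => X (t + c)).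
Proof.
move=> cL cR; apply: piecewise_filippov_solution => //.
  move=> s; apply: (@continuous_comp _ _ _ (fun s => s + c)).
    by apply: cvgD; [exact: cvg_id|exact: cvg_cst].
  exact: loop_solution_cont L _.
move=> s; have [e e0 he] := loop_piecewise _ _ _ _ _ _ L (s + c); exists e => // u us.
have {}us : 0 < `|u + c - (s + c)| < e by rewrite opprD addrACA subrr addr0.
by case: (he _ us) => -[x0 d]; [left|right]; split=> //; exact: solves_at_shift.
Qed.

Lemma loop_shift_range c t : exists2 s, 0 <= s < T & X (s + c) = X t.
Proof.
have [j [s [e s0T]]] := loop_decomp _ _ _ _ _ _ L (t - c); exists s => //.
by rewrite -(loop_periodicZ j); congr X; move: e; rewrite -/T; lra.
Qed.

Hypothesis injR : forall s t, 0 <= s <= tauR -> 0 <= t <= tauR -> r s = r t -> s = t.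
Hypothesis injL : forall s t, 0 <= s <= tauL -> 0 <= t <= tauL -> l s = l t -> s = t.

Lemma loop_inj s t : 0 <= s < T -> 0 <= t < T -> X s = X t -> s = t.
Proof.
have [tR tL] := (loop_tauR _ _ _ _ _ _ L, loop_tauL _ _ _ _ _ _ L).
have hr u : 0 <= u <= tauR -> X u = r u := loop_solution_r _ _ _ _ _ _ L u.
have hl u : tauR <= u < T -> X u = l (u - tauR).
  move=> /andP[u1 u2]; rewrite -(loop_solution_l _ _ _ _ _ _ L (u - tauR)).
    by rewrite /X; congr loop_solution; ring.
  by move: u2; rewrite /T => u2; bounds.
wlog st : s t / s <= t.
  move=> h hs ht e; have [st|/ltW ts] := leP s t; first exact: h.
  by apply/esym/h.
move=> /andP[s0 sT] /andP[t0 tT] e.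
have [tr|rt] := leP t tauR.
  by apply: injR; rewrite -?hr ?s0 ?t0//= ?(le_trans st tr).
have [rs|sr] := leP tauR s.
  suff : s - tauR = t - tauR by lra.
  apply: injL.
  - by move: sT; rewrite /T => sT; bounds.
  - by move: tT; rewrite /T => tT; bounds.
  - by rewrite -!hl ?rs ?(ltW rt).
exfalso; have : (X t).1 < 0.
  rewrite hl ?(ltW rt)//; apply: (loop_left _ _ _ _ _ _ L).
  by move: tT; rewrite /T => tT; bounds.
suff : 0 <= (X s).1 by rewrite e; lra.
have s01 : 0 <= s <= tauR by rewrite s0 ltW.
rewrite (hr _ s01); move: s0; rewrite le_eqVlt => /predU1P[<-|s0].
  by rewrite (loop_x0 _ _ _ _ _ _ L).
by rewrite ltW//; apply: (loop_right _ _ _ _ _ _ L); rewrite s0.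
Qed.

Lemma loop_shift_inj c s t : 0 <= s < T -> 0 <= t < T -> X (s + c) = X (t + c) -> s = t.
Proof.
have T0 : 0 < T by rewrite /T; have := loop_tauR _ _ _ _ _ _ L; have := loop_tauL _ _ _ _ _ _ L; lra.
move=> hs ht e.
have [j [u [eu huT]]] := loop_decomp _ _ _ _ _ _ L (s + c).
have [j' [u' [eu' huT']]] := loop_decomp _ _ _ _ _ _ L (t + c).
rewrite -/T in eu huT eu' huT'.
have uu : u = u'.
  by apply: loop_inj => //; rewrite -(loop_periodicZ j) -eu e eu' (loop_periodicZ j').
have jj : j = j'.
  have d : s - t = T * (j - j')%:~R by rewrite intrB; move: eu eu'; rewrite uu; lra.
  have : `|s - t| < T by rewrite ltr_norml; move: hs ht => /andP[? ?] /andP[? ?]; bounds.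
  rewrite d normrM (gtr0_norm T0) -{2}(mulr1 T) ltr_pM2l// -intr_norm ltrz1.
  by rewrite -[X in _ < X]add0r ltzD1 normr_le0 subr_eq0 => /eqP.
move: eu eu'; rewrite uu jj; lra.
Qed.

End LoopMore.

(** * The heart of two real foci *)

Section SpiralCompact.
Context {R : realType}.
Variables (gamma xr : R).
Notation E t := (expR (gamma * t)).
Notation D := (1 + gamma ^+ 2).
Notation g := (gfun gamma).
Notation h := (hfun gamma).
Notation spiral := (spiral_curve gamma xr).

(** Properness of the polar coordinates over one turn: [C] and [S] are affine in the coordinates of
    the point, k E(t) is at most |C| + |S|, and E(t) is bounded below. *)
Lemma spiral_size : exists2 M : R, 0 <= M & forall k t, 0 <= k -> 0 <= t <= pi *+ 2 ->
  k <= M * (1 + `|spiral k t|).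
Proof.
pose e := expR (`|gamma| * (pi *+ 2)); pose A := 2 * `|gamma| + 1.
have e0 : 0 < e by exact: expR_gt0.
have A1 : 1 <= A by rewrite /A; have := normr_ge0 gamma; lra.
have D1 : 1 <= D by rewrite lerDl sqr_ge0.
pose B := `|xr| + 1 + `|gamma| * A + A.
have B0 : 0 <= B.
  by rewrite /B; have := normr_ge0 gamma; have := normr_ge0 xr => ? ?; rewrite !addr_ge0// ?mulr_ge0//; lra.
exists (e * B); first by rewrite mulr_ge0// ltW.
move=> k t k0 /andP[t0 t2]; set p := spiral k t; set N := `|p|.
have [N1 N2] : `|p.1| <= N /\ `|p.2| <= N by rewrite /N prod_normE /=; split; rewrite le_max lexx ?orbT.
have N0 : 0 <= N by exact: normr_ge0.
have [S SE] : {S | S = k * (E t * sin t)} by exists (k * (E t * sin t)).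
have [C CE'] : {C | C = k * (E t * cos t)} by exists (k * (E t * cos t)).
have SD : S * D = 2 * gamma * p.1 - p.2 by rewrite SE /p /spiral_curve /hfun /=; ring.
have CE : C = xr - p.1 + gamma * S by rewrite CE' SE /p /spiral_curve /gfun /=; ring.
have hS : `|S| <= A * N.
  have h1 : `|S| <= `|S * D| by rewrite normrM (ger0_norm (le_trans ler01 D1)) ler_peMr.
  apply: (le_trans h1); rewrite SD; apply: le_trans (ler_normB _ _) _.
  have -> : `|2 * gamma * p.1| = 2 * `|gamma| * `|p.1| by rewrite !normrM normr_nat.
  have : `|gamma| * `|p.1| <= `|gamma| * N by rewrite ler_wpM2l.
  by rewrite /A; lra.
have hC : `|C| <= `|xr| + N + `|gamma| * (A * N).
  rewrite CE; apply: le_trans (ler_normD _ _) _; apply: lerD.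
    by apply: le_trans (ler_normB _ _) _; rewrite lerD.
  by rewrite normrM ler_wpM2l.
have hK : k * E t <= `|C| + `|S|.
  have K0 : 0 <= k * E t by rewrite mulr_ge0// expR_ge0.
  have CS : (k * E t) ^+ 2 = C ^+ 2 + S ^+ 2.
    rewrite CE' SE -[LHS]mulr1 -(cos2Dsin2 t); ring.
  rewrite -(@ler_pXn2r _ 2)// ?nnegrE ?addr_ge0// CS.
  rewrite -(real_normK (num_real C)) -(real_normK (num_real S)).
  by have := mulr_ge0 (normr_ge0 C) (normr_ge0 S); nra.
have hk : k <= e * (k * E t).
  have : 1 <= e * E t.
    rewrite -expRD -[leLHS]expR0 ler_expR.
    have : - gamma * t <= `|gamma| * (pi *+ 2).
      apply: (@le_trans _ _ (`|gamma| * t)); last by rewrite ler_wpM2l.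
      by rewrite ler_wpM2r// -normrN ler_norm.
    lra.
  by move=> h1; rewrite mulrCA ler_peMr.
apply: (le_trans hk); rewrite -mulrA ler_pM2l//.
apply: (le_trans hK); apply: (le_trans (lerD hC hS)).
rewrite /B; have := normr_ge0 gamma; have := normr_ge0 xr; move: N0 A1; nra.
Qed.

Definition spiral_set (a b : R) : set (R * R) :=
  [set p | exists k t, [/\ a <= k <= b, 0 <= t <= pi *+ 2, 0 <= p.1 & p = spiral k t]].

Lemma spiral_cont2 : continuous (fun q : R * R => spiral q.1 q.2).
Proof.
move=> q; have cg : {for q, continuous (fun q : R * R => q.1 * g q.2)}.
  apply: cvgM; first exact: cvg_fst.
  by apply: (@continuous_comp _ _ _ snd g); [exact: cvg_snd|exact: gfun_cont].
have ch : {for q, continuous (fun q : R * R => q.1 * h q.2)}.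
  apply: cvgM; first exact: cvg_fst.
  by apply: (@continuous_comp _ _ _ snd h); [exact: cvg_snd|exact: hfun_cont].
apply: (@cvg_pair _ _ _ (nbhs q) (nbhs (spiral q.1 q.2).1) (nbhs (spiral q.1 q.2).2) _ _ _
  (fun q => (spiral q.1 q.2).1) (fun q => (spiral q.1 q.2).2)).
  by apply: cvgB; [exact: cvg_cst|exact: cg].
apply: cvgB; last exact: ch.
by apply: cvgM; [exact: cvg_cst|apply: cvgB; [exact: cvg_cst|exact: cg]].
Qed.

Lemma spiral_set_compact a b : compact (spiral_set a b).
Proof.
have -> : spiral_set a b =
    ((fun q : R * R => spiral q.1 q.2) @` (`[a, b] `*` `[0, pi *+ 2])) `&`
    [set p : R * R | 0 <= p.1].
  apply/seteqP; split=> p.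
    move=> [k [t [kab t02 p0 e]]]; split; last exact: p0.
    exists (k, t); last by rewrite e.
    by split; [rewrite /= in_itv; exact: kab|rewrite /= in_itv; exact: t02].
  move=> [[[k t] [ks ts] e] p0].
  by exists k, t; split.
apply: compact_closedI.
  apply: continuous_compact; first by apply: continuous_subspaceT; exact: spiral_cont2.
  by apply: compact_setX; exact: segment_compact.
have -> : [set p : R * R | 0 <= p.1] = fst @^-1` [set x | 0 <= x] by [].
apply: preimage_closed; last exact: closed_ge.
by move=> p _; exact: cvg_fst.
Qed.

Lemma spiral_set_closed a b : closed (spiral_set a b).
Proof. by apply: compact_closed (spiral_set_compact a b); exact: norm_hausdorff. Qed.

(** Regions invariant under the reflection in Sigma are preimages under this fold of sets of the
    right half-plane, which makes their topology that of one focus. *)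
Definition fold_x (p : R * R) : R * R := (`|p.1|, p.2).

Lemma fold_x_cont : continuous fold_x.
Proof.
move=> p; apply: (@cvg_pair _ _ _ (nbhs p) (nbhs `|p.1|) (nbhs p.2) _ _ _
  (fun q : R * R => `|q.1|) (fun q : R * R => q.2)); last exact: cvg_snd.
by apply: cvg_norm; exact: cvg_fst.
Qed.

Lemma norm_fold_x p : `|fold_x p| = `|p|.
Proof. by rewrite !prod_normE /= normr_id. Qed.

Definition folded (A : set (R * R)) : set (R * R) := fold_x @^-1` A.

Lemma folded_closed A : closed A -> closed (folded A).
Proof. by move=> cA; apply: preimage_closed => // p _; exact: fold_x_cont. Qed.

Definition spiral_tail (a : R) : set (R * R) :=
  [set p | exists k t, [/\ a <= k, 0 <= t <= pi *+ 2, 0 <= p.1 & p = spiral k t]].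

Lemma spiral_tail_closed a : 0 <= a -> closed (spiral_tail a).
Proof.
move=> a0; have [M M0 hM] := spiral_size; rewrite -openC openE => p np.
(* Points within distance 1 of p have size at most K, so near p the tail coincides with a compact
   set of spirals. *)
pose K := M * (1 + (`|p| + 1)).
have cK := spiral_set_closed a K.
have npK : (~` spiral_set a K) p.
  by move=> [k [t [/andP[ak _] t02 p0 e]]]; apply: np; exists k, t.
have oK : nbhs p (~` spiral_set a K) by apply: open_nbhs_nbhs; split=> //; rewrite openC.
have /nbhs_ballP[d d0 hd] := oK.
apply/nbhs_ballP; exists (Num.min d 1); first by rewrite /= lt_min d0 ltr01.
move=> q pq [k [t [ak t02 q0 e]]].
have qd : ball p d q by apply: le_ball pq; rewrite ge_min lexx.
have q1 : ball p 1 q by apply: le_ball pq; rewrite ge_min lexx orbT.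
apply: (hd q qd); exists k, t; split=> //; rewrite ak /=.
apply: le_trans (hM k t (le_trans a0 ak) t02) _.
rewrite -e /K; apply: ler_wpM2l => //; rewrite lerD2l.
move: q1; rewrite -ball_normE /= => q1.
have : `|q| <= `|p| + `|p - q|.
  by rewrite -{1}(subKr p q); apply: ler_normB.
by move: q1; lra.
Qed.

End SpiralCompact.

(** * The region outside the heart *)

Section RealFoci.
Context {R : realType}.
Variables (gamma alpha : R).
Let fL := affine_field (- gamma) (- alpha) 0.
Let fR := affine_field gamma alpha 0.
Let F := filippov fL fR.
Notation xr := (alpha / (1 + gamma ^+ 2)).
Notation spiral := (spiral_curve gamma xr).
Notation g := (gfun gamma).
Notation h := (hfun gamma).
Notation E t := (expR (gamma * t)).
Hypotheses (g0 : gamma <> 0) (x0 : 0 < xr).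
Implicit Types (k t a b : R) (p : R * R).

(* The size of the spiral tangent to Sigma at the origin. *)
Definition notch_size : R := xr * Num.max 1 (E (pi *+ 2))^-1.
Notation k0 := notch_size.

Lemma notch_size_ge1 : xr <= k0.
Proof. by apply: ler_peMr; [exact: ltW|rewrite le_max lexx]. Qed.

Lemma notch_size_ge2 : xr <= k0 * E (pi *+ 2).
Proof.
rewrite /notch_size; move: (xr) x0 => x xp.
rewrite -[leLHS]mulr1 -mulrA ler_pM2l// -ler_pdivrMr ?expR_gt0// div1r.
by rewrite le_max lexx orbT.
Qed.

Lemma notch_size_gt0 : 0 < k0.
Proof. exact: lt_le_trans x0 notch_size_ge1. Qed.

Lemma notch_weakly_wide : weakly_wide gamma xr k0.
Proof.
split; [exact: notch_size_gt0|exact: notch_size_ge1|exact: notch_size_ge2|].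
have : 0 < k0 * E pi by rewrite mulr_gt0 ?notch_size_gt0// expR_gt0.
by move: x0; lra.
Qed.

Lemma wideP k : wide gamma xr k <-> k0 < k.
Proof.
split=> [[k1 k2 k3 _]|k0k].
  move: k2 k3; rewrite /notch_size; move: (xr) x0 => x xp k2 k3.
  by rewrite maxr_pMr ?ltW// gt_max mulr1 k2 /= ltr_pdivrMr ?expR_gt0.
have kp := lt_trans notch_size_gt0 k0k.
split=> //.
- exact: le_lt_trans notch_size_ge1 k0k.
- by apply: (le_lt_trans notch_size_ge2); rewrite ltr_pM2r// expR_gt0.
- have : 0 < k * E pi by rewrite mulr_gt0// expR_gt0.
  by move: x0; lra.
Qed.

Lemma notch_size_pos : 0 < gamma -> k0 = xr.
Proof.
move=> gp; rewrite /notch_size max_l ?mulr1//.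
rewrite invf_le1 ?expR_gt0// -[leLHS]expR0 ler_expR mulr_ge0// ?ltW//.
by rewrite pmulrn_lgt0// pi_gt0.
Qed.

Lemma notch_size_neg : gamma < 0 -> k0 * E (pi *+ 2) = xr.
Proof.
move=> gn; have E0 := expR_gt0 (gamma * (pi *+ 2)).
rewrite /notch_size max_r ?divfK ?gt_eqF//.
rewrite invf_ge1// -[leRHS]expR0 ler_expR mulr_le0_ge0// ?ltW//.
by rewrite pmulrn_lgt0// pi_gt0.
Qed.

(** Taken as the complement of a closed set to have openness at once; the description by wide
    spirals is [outer_regionP]. *)
Definition outer_region : set (R * R) := ~` folded (spiral_set gamma xr 0 k0).
Definition heart : set (R * R) := folded (spiral_set gamma xr k0 k0).
Notation O := outer_region.

Lemma outer_regionP p : O p <->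
  exists k t, [/\ wide gamma xr k, 0 <= t <= pi *+ 2 & fold_x p = spiral k t].
Proof.
split=> [np|[k [t [kw t02 e]]] [k' [t' [/andP[k'0 k'k0] t'02 _ e']]]].
  have [k [t [kp /andP[t0 t2] e]]] := arc_polar gamma xr (fold_x p).
  have t02 : 0 <= t <= pi *+ 2 by rewrite t0 ltW.
  exists k, t; split=> //; apply/wideP; rewrite ltNge; apply/negP => kk0; apply: np.
  by exists k, t; split=> //; [rewrite kp|exact: normr_ge0].
have k0k : k0 < k by apply/wideP.
(* The ends of a wide arc are strictly between 0 and 2 pi, hence so is t. This rules out a second
   representation of the point with an angle differing by 2 pi, and [arc_inj] applies. *)
have [a [b kab]] := wide_arc _ _ _ kw.
have /andP[ta tb] : a <= t <= b.
  by rewrite -(wide_ends_x_ge0 _ _ _ _ _ _ kw kab t02) -e; exact: normr_ge0.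
have [/andP[a0 _] /andP[_ b2] _ _ _] := kab.
have [|kk' _] := arc_inj _ _ _ _ t t' (lt_trans notch_size_gt0 k0k) k'0 _ (etrans (esym e) e').
  by move: t'02 => /andP[? ?]; rewrite ltr_norml; bounds.
by move: k0k; rewrite kk' ltNge k'k0.
Qed.

Lemma outer_region_open : open O.
Proof. by rewrite /outer_region openC; apply: folded_closed; exact: spiral_set_closed. Qed.

Lemma outer_heart : O `|` heart = folded (spiral_tail gamma xr k0).
Proof.
apply/seteqP; split=> p.
  move=> [/outer_regionP[k [t [/wideP kw t02 e]]]|[k [t [/andP[k1 k2] t02 p0 e]]]].
    by exists k, t; split=> //; [exact: ltW|exact: normr_ge0].
  by exists k, t; split.
move=> [k [t []]]; rewrite le_eqVlt => /predU1P[<-|/wideP kw] t02 p0 e.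
  by right; exists k0, t; split=> //; rewrite lexx.
by left; apply/outer_regionP; exists k, t.
Qed.

Lemma outer_heart_closed : closed (O `|` heart).
Proof.
rewrite outer_heart; apply: folded_closed; apply: spiral_tail_closed.
exact: ltW notch_size_gt0.
Qed.

Lemma heart_not_outer p : heart p -> ~ O p.
Proof.
move=> [k [t [/andP[k1 k2] t02 p0 e]]]; apply; exists k, t; split=> //.
by rewrite k2 (le_trans _ k1)// ltW// notch_size_gt0.
Qed.

Lemma fold_xP p : p = fold_x p \/ p = flip_x (fold_x p).
Proof.
case: p => x y; rewrite /fold_x /flip_x /=; case: (ger0P x) => x1; first by left.
by right; rewrite opprK.
Qed.

Lemma wide_ends_loop k a b : wide gamma xr k -> wide_ends gamma xr k a b ->
  [/\ loop fL fR (right_half gamma alpha k a) (left_half gamma alpha k b) (b - a) (b - a),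
      (right_half gamma alpha k a 0).2 < 0 & 0 < (left_half gamma alpha k b 0).2].
Proof.
move=> [kp _ _ _] [ha hb ea eb hab]; split.
- by apply: reversible_loop => //; [case/andP: ha => /ltW ->|case/andP: hb => -> /ltW].
- by rewrite /right_half addr0 (arc_y _ _ _ _ ea) /= oppr_lt0 mulr_gt0// hfun_gt0.
- by rewrite /left_half subr0 (arc_y _ _ _ _ eb) /= oppr_gt0 pmulr_rlt0// hfun_lt0.
Qed.

Lemma wide_loop_outer k a b t : wide gamma xr k -> wide_ends gamma xr k a b ->
  O (loop_solution (right_half gamma alpha k a) (left_half gamma alpha k b) (b - a) (b - a) t).
Proof.
move=> kw kab; have [L _ _] := wide_ends_loop _ _ _ kw kab.
have [/andP[a0 a1] /andP[b0 b2] _ _ _] := kab.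
have fE s : a <= s <= b -> fold_x (spiral k s) = spiral k s.
  move=> /andP[s1 s2]; rewrite /fold_x ger0_norm; last first.
    by rewrite (wide_ends_x_ge0 _ _ _ _ _ _ kw kab); bounds.
  by case: (spiral k s).
apply/outer_regionP; have [[s /andP[s0 s1] ->]|[s /andP[s0 s1] ->]] := loop_range _ _ _ _ _ _ L t.
  exists k, (a + s); rewrite /right_half fE; first by split=> //; bounds.
  by bounds.
exists k, (b - s).
have -> : fold_x (left_half gamma alpha k b s) = fold_x (spiral k (b - s)).
  by rewrite /left_half /fold_x /flip_x /= normrN.
rewrite fE; first by split=> //; bounds.
by bounds.
Qed.

Lemma outer_region_on_loop p : O p -> exists k a b t,
  [/\ wide gamma xr k, wide_ends gamma xr k a b &
  loop_solution (right_half gamma alpha k a) (left_half gamma alpha k b) (b - a) (b - a) t = p].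
Proof.
move=> /outer_regionP[k [t [kw t02 e]]]; have [a [b kab]] := wide_arc _ _ _ kw.
have tab : a <= t <= b.
  by rewrite -(wide_ends_x_ge0 _ _ _ _ _ _ kw kab t02) -e; exact: normr_ge0.
have [ha hb ea eb hab] := kab.
have ha' : 0 <= a < pi by case/andP: ha => /ltW ->.
have hb' : pi < b <= pi *+ 2 by case/andP: hb => -> /ltW ->.
have [[s hs] [s' hs']] := reversible_loop_range _ _ _ _ _ _ ha' hb' ea eb hab tab.
by have [pE|pE] := fold_xP p; [exists k, a, b, s|exists k, a, b, s']; rewrite pE e; split.
Qed.

(** A crossing periodic orbit visits both half-axes of Sigma. On one of them, the lower if gamma > 0
    and the upper if gamma < 0, every point lies on a wide spiral, so the orbit is one of the
    loops. *)
Lemma crossing_periodic_set_outer : crossing_periodic_set fL fR = O.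
Proof.
apply/seteqP; split=> p; last first.
  move=> /outer_region_on_loop[k [a [b [t [kw kab <-]]]]].
  have [L r0 l0] := wide_ends_loop _ _ _ kw kab.
  by apply: on_crossing_loop_crossing; do 4 eexists; split; [exact: L|exact: r0|exact: l0|exists t].
move=> [[X sX X0] /(_ X sX X0)[pX hX cX]].
have tX := filippov_tame0 _ _ _ _ _ sX.
have nX t : (X t).1 = 0 -> (X t).2 != 0.
  move=> xt; have [_] := cX t xt; rewrite /fL /fR /affine_field /= xt.
  by apply: contraTneq => ->; rewrite !mulr0 !subr0 !addr0 mul0r ltxx.
have [[t1 xt1 yt1] [t2 xt2 yt2]] := crossing_periodic_hits _ _ _ tX pX hX nX.
have XE t : X t = ((X t).1, (X t).2) by case: (X t).
have [gn|gp|//] := ltgtP gamma 0.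
  have [|k [a [b [kw kab e]]]] := sigma_pos_wide_ends gamma xr _ yt2 _; first by move=> _; exact: ltW.
  have [L r0 l0] := wide_ends_loop _ _ _ kw kab.
  have [/andP[a0 a1] /andP[b0 b2] _ _ _] := kab.
  have hb : X t2 = loop_solution (right_half gamma alpha k a) (left_half gamma alpha k b) (b - a) (b - a) (b - a).
    rewrite (loop_solution_r _ _ _ _ _ _ L); last by bounds.
    by rewrite /right_half XE xt2 e; congr spiral; ring.
  have XL := crossing_loop_unique _ _ _ _ _ _ _ _ _ _ L r0 l0 sX _ hb.
  by rewrite -X0 XL; exact: wide_loop_outer.
have [|k [a [b [kw kab e]]]] := sigma_neg_wide_ends gamma xr _ yt1 _; first by move=> _; exact: ltW.
have [L r0 l0] := wide_ends_loop _ _ _ kw kab.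
have [/andP[a0 a1] /andP[b0 b2] _ _ _] := kab.
have hb : X t1 = loop_solution (right_half gamma alpha k a) (left_half gamma alpha k b) (b - a) (b - a) 0.
  rewrite (loop_solution_r _ _ _ _ _ _ L); last by bounds.
  by rewrite /right_half XE xt1 e; congr spiral; ring.
have XL := crossing_loop_unique _ _ _ _ _ _ _ _ _ _ L r0 l0 sX _ hb.
by rewrite -X0 XL; exact: wide_loop_outer.
Qed.

(* All the loops of the outer region meet a half-axis contained in it. *)
Lemma outer_region_component p q : O p -> O q -> connected_component O p q.
Proof.
have [S [cS SO hS]] : exists S : set (R * R), [/\ connected S, S `<=` O &
    forall k a b, wide gamma xr k -> wide_ends gamma xr k a b ->
    exists t, S (loop_solution (right_half gamma alpha k a) (left_half gamma alpha k b) (b - a) (b - a) t)].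
  pose ray (s : R) : set (R * R) := (fun y : R => (0, s * y)) @` `]0, +oo[.
  have cray s : connected (ray s).
    apply: connected_continuous_connected; first by apply/connected_intervalP; exact: interval_is_interval.
    apply: continuous_subspaceT => y; apply: (@cvg_pair _ _ _ (nbhs y) (nbhs 0) (nbhs (s * y)) _ _ _ (fun _ : R => 0 : R) (fun y => s * y)).
      exact: cvg_cst.
    by apply: cvgM; [exact: cvg_cst|exact: cvg_id].
  have f0 (y : R) : fold_x (0, y) = (0, y) by rewrite /fold_x /= normr0.
  have [gn|gp|//] := ltgtP gamma 0.
    exists (ray 1); split=> //.
      move=> w [y /=]; rewrite in_itv/= andbT mul1r => y0 <-; apply/outer_regionP.
      have [|k [t [kw /andP[t1 t2] e]]] := polar_sigma_pos gamma xr _ y0 _; first by move=> _; exact: ltW.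
      by exists k, t; split=> //; [rewrite t1 ltW|rewrite f0].
    move=> k a b kw kab; have [L r0 l0] := wide_ends_loop _ _ _ kw kab; exists (b - a + 0).
    have [/andP[a0 a1] /andP[b0 b2] _ eb _] := kab.
    rewrite (loop_solution_l _ _ _ _ _ _ L); last by bounds.
    exists (left_half gamma alpha k b 0).2; first by rewrite /= in_itv/= l0.
    by rewrite mul1r /left_half subr0 (arc_y _ _ _ _ eb) /flip_x /= oppr0.
  exists (ray (-1)); split=> //.
    move=> w [y /=]; rewrite in_itv/= andbT mulN1r -oppr_lt0 => y0 <-; apply/outer_regionP.
    have [|k [t [kw /andP[t1 t2] e]]] := polar_sigma_neg gamma xr _ y0 _; first by move=> _; exact: ltW.
    by exists k, t; split=> //; [rewrite t1 ltW|rewrite f0].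
  move=> k a b kw kab; have [L r0 l0] := wide_ends_loop _ _ _ kw kab; exists 0.
  have [/andP[a0 a1] /andP[b0 b2] ea _ _] := kab.
  rewrite (loop_solution_r _ _ _ _ _ _ L); last by bounds.
  exists (- (right_half gamma alpha k a 0).2); first by rewrite /= in_itv/= oppr_gt0 r0.
  by rewrite mulN1r opprK /right_half addr0 (arc_y _ _ _ _ ea).
have key r : O r -> exists W : set (R * R), [/\ connected W, W r, W `<=` O & W `&` S !=set0].
  move=> /outer_region_on_loop[k [a [b [t [kw kab <-]]]]].
  have [L r0 l0] := wide_ends_loop _ _ _ kw kab.
  exists (range (loop_solution (right_half gamma alpha k a) (left_half gamma alpha k b) (b - a) (b - a))); split.
  - apply: connected_continuous_connected; last first.
      by apply: continuous_subspaceT; exact: loop_solution_cont L.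
    by rewrite -set_itvNyy; apply/connected_intervalP; exact: interval_is_interval.
  - by exists t.
  - by move=> _ [s _ <-]; exact: wide_loop_outer.
  - by have [s hs] := hS _ _ _ kw kab; eexists; split; [exists s|exact: hs].
move=> /key[W [cW Wp WO WS]] /key[V [cV Vq VO VS]].
have c1 : connected (W `|` S) by apply: connectedU.
have c2 : connected ((W `|` S) `|` V).
  by apply: connectedU => //; have [s [Vs Ss]] := VS; exists s; split=> //; right.
apply: (connected_component_max _ _ c2); last by right.
- by left; left.
- by move=> s [[/WO|/SO]|/VO].
Qed.

End RealFoci.

(** * The heart as a homoclinic curve *)

Section Heart.
Context {R : realType}.
Variables (gamma alpha : R).
Let fL := affine_field (- gamma) (- alpha) 0.
Let fR := affine_field gamma alpha 0.
Let F := filippov fL fR.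
Notation xr := (alpha / (1 + gamma ^+ 2)).
Notation spiral := (spiral_curve gamma xr).
Notation g := (gfun gamma).
Notation h := (hfun gamma).
Notation E t := (expR (gamma * t)).
Hypotheses (g0 : gamma <> 0) (x0 : 0 < xr).
Implicit Types (k t a b : R) (p : R * R).
Notation k0 := (notch_size gamma alpha).
Notation O := (outer_region gamma alpha).
Notation G := (heart gamma alpha).
Let kp : 0 < k0 := notch_size_gt0 _ _ x0.
Let D0 : 0 < 1 + gamma ^+ 2 := D_gt0 gamma.

Definition notch_ends a b : Prop :=
  [/\ 0 <= a < pi, pi < b <= pi *+ 2, k0 * g a = xr, k0 * g b = xr &
      forall t, 0 <= t <= pi *+ 2 -> (k0 * g t < xr) = (a < t < b)].

(** The tangency at the origin is the start of the right arc if gamma > 0, where k0 = xr = xr / g 0,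
    and its end if gamma < 0, where k0 = xr / g (2 pi). The other end is the tip. *)
Lemma notch_endsP : exists a b, notch_ends a b /\
  ((0 < gamma /\ a = 0 /\ b < pi *+ 2) \/ (gamma < 0 /\ 0 < a /\ b = pi *+ 2)).
Proof.
have [a [b [ha hb ea eb hab]]] := weakly_wide_arc _ _ _ (notch_weakly_wide _ _ x0).
exists a, b; split; first by split.
have [gn|gp|//] := ltgtP gamma 0; [right|left]; split=> //.
  have k2 := notch_size_neg _ _ gn; have [/andP[a0 a1] /andP[b1 b2]] := (ha, hb).
  have bE : b = pi *+ 2.
    apply/eqP; rewrite eq_le b2 leNgt; apply/negP => b3.
    have := gfun_inc gamma _ _ (ltW b1) b3 (lexx _).
    by rewrite -(ltr_pM2l kp) eb gfun2pi k2 ltxx.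
  split=> //; rewrite lt_neqAle a0 andbT; apply/eqP => aE.
  move: ea; rewrite -aE gfun0 mulr1 -k2 => /eqP.
  rewrite -{1}[k0]mulr1 (inj_eq (mulfI (lt0r_neq0 kp))) => /eqP e1.
  have : E (pi *+ 2) < 1.
    by rewrite -[ltRHS]expR0 ltr_expR nmulr_rlt0// pmulrn_lgt0// pi_gt0.
  by rewrite -e1 ltxx.
have k1 := notch_size_pos _ alpha gp; have [/andP[a0 a1] /andP[b1 b2]] := (ha, hb).
have aE : a = 0.
  apply/eqP; rewrite eq_le a0 andbT leNgt; apply/negP => a2.
  have := gfun_dec gamma _ _ (lexx _) a2 (ltW a1).
  by rewrite -(ltr_pM2l kp) ea gfun0 mulr1 k1 ltxx.
split=> //; rewrite lt_neqAle b2 andbT; apply/eqP => bE.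
move: eb; rewrite bE gfun2pi -k1 => /eqP.
rewrite -{2}[k0]mulr1 (inj_eq (mulfI (lt0r_neq0 kp))) => /eqP e1.
have : 1 < E (pi *+ 2).
  by rewrite -[ltLHS]expR0 ltr_expR pmulr_rgt0// pmulrn_lgt0// pi_gt0.
by rewrite e1 ltxx.
Qed.

Section Ends.
Variables (a b : R).
Hypothesis ab : notch_ends a b.

Lemma notch_x_ge0 t : 0 <= t <= pi *+ 2 -> (0 <= (spiral k0 t).1) = (a <= t <= b).
Proof. by have [ha hb ea eb hab] := ab; exact: (spiral_x_ge0 _ _ _ _ _ (notch_weakly_wide _ _ x0)). Qed.

Lemma notch_sub t : a <= t <= b -> 0 <= t <= pi *+ 2.
Proof. by have [/andP[? ?] /andP[? ?] _ _ _] := ab; move=> /andP[? ?]; bounds. Qed.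

Lemma heartP p : G p <-> exists2 t, a <= t <= b & fold_x p = spiral k0 t.
Proof.
split=> [[k [t [/andP[k1 k2] t02 p0 e]]]|[t tab e]].
  have kk : k = k0 by apply/le_anti; rewrite k1 k2.
  by exists t; rewrite -?kk// -(notch_x_ge0 _ t02) -kk -e.
by exists k0, t; split=> //; [rewrite lexx|exact: notch_sub|exact: normr_ge0].
Qed.

Lemma notch_loop : loop fL fR (right_half gamma alpha k0 a) (left_half gamma alpha k0 b) (b - a) (b - a).
Proof. by have [ha hb ea eb hab] := ab; exact: reversible_loop. Qed.
Notation X := (loop_solution (right_half gamma alpha k0 a) (left_half gamma alpha k0 b) (b - a) (b - a)).

Lemma fold_flip p : fold_x (flip_x p) = fold_x p.
Proof. by rewrite /fold_x /flip_x /= normrN. Qed.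

Lemma notch_fold t : a <= t <= b -> fold_x (spiral k0 t) = spiral k0 t.
Proof.
move=> tab; have := notch_x_ge0 _ (notch_sub _ tab); rewrite tab => h'.
by rewrite /fold_x ger0_norm ?h'//; case: (spiral k0 t).
Qed.

Lemma notch_loop_heart t : G (X t).
Proof.
apply/heartP; have [[s /andP[s0 s1] ->]|[s /andP[s0 s1] ->]] := loop_range _ _ _ _ _ _ notch_loop t.
  have h1 : a <= a + s <= b by bounds.
  by exists (a + s) => //; exact: notch_fold.
have h1 : a <= b - s <= b by bounds.
by exists (b - s) => //; rewrite /left_half fold_flip; exact: notch_fold.
Qed.

Lemma heart_notch_loop p : G p -> exists t, X t = p.
Proof.
move=> /heartP[t tab e]; have [ha hb ea eb hab] := ab.
have [s1 s2] := reversible_loop_range _ _ _ _ _ _ ha hb ea eb hab tab.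
by have [->|->] := fold_xP p; rewrite e.
Qed.

(** The shift c starts the loop at the notch; an arc shorter than a full turn is injective. *)
Lemma notch_homoclinic c : X c = (0, 0) -> b - a < pi *+ 2 -> homoclinic_orbit F (0, 0) G.
Proof.
move=> Xc ba; pose T := (b - a) + (b - a).
have T0 : 0 < T by rewrite /T; have [/andP[? ?] /andP[? ?] _ _ _] := ab; lra.
exists (fun t => X (t + c)), T; split=> //.
- by apply: (loop_shift_filippov _ _ _ _ _ _ notch_loop); exact: affine_field_cont.
- by rewrite add0r.
- by rewrite (addrC T) (loop_periodic _ _ _ _ _ _ notch_loop).
split.
  have inj s t : 0 <= s <= b - a -> 0 <= t <= b - a -> `|s - t| < pi *+ 2.
    by move=> /andP[? ?] /andP[? ?]; rewrite ltr_norml; bounds.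
  move=> s t; rewrite !in_itv /= => hs ht.
  apply: (loop_shift_inj _ _ _ _ _ _ notch_loop) => //.
    move=> u w hu hw e; have d : `|a + u - (a + w)| < pi *+ 2.
      by have -> : a + u - (a + w) = u - w by [ring]; exact: inj.
    by have [_] := arc_inj _ _ _ _ _ _ kp (ltW kp) d e; lra.
  move=> u w hu hw /(congr1 flip_x); rewrite /left_half !flip_xK => e.
  have d : `|b - u - (b - w)| < pi *+ 2.
    by have -> : b - u - (b - w) = w - u by [ring]; exact: inj.
  by have [_] := arc_inj _ _ _ _ _ _ kp (ltW kp) d e; lra.
apply/seteqP; split=> p.
  move=> /heart_notch_loop[t <-].
  have [s /andP[s0 sT] e] := loop_shift_range _ _ _ _ _ _ notch_loop c t.
  by exists s => //; rewrite /= in_itv/= s0 ltW.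
by move=> [t _ <-]; exact: notch_loop_heart.
Qed.

(** The vertical velocity is - (1 + gamma^2) k0 g, so the height decreases as long as the point is
    to the left of the focus. *)
Lemma spiral_y_dec s t : 0 <= s -> s < t -> t <= pi -> 0 < g t -> (spiral k0 t).2 < (spiral k0 s).2.
Proof.
move=> s0 st tpi gt; apply: (@isd_gt _ (fun t => (spiral k0 t).2) (fun t => (fR (spiral k0 t)).2) _ _ st).
  move=> r /andP[r1 r2]; split; first by have [] := arc_solves gamma xr alpha k0 r erefl.
  rewrite -/((fR (spiral k0 r)).2) /fR affine_field_focus [X in X < 0]/= pmulr_rlt0// /focus /=.
  have : 0 < k0 * g r by rewrite mulr_gt0//; apply: (lt_trans gt); apply: gfun_dec => //; lra.
  lra.
by move=> r _; have [_ /isd_cont] := arc_solves gamma xr alpha k0 r erefl.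
Qed.

Lemma spiral_y_dec2 s t : pi <= s -> s < t -> t <= pi *+ 2 -> 0 < g s -> (spiral k0 t).2 < (spiral k0 s).2.
Proof.
move=> s0 st tpi gt; apply: (@isd_gt _ (fun t => (spiral k0 t).2) (fun t => (fR (spiral k0 t)).2) _ _ st).
  move=> r /andP[r1 r2]; split; first by have [] := arc_solves gamma xr alpha k0 r erefl.
  rewrite -/((fR (spiral k0 r)).2) /fR affine_field_focus [X in X < 0]/= pmulr_rlt0// /focus /=.
  have : 0 < k0 * g r by rewrite mulr_gt0//; apply: (lt_trans gt); apply: gfun_inc => //; lra.
  lra.
by move=> r _; have [_ /isd_cont] := arc_solves gamma xr alpha k0 r erefl.
Qed.

Lemma heart_sigma p : G p /\ p.1 = 0 <-> p = spiral k0 a \/ p = spiral k0 b.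
Proof.
have [/andP[a0 a1] /andP[b0 b1] ea eb hab] := ab.
split=> [[/heartP[t tab e] p0]|].
  have pE : p = spiral k0 t by rewrite -e /fold_x p0 normr0 -p0; case: (p).
  have := hab t (notch_sub _ tab); have := congr1 fst pE; rewrite p0 /= => e'.
  have -> : k0 * g t = xr by lra.
  rewrite ltxx => /esym/negbT; rewrite negb_and -!leNgt; case/andP: tab => t1 t2.
  by move=> /orP[?|?]; [left|right]; rewrite pE; congr spiral; apply/le_anti/andP; split.
have xa : (spiral k0 a).1 = 0 by rewrite /= ea subrr.
have xb : (spiral k0 b).1 = 0 by rewrite /= eb subrr.
have hA : a <= a <= b by bounds.
have hB : a <= b <= b by bounds.
by case=> ->; split=> //; apply/heartP; [exists a|exists b] => //; exact: notch_fold.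
Qed.

End Ends.

Lemma heart_flip : flip_x @` G = G.
Proof.
have key p : G p -> G (flip_x p).
  by move=> [k [t [kk tt p0 e]]]; exists k, t; rewrite fold_flip.
apply/seteqP; split=> p; first by move=> [q /key Gq <-].
by move=> /key Gp; exists (flip_x p) => //; rewrite flip_xK.
Qed.

Lemma spiral_sin0 k t : k * g t = xr -> sin t = 0 -> spiral k t = (0, 0).
Proof. by move=> /arc_y -> s0; rewrite /hfun s0 !mulr0 oppr0. Qed.

Lemma heart_homoclinic : homoclinic_orbit F (0, 0) G.
Proof.
have [a [b [ab [[gp [aE b2]]|[gn [a1 bE]]]]]] := notch_endsP.
  have [_ /andP[b0 _] ea eb _] := ab.
  apply: (notch_homoclinic a b ab 0); last by lra.
  rewrite (loop_solution_r _ _ _ _ _ _ (notch_loop _ _ ab)); last first.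
    by have pi0 := pi_gt0 R; bounds.
  by rewrite /right_half addr0; apply: spiral_sin0; rewrite // aE sin0.
have [/andP[a0 a2] _ ea eb _] := ab.
apply: (notch_homoclinic a b ab (b - a + 0)); last by lra.
have pi0 := pi_gt0 R.
rewrite (loop_solution_l _ _ _ _ _ _ (notch_loop _ _ ab)); last by bounds.
by rewrite /left_half subr0 (spiral_sin0 _ _ eb) ?bE ?sin2pi// /flip_x /= oppr0.
Qed.

Lemma heart_is_heart_shaped : heart_shaped G.
Proof.
have pi0 := pi_gt0 R.
split; first exact: heart_flip.
have [a [b [ab [[gp [aE b2]]|[gn [a1 bE]]]]]] := notch_endsP.
  have [/andP[a0 a1] /andP[b0 b1] ea eb hab] := ab.
  have hb : 0 < - (k0 * h b).
    by rewrite oppr_gt0 pmulr_rlt0//; apply: hfun_lt0; rewrite b0.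
  exists (- (k0 * h b)); split; first by apply/eqP; rewrite gt_eqF.
    move=> p; rewrite heart_sigma; last exact: ab.
    by rewrite (arc_y _ _ _ _ eb) spiral_sin0// aE sin0.
  (* The first bound keeps the point to the left of the focus, so that the height decreases along
     the arc; the second keeps it below the tip. On the first half of the arc the height is then
     negative. *)
  exists (Num.min xr (- (k0 * h b))); first by rewrite lt_min x0.
  move=> p /(heartP _ _ ab)[t tab e]; have t02 := notch_sub _ _ ab _ tab.
  rewrite -(norm_fold_x p) e prod_normE /= lt_min !gt_max => /and3P[p0 /andP[px _] /andP[_ py]].
  have pyE : p.2 = (spiral k0 t).2 by rewrite -e.
  have gt : 0 < g t.
    have := ler_norm (xr - k0 * g t); rewrite -(pmulr_rgt0 _ kp); lra.
  move: tab => /andP[ta tb]; have [tpi|pit] := leP t pi.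
    have t0 : 0 < t.
      rewrite lt_neqAle -aE ta andbT; apply/eqP => te; move: p0.
      by rewrite -te ea subrr mulr0 sub0r aE /hfun sin0 !mulr0 oppr0 normr0 maxxx ltxx.
    have := spiral_y_dec 0 t (lexx _) t0 tpi gt.
    have -> : spiral k0 0 = (0, 0) by apply: spiral_sin0; rewrite ?sin0// -ea aE.
    by rewrite -pyE => y0; rewrite nmulr_rlt0.
  (* On the second half the height decreases towards that of the tip, hence is at least as large,
     against the choice of the radius. *)
  exfalso; move: tb; rewrite le_eqVlt => /predU1P[te|tb].
    by move: py; rewrite te eb subrr mulr0 sub0r; rewrite ger0_norm ?ltW// ltxx.
  have := spiral_y_dec2 t b (ltW pit) tb b1 gt; rewrite (arc_y _ _ _ _ eb) /= => y0.
  have := ler_norm (2 * gamma * (xr - k0 * g t) - k0 * h t); lra.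
have [/andP[a0 a2] /andP[b0 b1] ea eb hab] := ab.
have ha : - (k0 * h a) < 0.
  by rewrite oppr_lt0 pmulr_rgt0//; apply: hfun_gt0; rewrite a1.
exists (- (k0 * h a)); split; first by apply/eqP; rewrite lt_eqF.
  move=> p; rewrite heart_sigma; last exact: ab.
  rewrite (arc_y _ _ _ _ ea) [in X in _ \/ X](spiral_sin0 _ _ eb) ?bE ?sin2pi//.
  by split=> -[]; tauto.
exists (Num.min xr (k0 * h a)); first by rewrite lt_min x0 -oppr_lt0.
move=> p /(heartP _ _ ab)[t tab e]; have t02 := notch_sub _ _ ab _ tab.
rewrite -(norm_fold_x p) e prod_normE /= lt_min !gt_max => /and3P[p0 /andP[px _] /andP[_ py]].
have pyE : p.2 = (spiral k0 t).2 by rewrite -e.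
have gt : 0 < g t.
  have := ler_norm (xr - k0 * g t); rewrite -(pmulr_rgt0 _ kp); lra.
move: tab => /andP[ta tb]; have [pit|tpi] := leP pi t.
  have t0 : t < pi *+ 2.
    rewrite lt_neqAle -bE tb andbT; apply/eqP => te; move: p0.
    by rewrite te eb subrr mulr0 sub0r bE /hfun sin2pi !mulr0 oppr0 normr0 maxxx ltxx.
  have := spiral_y_dec2 t (pi *+ 2) pit t0 (lexx _) gt.
  rewrite -pyE -bE spiral_sin0 ?bE ?sin2pi -?bE//= => y0.
  by rewrite nmulr_llt0.
exfalso; move: ta; rewrite le_eqVlt => /predU1P[te|ta].
  by move: py; rewrite -te ea subrr mulr0 sub0r normrN gtr0_norm ?ltxx// -oppr_lt0.
have := spiral_y_dec a t a0 ta (ltW tpi) gt; rewrite (arc_y _ _ _ _ ea) /= => y0.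
have := ler_norm (- (2 * gamma * (xr - k0 * g t) - k0 * h t)); rewrite normrN; lra.
Qed.

End Heart.

(** * Inside, outside and boundary of the heart *)

Section HeartRegions.
Context {R : realType}.
Variables (gamma alpha : R).
Let fL := affine_field (- gamma) (- alpha) 0.
Let fR := affine_field gamma alpha 0.
Let F := filippov fL fR.
Notation xr := (alpha / (1 + gamma ^+ 2)).
Notation spiral := (spiral_curve gamma xr).
Notation g := (gfun gamma).
Notation h := (hfun gamma).
Hypotheses (g0 : gamma <> 0) (x0 : 0 < xr).
Implicit Types (k t a b : R) (p : R * R).
Notation k0 := (notch_size gamma alpha).
Notation O := (outer_region gamma alpha).
Notation G := (heart gamma alpha).
Let kp : 0 < k0 := notch_size_gt0 _ _ x0.

Lemma outer_region_far : exists r : R, forall p, r < `|p| -> O p.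
Proof.
have [M hM] := arc_bound gamma xr k0; exists M => p pM [k [t [kk tt _ e]]].
have := hM k t kk tt; rewrite -e norm_fold_x; lra.
Qed.

(** O is connected, unbounded and disjoint from G. Conversely O is open and its union with G is
    closed, so a component of the complement of G that starts outside O never enters it, and the
    complement of O is bounded. *)
Lemma outer_region_outside : O = outside G.
Proof.
have [r hr] := outer_region_far.
apply/seteqP; split=> p.
  move=> Op; split; first by move=> /(heart_not_outer _ _ x0)/(_ Op).
  move=> [M [_ hM]].
  pose N := `|r| + `|M| + 2.
  have rN : r < N by rewrite /N; have := ler_norm r; have := normr_ge0 M; lra.
  have MN : M + 1 < N by rewrite /N; have := ler_norm M; have := normr_ge0 r; lra.
  have N0 : 0 <= N by rewrite /N !addr_ge0.
  have nq : `|(N, 0) : R * R| = N by rewrite prod_normE /= normr0 ger0_norm// max_l.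
  have Oq : O (N, 0) by apply: hr; rewrite nq.
  have : `|(N, 0) : R * R| <= M + 1.
    apply: (hM (M + 1)); first by rewrite ltrDl.
    have := outer_region_component _ _ g0 x0 _ _ Op Oq.
    have OG : O `<=` ~` G by move=> q Oq' /(heart_not_outer _ _ x0)/(_ Oq').
    move=> [B [Bp BO cB] Bq]; exists B => //; split=> //.
    exact: subset_trans BO OG.
  by rewrite nq; lra.
move=> [Gp nb]; apply: contrapT => nO; apply: nb.
pose C := connected_component (~` G) p.
have CG : C `<=` ~` G by exact: connected_component_sub.
have Cp : C p by apply: connected_component_refl.
have cC : connected C by exact: component_connected.
have CO : C `&` ~` O = C.
  apply: cC; first by exists p.
    exists (~` (O `|` G)); first by rewrite openC; exact: outer_heart_closed.
    apply/seteqP; split=> q [Cq nq]; split=> //; last by move=> Oq; apply: nq; left.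
    by move=> [//|Gq]; exact: CG Cq Gq.
  by exists (~` O) => //; rewrite closedC; exact: outer_region_open.
exists r; split; first exact: num_real.
move=> M rM q; rewrite -/C -CO => -[_ nOq]; rewrite /= leNgt; apply/negP => Mq.
by apply: nOq; apply: hr; exact: lt_trans Mq.
Qed.

Lemma inside_heart p : ~ O p -> ~ G p -> inside G p.
Proof.
move=> nO nG; split=> //; apply: contrapT => nb; apply: nO.
by rewrite outer_region_outside.
Qed.

(** A focus has size 0, and the heart and the outer region consist of points of size at least k0 >
    0. *)
Lemma focus_inside p : fold_x p = spiral 0 0 -> inside G p.
Proof.
move=> e; have key k t : k0 <= k -> 0 <= t <= pi *+ 2 -> fold_x p = spiral k t -> False.
  move=> kk tt e'; have k1 : 0 < k := lt_le_trans kp kk.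
  have e2 : spiral k t = spiral 0 t by rewrite -e' e /spiral_curve; congr pair; ring.
  have d : `|t - t| < pi *+ 2 by rewrite subrr normr0 pmulrn_lgt0// pi_gt0.
  by have [k00 _] := arc_inj _ _ _ _ _ _ k1 (lexx 0) d e2; move: k1; rewrite k00 ltxx.
apply: inside_heart.
  by move=> /(outer_regionP _ _ x0)[k [t [/(wideP _ _ x0)/ltW kw tt e']]]; exact: key e'.
by move=> [k [t [/andP[k1 _] tt _ e']]]; exact: key e'.
Qed.

Lemma period_annulus_outer : period_annulus_at_infinity fL fR = O.
Proof.
have [r hr] := outer_region_far.
rewrite /period_annulus_at_infinity crossing_periodic_set_outer//.
apply/seteqP; split=> p.
  move=> [s hs]; apply: contrapT => nO.
  have : connected_component O p (`|s| + 1, 0).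
    apply: hs; rewrite prod_normE /= normr0 max_l// ger0_norm ?addr_ge0//.
    by have := ler_norm s; lra.
  by rewrite connected_component_out.
by move=> Op; exists r => q /hr Oq; exact: outer_region_component.
Qed.

(** An interior point of an arc of the heart is the limit of points with the same angle on slightly
    larger spirals. [sg] is the identity or the reflection and treats both lobes at once. *)
Lemma heart_boundary : closure O `\` O = G.
Proof.
apply/seteqP; split=> p.
  move=> [cO nO]; have : closure (O `|` G) p by apply: (closureS _ cO) => q; left.
  by rewrite -(closure_id _).1; [case|exact: outer_heart_closed].
move=> Gp; split; last exact: heart_not_outer.
have [a [b [ab _]]] := notch_endsP _ _ g0 x0.
have [/andP[a0 a1] /andP[b0 b1] ea eb hab] := ab.
have /(heartP _ _ x0 _ _ ab)[t tab e] := Gp.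
have [sg [csg fsg pE]] : exists sg : R * R -> R * R, [/\ continuous sg,
    (forall q, fold_x (sg q) = fold_x q) & p = sg (spiral k0 t)].
  have [pE|pE] := fold_xP p; rewrite e in pE.
    by exists (fun q => q); split=> // q; exact: cvg_id.
  exists flip_x; split=> //; last exact: fold_flip.
  move=> q; apply: (@cvg_pair _ _ _ (nbhs q) (nbhs (- q.1)) (nbhs q.2) _ _ _ (fun q => - q.1) (fun q => q.2)).
    by apply: cvgN; exact: cvg_fst.
  exact: cvg_snd.
have c2 := spiral_cont2 gamma xr.
have inner s : a < s < b -> closure O (sg (spiral k0 s)).
  move=> sab B nB.
  have s02 : 0 <= s <= pi *+ 2 by move: sab => /andP[? ?]; bounds.
  have ck : {for k0, continuous (fun k => spiral k s)}.
    apply: (@continuous_comp _ _ _ (fun k : R => (k, s)) (fun q : R * R => spiral q.1 q.2)); last exact: c2.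
    by apply: (@cvg_pair _ _ _ (nbhs k0) (nbhs k0) (nbhs s)); [exact: cvg_id|exact: cvg_cst].
  have csk : {for k0, continuous (fun k => sg (spiral k s))}.
    by apply: (@continuous_comp _ _ _ (fun k => spiral k s) sg); [exact: ck|exact: csg].
  have [e1 e10 h1] : nbhs k0 ((fun k => sg (spiral k s)) @^-1` B) by exact: csk.
  have xs : 0 < (spiral k0 s).1 by rewrite arc_x_gt0 hab.
  have cx : {for k0, continuous (fun k => (spiral k s).1)} by have /cont_pair[] := ck.
  have [e2 e20 h2] := near_cont_gt0 _ _ _ cx xs.
  pose d := Num.min e1 e2 / 2.
  have d0 : 0 < d by rewrite divr_gt0// lt_min e20 andbT.
  have d1 : d < e1.
    by have : Num.min e1 e2 <= e1 by [rewrite ge_min lexx]; move: d0; rewrite /d; lra.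
  have d2 : d < e2.
    by have : Num.min e1 e2 <= e2 by [rewrite ge_min lexx orbT]; move: d0; rewrite /d; lra.
  exists (sg (spiral (k0 + d) s)); split; last first.
    apply: h1; rewrite /ball_ /= opprD addrA subrr sub0r normrN gtr0_norm//.
  apply/(outer_regionP _ _ x0); exists (k0 + d), s; split=> //.
    by apply/(wideP _ _ x0); rewrite ltrDl.
  rewrite fsg /fold_x gtr0_norm; first by case: (spiral _ _).
  by apply: h2; rewrite addrC addKr gtr0_norm.
(* At an end of the arc enlarging the spiral leaves the half-plane, so the ends are reached as
   limits of interior points of the arc. *)
have [/andP[ta tb]|] := boolP (a < t < b); first by rewrite pE; apply: inner; rewrite ta.
rewrite negb_and -!leNgt => tE.
have tabE : t = a \/ t = b.
  by move: tab => /andP[t1 t2]; case/orP: tE => ?; [left|right]; apply/le_anti/andP; split.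
have ct : {for t, continuous (fun s => sg (spiral k0 s))}.
  apply: (@continuous_comp _ _ _ (fun s => spiral k0 s) sg); last exact: csg.
  exact: arc_cont.
rewrite pE => B /nbhs_interior/ct[e1 e10 h1].
have [s [sab st]] : exists s, a < s < b /\ `|t - s| < e1.
  have e1' : 0 < e1 by [].
  pose d := Num.min (e1 / 2) ((b - a) / 2).
  have d0 : 0 < d by rewrite lt_min; bounds.
  have [d1 d2] : d <= e1 / 2 /\ d <= (b - a) / 2 by rewrite /d !ge_min !lexx orbT.
  case: tabE => ->; [exists (a + d)|exists (b - d)]; split.
  - by bounds.
  - by rewrite opprD addrA subrr sub0r normrN gtr0_norm//; lra.
  - by bounds.
  - by rewrite opprB addrCA subrr addr0 gtr0_norm//; lra.
by have /inner := sab; apply; exact: h1.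
Qed.

(** The right orbit through the origin is the spiral of size xr at t = 0, with abscissa xr (1 - g
    t), and g has a strict maximum 1 at 0 on ]- pi, pi[. The left one is its mirror image run
    backwards. *)
Lemma heart_pseudo_saddle : pseudo_saddle fL fR (0, 0).
Proof.
have pi0 := pi_gt0 R.
have e0 : spiral xr 0 = (0, 0) by apply: spiral_sin0; rewrite ?sin0// gfun0 mulr1.
have dg t : is_derive t (1 : R) g (- h t) by exact: gfun_der.
have hneg t : - pi < t < 0 -> h t < 0.
  move=> /andP[t1 t2]; rewrite /hfun pmulr_rlt0 ?D_gt0// pmulr_rlt0 ?expR_gt0//.
  by rewrite -oppr_gt0 -sinN; apply: sin_gt0_pi; bounds.
have g1 t : 0 < `|t| < pi -> g t < 1.
  move=> /andP[t0 tpi]; rewrite -(gfun0 gamma).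
  have [tn|tp|te] := ltgtP t 0; last by rewrite te normr0 ltxx in t0.
    apply: (@isd_lt _ g (fun t => - h t) _ _ tn) => r /andP[r1 r2]; last exact: gfun_cont.
    split=> //; rewrite oppr_gt0; apply: hneg; move: tpi; rewrite ltr0_norm// => tpi.
    by bounds.
  by apply: gfun_dec => //; move: tpi; rewrite gtr0_norm// => /ltW.
have xpos t : 0 < `|t| < pi -> 0 < (spiral xr t).1.
  by move=> /g1 h1; rewrite arc_x_gt0 gtr_pMr.
have near (P : R -> Prop) : (forall t, 0 < `|t| < pi -> P t) -> \forall t \near (0 : R)^', P t.
  move=> hP; near=> t; apply: hP; apply/andP; split.
    by rewrite normr_gt0; near: t; exact: nbhs_dnbhs_neq.
  by near: t; apply: dnbhs0_lt.
split; split=> //.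
- by rewrite /fL /affine_field /=; ring.
- move=> X sX X0.
  have sY : smooth_solution fL (left_half gamma alpha xr 0).
    by apply/smooth_solutionP => t; exact: left_half_solves.
  have Y0 : left_half gamma alpha xr 0 0 = (0, 0).
    by rewrite /left_half subr0 e0 /flip_x /= oppr0.
  apply: near => t tpi.
  rewrite (smooth_solution_flow _ _ _ _ sX) X0 -Y0 -(smooth_solution_flow _ _ _ _ sY).
  by rewrite /left_half sub0r [X in X < 0]/= oppr_lt0; apply: xpos; rewrite normrN.
- by rewrite /fR /affine_field /=; ring.
- move=> X sX X0.
  have sY : smooth_solution fR (spiral xr).
    by apply/smooth_solutionP => t; exact: arc_solves.
  apply: near => t tpi.
  rewrite (smooth_solution_flow _ _ _ _ sX) X0 -e0 -(smooth_solution_flow _ _ _ _ sY).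
  exact: xpos.
Unshelve. all: by end_near. Qed.

(** Both foci are equilibria, so each of them would have to be the center point. *)
Lemma real_foci_not_global : ~ global_center F.
Proof.
move=> [c hc].
have nR : ~ orbit_through F periodic_orbit (xr, 2 * gamma * xr).
  apply: not_through_equilibrium; apply: Or32; split=> //.
  by rewrite affine_field_focus /focus /=; congr pair; ring.
have nL : ~ orbit_through F periodic_orbit (- xr, 2 * gamma * xr).
  apply: not_through_equilibrium; apply: Or31; split; first by rewrite /= oppr_lt0.
  by rewrite affine_field_focus /focus /= sqrrN mulNr; congr pair; ring.
have eR : (xr, 2 * gamma * xr) = c by apply: contrapT => /hc.
have eL : (- xr, 2 * gamma * xr) = c by apply: contrapT => /hc.
by move: x0; have := congr1 fst (etrans eR (esym eL)); rewrite /=; lra.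
Qed.

End HeartRegions.

(** * The first return to x = 0 far from the origin *)

Section HalfMap.
Context {R : realType}.

Lemma der_le0 (f : R -> R) (z d e : R) : is_derive z 1 f d -> 0 < e -> f z = 0 ->
  (forall t, z - e < t < z -> 0 < f t) -> d <= 0.
Proof.
move=> /is_derive_cvgP/cvgrPdist_lt h e0 fz hf; rewrite leNgt; apply/negP => d0.
have := h d d0 => -[r r0 hr].
pose k := - (Num.min r e / 2).
have m0 : 0 < Num.min r e by rewrite lt_min r0.
have [mr me] : Num.min r e <= r /\ Num.min r e <= e by rewrite !ge_min !lexx orbT.
have k0 : k < 0 by rewrite /k; lra.
have : `|d - k^-1 *: (f (k *: 1 + z) - f z)| < d.
  apply: hr; last by rewrite lt_eqF.
  by rewrite /ball_ /= sub0r normrN ltr0_norm// /k; lra.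
rewrite fz subr0 ltr_distlC => /andP[h2 _].
have fk : 0 < f (k *: 1 + z).
  by apply: hf; rewrite [k *: 1]mulr1 /k; bounds.
have : k^-1 *: f (k *: 1 + z) < 0 by rewrite [_ *: _]/(_ * _) nmulr_rlt0 ?invr_lt0.
by move: h2; rewrite subrr; lra.
Qed.

(* In polar coordinates (rho, theta) centred at the focus, chosen so that orbits are
   rho = C exp (gamma theta), this is the first integral ln rho - gamma theta at (0, s): the branch
   of atan jumps by pi between s -> -oo and s -> +oo, so Phi grows by gamma pi on a half-turn. *)
Definition Phi (gamma x b s : R) : R :=
  ln ((s - (b + gamma * x)) ^+ 2 + x ^+ 2) / 2 - gamma * atan (x / (s - (b + gamma * x))).

Lemma atan_polar (v x : R) (rho := Num.sqrt (v ^+ 2 + x ^+ 2)) (th := atan (x / v)) : 0 < v ->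
  v = rho * cos th /\ x = rho * sin th.
Proof.
move=> v0; have r2 : rho ^+ 2 = v ^+ 2 + x ^+ 2 by rewrite sqr_sqrtr// addr_ge0 ?sqr_ge0.
have r0 : 0 < rho by rewrite sqrtr_gt0 ltr_pwDl ?sqr_ge0// exprn_gt0.
have c0 : 0 < cos th by apply: cos_gt0_pihalf; rewrite atan_gtNpi2 atan_ltpi2.
have tE : sin th = x / v * cos th by rewrite -(atanK (x / v)) /tan divfK ?gt_eqF.
have vE : v = rho * cos th.
  apply/eqP; rewrite -(@eqrXn2 _ 2)// ?ltW ?mulr_gt0// exprMn r2; apply/eqP.
  have := cos2Dsin2 th; rewrite tE => cs.
  have : (v ^+ 2 + x ^+ 2) * cos th ^+ 2 = v ^+ 2 * (cos th ^+ 2 + (x / v * cos th) ^+ 2).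
    by field; rewrite gt_eqF.
  by rewrite cs mulr1.
by split=> //; rewrite tE mulrCA -vE divfK ?gt_eqF.
Qed.

(** Seen from the focus, the half-turn lasts tau = pi + th1 + th0 and multiplies the distance by
    exp(gamma tau), where th0 and th1 are the arctangents of the two ends; these are the ones
    subtracted in [Phi], and gamma pi remains. *)
Lemma half_map (gamma alpha b : R) (x := alpha / (1 + gamma ^+ 2)) (B : R) :
  exists S : R, forall (X : R -> R * R) (t0 eta : R), continuous X ->
  (forall t, 0 < (X t).1 -> solves_at (affine_field gamma alpha b) X t) ->
  X t0 = (0, - eta) -> (exists2 e : R, 0 < e & forall s, t0 < s < t0 + e -> 0 < (X s).1) ->
  S < eta ->
  exists t1 zeta, [/\ t0 < t1, X t1 = (0, zeta), B < zeta &
    Phi gamma x b zeta - Phi gamma x b (- eta) = gamma * pi].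
Proof.
have pi0 := pi_gt0 R.
pose c := b + gamma * x; pose m := expR (- (`|gamma| * (pi *+ 2))).
(* m bounds exp(gamma t) from below over a turn. K < m v0 is what makes the orbit come back, and
   come back above B. *)
pose K := `|x| + `|gamma * x| + `|B| + `|c| + 1.
have m0 : 0 < m by exact: expR_gt0.
have K0 : 0 < K by rewrite /K ltr_pwDr// !addr_ge0.
exists (K / m + `|c|) => X t0 eta cX sX X0 [e e0 he] Seta.
pose v0 := eta + c.
have mv0 : K < m * v0.
  rewrite -ltr_pdivrMl// mulrC /v0.
  by have : - c <= `|c| by [rewrite -normrN ler_norm]; lra.
have v00 : 0 < v0 by rewrite -(pmulr_rgt0 _ m0); lra.
have mE t : 0 <= t <= pi *+ 2 -> m <= expR (gamma * t).
  move=> /andP[t1 t2]; rewrite ler_expR.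
  have : - gamma * t <= `|gamma| * (pi *+ 2).
    apply: (@le_trans _ _ (`|gamma| * t)); last by rewrite ler_wpM2l.
    by rewrite ler_wpM2r// -normrN ler_norm.
  lra.
(* At this time the abscissa would be x - exp(gamma T) v0 < 0, so the orbit has returned to Sigma
   before. *)
pose T : R := 3 * pi / 2.
have flowE t : flow gamma alpha b (X t0) t =
    (x + expR (gamma * t) * (- x * cos t + v0 * sin t),
     c + gamma * (x + expR (gamma * t) * (- x * cos t + v0 * sin t)) -
     expR (gamma * t) * (v0 * cos t + x * sin t)).
  by rewrite X0 /flow /focus /= -/x /v0 /c; congr pair; ring.
have uniq t : t0 <= t -> (forall s, t0 < s < t -> 0 < (X s).1) ->
    X t = flow gamma alpha b (X t0) (t - t0).
  move=> tt hs; apply: (@flow_unique _ _ _ _ X t0 t).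
  - by move=> s /hs; exact: sX.
  - by move=> s _; exact: cX.
  - by rewrite lexx.
  - by rewrite lexx tt.
have [s [s0 sT xs]] : exists s, [/\ t0 < s, s <= t0 + T & (X s).1 <= 0].
  apply: contrapT => hn.
  have pos s : t0 < s <= t0 + T -> 0 < (X s).1.
    by move=> /andP[s1 s2]; rewrite ltNge; apply/negP => xs; apply: hn; exists s.
  have TT : t0 <= t0 + T by rewrite /T; lra.
  have TT' : t0 < t0 + T <= t0 + T by rewrite lexx andbT /T; lra.
  have := pos _ TT'; rewrite (uniq _ TT); last first.
    by move=> s /andP[s1 s2]; apply: pos; rewrite s1 ltW.
  have -> : t0 + T - t0 = T by ring.
  have TE : T = pi / 2 + pi by rewrite /T; field.
  rewrite flowE /= {2 3}TE sinDpi cosDpi sin_pihalf cos_pihalf.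
  have : m * v0 <= expR (gamma * T) * v0.
    by rewrite ler_pM2r//; apply: mE; rewrite /T; bounds.
  have := ler_norm x; move: mv0; rewrite /K.
  have := normr_ge0 (gamma * x); have := normr_ge0 B; have := normr_ge0 c; lra.
pose s1 := Num.min (t0 + e / 2) ((t0 + s) / 2).
have [s1a s1b] : s1 <= t0 + e / 2 /\ s1 <= (t0 + s) / 2 by rewrite !ge_min !lexx orbT.
have ts1 : t0 < s1 by rewrite lt_min; bounds.
have xs1 : 0 < (X s1).1 by apply: he; rewrite ts1; lra.
have c1 t : {for t, continuous (fun s => (X s).1)} by have /cont_pair[] := cX t.
have [||z [/andP[z1 z2] xz hz]] := first_zero_down (fun s => (X s).1) s1 s _ _ xs1 xs.
- by lra.
- by move=> t _; exact: c1.
have posz t : t0 < t < z -> 0 < (X t).1.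
  move=> /andP[t1 t2]; have [ts|st] := leP s1 t; first by apply: hz; rewrite ts.
  by apply: he; rewrite t1; lra.
pose tau := z - t0.
have tau0 : 0 < tau by rewrite /tau; lra.
have tauT : tau <= T by rewrite /tau; lra.
have Xz : X z = flow gamma alpha b (X t0) tau by apply: uniq => //; lra.
have E0 : 0 < expR (gamma * tau) by exact: expR_gt0.
pose v1 := expR (gamma * tau) * (v0 * cos tau + x * sin tau).
have u1 : expR (gamma * tau) * (- x * cos tau + v0 * sin tau) = - x.
  by have := xz; rewrite Xz flowE /=; lra.
have yz : (X z).2 = c - v1.
  by have := xz; rewrite Xz flowE /= => ->; rewrite mulr0 addr0.
have XzE : X z = (0, c - v1) by rewrite -yz -xz; case: (X z).
(* At the first return the abscissa comes down to 0, so its derivative v1 - gamma x is not positive.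
   As |v1| is large, v1 is negative: the return is on the upper half-axis. *)
have v1le : v1 <= gamma * x.
  have dz : is_derive z 1 (fun t => (flow gamma alpha b (X t0) (t - t0)).1) (b - (c - v1)).
    have [d _] := solves_at_shift (affine_field gamma alpha b) (flow gamma alpha b (X t0)) (- t0) z (flow_solves _ _ _ _ _).
    by apply: (isd_eq d); rewrite -/tau -Xz XzE /affine_field /=; ring.
  have := der_le0 _ _ _ tau dz tau0; rewrite -/tau -Xz xz => /(_ erefl) h.
  suff : b - (c - v1) <= 0 by rewrite /c; lra.
  apply: h => t /andP[t1 t2]; have tz : t0 < t < z by move: t1; rewrite /tau t2 => ?; rewrite andbT; lra.
  rewrite -uniq; first exact: posz.
    by case/andP: tz => /ltW.
  by move=> r /andP[r1 r2]; apply: posz; rewrite r1; case/andP: tz => _ /(lt_trans r2).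
have norm1 : v1 ^+ 2 + x ^+ 2 = expR (gamma * tau) ^+ 2 * (v0 ^+ 2 + x ^+ 2).
  have -> : x ^+ 2 = (- x) ^+ 2 by rewrite sqrrN.
  rewrite -{1}u1 /v1 sqrrN -[v0 ^+ 2 + x ^+ 2]mulr1 -(cos2Dsin2 tau); ring.
have mtau : m <= expR (gamma * tau) by apply: mE; move: tauT; rewrite /T => ?; bounds.
have v1big : `|gamma * x| + `|B| + `|c| + 1 < `|v1|.
  rewrite ltNge; apply/negP => hv.
  have h1 : K ^+ 2 < v1 ^+ 2 + x ^+ 2.
    rewrite norm1; apply: (@lt_le_trans _ _ ((m * v0) ^+ 2)).
      by rewrite ltr_pXn2r// nnegrE ltW// (lt_trans K0).
    rewrite exprMn; apply: ler_pM; [exact: sqr_ge0|exact: sqr_ge0| |by rewrite lerDl sqr_ge0].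
    by rewrite ler_pXn2r// nnegrE ltW.
  have h2 : v1 ^+ 2 <= (`|gamma * x| + `|B| + `|c| + 1) ^+ 2.
    by rewrite -(real_normK (num_real v1)) ler_pXn2r// nnegrE// !addr_ge0.
  have h3 := real_normK (num_real x).
  move: h1 h2; rewrite /K -h3.
  have := normr_ge0 x; have := normr_ge0 (gamma * x); have := normr_ge0 B; have := normr_ge0 c.
  move: (`|x|) (`|gamma * x|) (`|B|) (`|c|) => a1 a2 a3 a4 ? ? ? ?; nra.
have v10 : v1 < 0.
  rewrite ltNge; apply/negP => v1p; move: v1big; rewrite (ger0_norm v1p).
  have := ler_norm (gamma * x); have := normr_ge0 B; have := normr_ge0 c; lra.
exists z, (c - v1); split=> //; first by lra.
  move: v1big; rewrite (ltr0_norm v10).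
  have := ler_norm B; have := normr_ge0 (gamma * x).
  have : - c <= `|c| by rewrite -normrN ler_norm.
  lra.
have nv1 : 0 < - v1 by rewrite oppr_gt0.
have [p1 p2] := atan_polar v0 x v00; have [q1 q2] := atan_polar (- v1) x nv1.
set th0 := atan (x / v0) in p1 p2; set th1 := atan (x / - v1) in q1 q2.
(* Both sides have the same cosine and sine once th0 is subtracted, and they differ by less than 2
   pi because 0 < tau <= 3 pi / 2. *)
have tauE : tau = pi + th1 + th0.
  pose rho0 := Num.sqrt (v0 ^+ 2 + x ^+ 2); pose rho1 := Num.sqrt ((- v1) ^+ 2 + x ^+ 2).
  rewrite -/rho0 in p1 p2; rewrite -/rho1 in q1 q2.
  have r10 : 0 < rho1 by rewrite sqrtr_gt0 ltr_pwDl ?sqr_ge0// exprn_even_gt0//= lt0r_neq0.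
  have rE : rho1 = expR (gamma * tau) * rho0.
    rewrite /rho1 sqrrN norm1 sqrtrM ?sqr_ge0// sqrtr_sqr gtr0_norm//.
  have cE : cos (tau - th0) = - cos th1.
    apply: (mulfI (lt0r_neq0 r10)); rewrite mulrN -q1 opprK /v1 rE cosB.
    have -> : v0 * cos tau + x * sin tau = rho0 * (cos tau * cos th0 + sin tau * sin th0).
      by rewrite {1}p1 {1}p2; ring.
    by ring.
  have sE : sin (tau - th0) = - sin th1.
    apply: (mulfI (lt0r_neq0 r10)); rewrite mulrN -q2 -u1 rE sinB.
    have -> : - x * cos tau + v0 * sin tau = rho0 * (sin tau * cos th0 - cos tau * sin th0).
      by rewrite {1}p1 {1}p2; ring.
    by ring.
  suff : tau - th0 - (th1 + pi) = 0 by lra.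
  apply: cos_eq1; last first.
    by rewrite cosB cE sE cosDpi sinDpi !mulrNN -!expr2 cos2Dsin2.
  have := atan_gtNpi2 (x / v0); have := atan_ltpi2 (x / v0).
  have := atan_gtNpi2 (x / - v1); have := atan_ltpi2 (x / - v1).
  rewrite -/th0 -/th1; move: tauT; rewrite /T => h1 h2 h3 h4 h5.
  by rewrite ltr_norml; clear -pi0 tau0 h1 h2 h3 h4 h5; bounds.
rewrite /Phi -/c.
have -> : c - v1 - c = - v1 by ring.
have -> : - eta - c = - v0 by rewrite /v0; ring.
have -> : x / - v0 = - (x / v0) by rewrite invrN mulrN.
rewrite atanN -/th0 -/th1 !sqrrN norm1.
rewrite lnM ?posrE ?exprn_gt0//; last by rewrite ltr_pwDl ?sqr_ge0// exprn_gt0.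
have -> : ln (expR (gamma * tau) ^+ 2) = 2 * (gamma * tau) by rewrite expr2 lnM ?posrE// expRK; ring.
by rewrite {1}tauE; field.
Qed.

End HalfMap.

(** * The first integral along Sigma near infinity *)

Section PhiTheory.
Context {R : realType}.

(** The numerator is minus the horizontal velocity b - s of the right field at (0, s), so [Phi]
    increases far up the axis. *)
Lemma Phi_der (gamma x b s : R) (c := b + gamma * x) : c != s ->
  is_derive s 1 (Phi gamma x b) ((s - b) / ((s - c) ^+ 2 + x ^+ 2)).
Proof.
move=> cs; have w0 : s - c != 0 by rewrite subr_eq0 eq_sym.
have A0 : 0 < (s - c) ^+ 2 + x ^+ 2 by rewrite ltr_pwDl ?sqr_ge0// exprn_even_gt0.
have d1 : is_derive s 1 (fun s => (s - c) ^+ 2 + x ^+ 2) (2 * (s - c)) by der; ring.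
have d2 := isd_comp d1 (is_derive1_ln A0).
have d3 : is_derive s 1 (fun s : R => s - c) (1 : R) by der; ring.
have d4 := isd_mul (isd_cst x s) (@isd_inv _ (fun s => s - c) s _ w0 d3).
have d5 := isd_comp d4 (is_derive1_atan (x / (s - c))).
have d6 := isd_add (isd_mul d2 (isd_cst (2^-1) s)) (isd_opp (isd_mul (isd_cst gamma s) d5)).
apply: (isd_eq d6).
have -> : s - b = s - c + gamma * x by rewrite /c; ring.
have A1 := lt0r_neq0 A0; move: {d1 d2 d3 d4 d5 d6 A0} w0 A1; move: (s - c) => w w0 A1.
have B1 : 1 + (x / w) ^+ 2 = (w ^+ 2 + x ^+ 2) / w ^+ 2 by field.
by rewrite B1 invf_div; field; rewrite A1 w0.
Qed.

Lemma Phi_ln (gamma x b e : R) : 0 < e ->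
  exists2 S : R, 0 < S & forall s, S < `|s| -> `|Phi gamma x b s - ln `|s| | < e.
Proof.
move=> e0; pose c := b + gamma * x.
(* With r = 1 / s, the difference of [Phi] and ln |s| is F r, which is continuous at r = 0 and
   vanishes there; this serves both ends of Sigma. *)
pose f (r : R) := (1 - c * r) ^+ 2 + (x * r) ^+ 2.
pose F (r : R) := ln (f r) / 2 - gamma * atan (x * r * (1 - c * r)^-1).
have f0 : f 0 = 1 by rewrite /f !mulr0; ring.
have d1 : is_derive (0 : R) 1 f (- (2 * c)).
  by rewrite /f; der; rewrite !mulr0; ring.
have d2 : is_derive (0 : R) 1 (fun r => 1 - c * r) (- c) by der; ring.
have f00 : 0 < f 0 by rewrite f0.
have n0 : 1 - c * 0 != 0 by rewrite mulr0 subr0 oner_neq0.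
have d3 := isd_comp d1 (is_derive1_ln f00).
have d4 : is_derive (0 : R) 1 (fun r => x * r) x by der; ring.
have d5 := isd_comp (isd_mul d4 (@isd_inv _ (fun r => 1 - c * r) 0 _ n0 d2)) (is_derive1_atan _).
have d6 := isd_add (isd_mul d3 (isd_cst (2^-1) 0)) (isd_opp (isd_mul (isd_cst gamma 0) d5)).
have F0 : F 0 = 0 by rewrite /F f0 ln1 !mulr0 !mul0r atan0 mulr0 subr0.
have cF : {for 0, continuous F} by exact: isd_cont d6.
have cF' : {for 0, continuous (fun r => - `|F r|)} by apply: cvgN; apply: cvg_norm; exact: cF.
have [|d d0 hd] := near_cont_gt0 _ _ (- e) cF'; first by rewrite F0 normr0 oppr0 oppr_lt0.
exists (d^-1 + `|c|); first by rewrite ltr_pwDl// invr_gt0.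
move=> s sS; have d1' : 0 < d^-1 by rewrite invr_gt0.
have s0 : s != 0.
  by rewrite -normr_gt0; have := normr_ge0 c; lra.
have sc : s - c != 0.
  rewrite subr_eq0; apply/eqP => sc; move: sS; rewrite sc; lra.
have sd : `|s^-1 - 0| < d.
  rewrite subr0 normrV ?unitfE// invf_plt ?posrE ?normr_gt0//.
  by have := normr_ge0 c; lra.
have := hd _ sd; rewrite ltrN2; suff -> : Phi gamma x b s - ln `|s| = F s^-1 by [].
have sn : 0 < `|s| by rewrite normr_gt0.
have fs : (s - c) ^+ 2 + x ^+ 2 = `|s| ^+ 2 * f s^-1.
  by rewrite real_normK ?num_real// /f; field.
have fp : 0 < f s^-1.
  rewrite /f ltr_pwDl ?sqr_ge0// exprn_even_gt0//=.
  have -> : 1 - c * s^-1 = (s - c) / s by field.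
  by rewrite mulf_neq0// invr_neq0.
rewrite /Phi -/c fs lnM ?posrE ?exprn_gt0// expr2 lnM ?posrE// /F.
have -> : x * s^-1 * (1 - c * s^-1)^-1 = x / (s - c) by field; rewrite s0 sc.
by field.
Qed.

Lemma N_limit (g1 x1 g2 x2 b e : R) : 0 < e ->
  exists2 S : R, 0 < S & forall s, S < s -> `|Phi g1 x1 b s - Phi g2 x2 b (- s)| < e.
Proof.
move=> e0; have e2 : 0 < e / 2 by rewrite divr_gt0.
have [S1 S10 h1] := Phi_ln g1 x1 b _ e2; have [S2 S20 h2] := Phi_ln g2 x2 b _ e2.
exists (S1 + S2); first by rewrite addr_gt0.
move=> s sS; have s0 : 0 < s by lra.
have a1 := h1 s; have a2 := h2 (- s); rewrite !normrN !(gtr0_norm s0) in a1 a2.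
have -> : Phi g1 x1 b s - Phi g2 x2 b (- s) =
  (Phi g1 x1 b s - ln s) - (Phi g2 x2 b (- s) - ln s) by ring.
apply: le_lt_trans (ler_normB _ _) _; rewrite [ltRHS](splitr e).
by apply: ltrD; [apply: a1|apply: a2]; lra.
Qed.

(* The polynomial on the right is s ^+ 3 times the numerator of the derivative of the difference
   N s := Phi g1 x1 b s - Phi g2 x2 b (- s), which tends to 0 at +oo. *)
Lemma N_compare (g1 x1 g2 x2 b k : R) (c1 := b + g1 * x1) (c2 := b + g2 * x2) :
  (exists S, forall s, S < s -> 2 * k * (((s - c1) ^+ 2 + x1 ^+ 2) * ((s + c2) ^+ 2 + x2 ^+ 2)) <
     (2 * (c1 + c2 - b) * s ^+ 2 +
      (c2 ^+ 2 + x2 ^+ 2 - (c1 ^+ 2 + x1 ^+ 2) - 2 * b * (c2 - c1)) * s -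
      b * (c1 ^+ 2 + x1 ^+ 2 + (c2 ^+ 2 + x2 ^+ 2))) * s ^+ 3) ->
  exists2 S : R, 0 < S & forall s, S < s -> Phi g1 x1 b s - Phi g2 x2 b (- s) < - (k / s ^+ 2).
Proof.
move=> [S0 hS]; pose S := `|S0| + `|c1| + `|c2| + 1.
have Sp : 0 < S by rewrite /S ltr_pwDr// !addr_ge0.
exists S => //.
(* H increases for large s by the hypothesis and tends to 0 at infinity, hence is negative. *)
pose H s := Phi g1 x1 b s - Phi g2 x2 b (- s) + k / s ^+ 2.
pose H' s := (s - b) / ((s - c1) ^+ 2 + x1 ^+ 2) + (- s - b) / ((- s - c2) ^+ 2 + x2 ^+ 2) * -1 * -1
  - 2 * k / s ^+ 3.
have big s : S < s -> [/\ S0 < s, 0 < s, c1 < s & - c2 < s].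
  move=> sS; have := ler_norm S0; have := ler_norm c1; have : - c2 <= `|c2| by rewrite -normrN ler_norm.
  have := normr_ge0 S0; have := normr_ge0 c1; have := normr_ge0 c2.
  by move: sS; rewrite /S => *; split; lra.
have dH s : S < s -> is_derive s 1 H (H' s) /\ 0 < H' s.
  move=> /big[sS s0 sc1 sc2].
  have n1 : c1 != s by rewrite lt_eqF.
  have n2 : c2 != - s by rewrite gt_eqF//; lra.
  have d1 := Phi_der g1 x1 b s n1.
  have dm : is_derive s 1 (fun s : R => - s) (-1 : R) by der.
  have d2 := isd_comp dm (Phi_der g2 x2 b (- s) n2).
  have sq0 : s ^+ 2 != 0 by rewrite expf_neq0// gt_eqF.
  have ds : is_derive s 1 (fun s : R => s ^+ 2) (2 * s) by der; ring.
  have d3 := isd_mul (isd_cst k s) (@isd_inv _ (fun s => s ^+ 2) s _ sq0 ds).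
  have d4 := isd_add (isd_add d1 (isd_opp d2)) d3.
  have A1 : 0 < (s - c1) ^+ 2 + x1 ^+ 2.
    by rewrite ltr_pwDl ?sqr_ge0// exprn_gt0// subr_gt0.
  have A2 : 0 < (s + c2) ^+ 2 + x2 ^+ 2.
    by rewrite ltr_pwDl ?sqr_ge0// exprn_gt0//; lra.
  have A2E : (- s - c2) ^+ 2 = (s + c2) ^+ 2 by ring.
  split.
    apply: (isd_eq d4); rewrite /H' -/c1 -/c2 !A2E; field.
    by rewrite (gt_eqF s0) (gt_eqF A1) (gt_eqF A2).
  have -> : H' s = ((2 * (c1 + c2 - b) * s ^+ 2 +
      (c2 ^+ 2 + x2 ^+ 2 - (c1 ^+ 2 + x1 ^+ 2) - 2 * b * (c2 - c1)) * s -
      b * (c1 ^+ 2 + x1 ^+ 2 + (c2 ^+ 2 + x2 ^+ 2))) * s ^+ 3 -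
     2 * k * (((s - c1) ^+ 2 + x1 ^+ 2) * ((s + c2) ^+ 2 + x2 ^+ 2))) /
     (((s - c1) ^+ 2 + x1 ^+ 2) * ((s + c2) ^+ 2 + x2 ^+ 2) * s ^+ 3).
    rewrite /H' A2E; field.
    by rewrite (gt_eqF s0) (gt_eqF A1) (gt_eqF A2).
  by rewrite divr_gt0 ?mulr_gt0 ?exprn_gt0// subr_gt0; exact: hS.
have incr s t : S < s -> s < t -> H s < H t.
  move=> sS st; apply: (isd_lt H' st) => r /andP[r1 r2].
    by apply: dH; lra.
  by apply: isd_cont (dH r _).1; lra.
move=> s sS; suff : H s < 0 by rewrite /H; lra.
(* The extra unit turns a weak inequality at s + 1 into the strict one at s. *)
have ss1 : s < s + 1 by lra.
apply: lt_le_trans (incr _ _ sS ss1) _.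
rewrite leNgt; apply/negP => Hp; have Hp2 : 0 < H (s + 1) / 2 by rewrite divr_gt0.
have [S1 S10 h1] := N_limit g1 x1 g2 x2 b _ Hp2.
have [q qE] : {q | q = `|k| / (H (s + 1) / 2)} by eexists.
(* At this time both terms of H are below half of H (s + 1), although H t should exceed it. *)
pose t := S1 + (s + 1) + q + 1.
have q0 : 0 <= q by rewrite qE divr_ge0// ltW.
have t1 : S1 < t by rewrite /t; lra.
have t2 : s + 1 < t by rewrite /t; lra.
have t3 : 1 <= t by rewrite /t; lra.
have : k / t ^+ 2 < H (s + 1) / 2.
  rewrite ltr_pdivrMr ?exprn_gt0//; last by lra.
  apply: (@le_lt_trans _ _ `|k|); first exact: ler_norm.
  apply: (@lt_le_trans _ _ (H (s + 1) / 2 * t)).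
    by rewrite mulrC -ltr_pdivrMr// -qE /t; lra.
  by rewrite ler_pM2l// expr2 ler_peMr//; lra.
have ss : S < s + 1 by lra.
have := incr _ _ ss t2; have := h1 t t1; have := ler_norm (Phi g1 x1 b t - Phi g2 x2 b (- t)).
have -> : H t = Phi g1 x1 b t - Phi g2 x2 b (- t) + k / t ^+ 2 by [].
by move: (H (s + 1)) (Phi g1 x1 b t - Phi g2 x2 b (- t)) (k / t ^+ 2) => u v w; lra.
Qed.

Lemma quartic_pos (a4 a3 a2 a1 a0 : R) : 0 < a4 ->
  exists S, forall s, S < s -> 0 < a4 * s ^+ 4 + a3 * s ^+ 3 + a2 * s ^+ 2 + a1 * s + a0.
Proof.
move=> a40; pose M := `|a3| + `|a2| + `|a1| + `|a0|.
exists (M / a4 + 1) => s sS.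
have M0 : 0 <= M / a4 by apply: divr_ge0; [rewrite /M !addr_ge0|exact: ltW].
have s1 : 1 < s by lra.
have aM : M < a4 * s by rewrite mulrC -ltr_pdivrMr//; lra.
have s30 : 0 < s ^+ 3 by rewrite exprn_gt0//; lra.
have absN (a : R) : - `|a| <= a by rewrite lerNl -normrN ler_norm.
have n3 : - `|a3| * s ^+ 3 <= a3 * s ^+ 3.
  by apply: ler_wpM2r; [exact: ltW|exact: absN].
have n2 : - `|a2| * s ^+ 3 <= a2 * s ^+ 2.
  apply: (@le_trans _ _ (- `|a2| * s ^+ 2)).
    by rewrite !mulNr lerN2 ler_wpM2l// ler_eXn2l//.
  by apply: ler_wpM2r; [apply: exprn_ge0; lra|exact: absN].
have n1 : - `|a1| * s ^+ 3 <= a1 * s.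
  apply: (@le_trans _ _ (- `|a1| * s)).
    by rewrite !mulNr lerN2 ler_wpM2l// -{1}(expr1 s) ler_eXn2l.
  by apply: ler_wpM2r; [lra|exact: absN].
have n0 : - `|a0| * s ^+ 3 <= a0.
  apply: (@le_trans _ _ (- `|a0|)).
    by rewrite mulNr lerN2 ler_peMr// exprn_ege1// ltW.
  by rewrite lerNl -normrN ler_norm.
have : 0 < (a4 * s - M) * s ^+ 3 by rewrite mulr_gt0// subr_gt0.
have -> : a4 * s ^+ 4 = a4 * s * s ^+ 3 by ring.
rewrite /M; lra.
Qed.

Lemma quadratic_pos (a2 a1 a0 : R) : 0 < a2 ->
  exists S, forall s, S < s -> 0 < a2 * s ^+ 2 + a1 * s + a0.
Proof.
move=> /(quartic_pos _ a1 a0 0 0)[S hS]; exists (Num.max S 0) => s.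
rewrite gt_max => /andP[/hS h s0].
have s20 : 0 < s ^+ 2 by rewrite exprn_gt0.
rewrite -(pmulr_lgt0 _ s20); move: h; congr (0 < _); ring.
Qed.

End PhiTheory.

(** * Criteria for an expanding return map *)

Section Expanding.
Context {R : realType}.
Implicit Types (g x b : R).

(* The first half-turn goes from (0, - eta) to (0, zeta); the second one, seen after the rotation
   p |-> - p, goes from (0, - zeta) to (0, eta'). *)
Definition expanding g1 x1 g2 x2 b : Prop := exists S, forall eta zeta eta' : R,
  S < eta -> S < zeta -> S < eta' ->
  Phi g1 x1 b zeta - Phi g1 x1 b (- eta) = g1 * pi ->
  Phi g2 x2 b eta' - Phi g2 x2 b (- zeta) = g2 * pi -> eta < eta'.

(** Substituting the two half-turn relations, the inequality says that [Phi] of the second focus is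
    larger at eta' than at eta, and this function increases far out. *)
Lemma expanding_criterion g1 x1 g2 x2 b :
  (exists S, forall eta zeta : R, S < eta -> S < zeta ->
    Phi g1 x1 b zeta - Phi g1 x1 b (- eta) = g1 * pi ->
    (Phi g1 x1 b zeta - Phi g2 x2 b (- zeta)) + (Phi g2 x2 b eta - Phi g1 x1 b (- eta)) <
      (g1 + g2) * pi) ->
  expanding g1 x1 g2 x2 b.
Proof.
move=> [S hS]; pose c := b + g2 * x2.
exists (Num.max S (Num.max b c)) => eta zeta eta'.
rewrite !gt_max => /and3P[e1 e2 e3] /and3P[z1 _ _] /and3P[f1 f2 f3] r1 r2.
have h := hS _ _ e1 z1 r1.
rewrite ltNge; apply/negP => le.
have : Phi g2 x2 b eta' <= Phi g2 x2 b eta.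
  move: le; rewrite le_eqVlt => /predU1P[->//|lt].
  have dP s : eta' <= s -> is_derive s 1 (Phi g2 x2 b) ((s - b) / ((s - c) ^+ 2 + x2 ^+ 2)).
    by move=> hs; apply: Phi_der; rewrite lt_eqF// (lt_le_trans f3).
  apply: ltW; apply: (isd_lt (fun s => (s - b) / ((s - c) ^+ 2 + x2 ^+ 2)) lt) => s /andP[s1 s2].
    split; first by apply: dP; exact: ltW.
    rewrite divr_gt0//; first by rewrite subr_gt0 (lt_trans f2).
    by rewrite ltr_pwDl ?sqr_ge0// exprn_gt0// subr_gt0 (lt_trans f3).
  exact: isd_cont (dP _ s1).
by move: h r1 r2; lra.
Qed.

Lemma expanding_sum g1 x1 g2 x2 b : 0 < g1 + g2 -> expanding g1 x1 g2 x2 b.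
Proof.
move=> s0; have e0 : 0 < (g1 + g2) * pi / 2 by rewrite divr_gt0// mulr_gt0// pi_gt0.
have [S1 _ h1] := N_limit g1 x1 g2 x2 b _ e0; have [S2 _ h2] := N_limit g2 x2 g1 x1 b _ e0.
apply: expanding_criterion; exists (Num.max S1 S2) => eta zeta.
rewrite !gt_max => /andP[_ e2] /andP[z1 _] _.
have := h1 _ z1; have := h2 _ e2.
have := ler_norm (Phi g1 x1 b zeta - Phi g2 x2 b (- zeta)).
have := ler_norm (Phi g2 x2 b eta - Phi g1 x1 b (- eta)); lra.
Qed.

(* The coefficients of the numerator of the derivative of s |-> Phi g1 x1 b s - Phi g2 x2 b (- s). *)
Definition drift2 g1 x1 g2 x2 b : R := 2 * ((b + g1 * x1) + (b + g2 * x2) - b).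
Definition drift1 g1 x1 g2 x2 b : R :=
  ((b + g2 * x2) ^+ 2 + x2 ^+ 2) - ((b + g1 * x1) ^+ 2 + x1 ^+ 2) -
  2 * b * ((b + g2 * x2) - (b + g1 * x1)).
Definition drift0 g1 x1 g2 x2 b : R :=
  - b * (((b + g1 * x1) ^+ 2 + x1 ^+ 2) + ((b + g2 * x2) ^+ 2 + x2 ^+ 2)).

(** The second bracket in [expanding_criterion] is the first with the foci exchanged. So the outer
    coefficients reinforce each other, and the middle one works against itself. *)
Lemma drift_swap g1 x1 g2 x2 b : [/\ drift2 g2 x2 g1 x1 b = drift2 g1 x1 g2 x2 b,
  drift1 g2 x2 g1 x1 b = - drift1 g1 x1 g2 x2 b & drift0 g2 x2 g1 x1 b = drift0 g1 x1 g2 x2 b].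
Proof. by rewrite /drift2 /drift1 /drift0; split; ring. Qed.

Lemma N_neg2 g1 x1 g2 x2 b : 0 < drift2 g1 x1 g2 x2 b ->
  exists2 S : R, 0 < S & forall s, S < s -> Phi g1 x1 b s - Phi g2 x2 b (- s) < 0.
Proof.
move=> p2; have [S S0 h] : exists2 S : R, 0 < S & forall s, S < s -> Phi g1 x1 b s - Phi g2 x2 b (- s) < - (0 / s ^+ 2).
  apply: N_compare.
  have [S hS] := quadratic_pos _ (drift1 g1 x1 g2 x2 b) (drift0 g1 x1 g2 x2 b) p2.
  exists (Num.max S 0) => s; rewrite gt_max => /andP[/hS h s0]; rewrite mulr0 mul0r.
  rewrite mulr_gt0 ?exprn_gt0//; move: h; rewrite /drift2 /drift1 /drift0.
  by rewrite mulNr.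
by exists S => // s /h; rewrite mul0r oppr0.
Qed.

Lemma N_neg0 g1 x1 g2 x2 b : drift2 g1 x1 g2 x2 b = 0 -> drift1 g1 x1 g2 x2 b = 0 ->
  0 < drift0 g1 x1 g2 x2 b ->
  exists2 S : R, 0 < S & forall s, S < s -> Phi g1 x1 b s - Phi g2 x2 b (- s) < 0.
Proof.
move=> p2 p1 p0; have [S S0 h] : exists2 S : R, 0 < S & forall s, S < s -> Phi g1 x1 b s - Phi g2 x2 b (- s) < - (0 / s ^+ 2).
  apply: N_compare; exists 0 => s s0; rewrite mulr0 mul0r mulr_gt0 ?exprn_gt0//.
  move: p2 p1 p0; rewrite /drift2 /drift1 /drift0 => -> ->.
  by rewrite !mul0r !add0r mulNr.
by exists S => // s /h; rewrite mul0r oppr0.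
Qed.

(** The difference behaves like - drift1 / (2 s^2). The gap drift1 - 2 k becomes the leading
    coefficient of a quartic and absorbs all lower terms. *)
Lemma N_neg1 g1 x1 g2 x2 b (k : R) : drift2 g1 x1 g2 x2 b = 0 -> 2 * k < drift1 g1 x1 g2 x2 b ->
  exists2 S : R, 0 < S & forall s, S < s -> Phi g1 x1 b s - Phi g2 x2 b (- s) < - (k / s ^+ 2).
Proof.
move=> p2 p1; apply: N_compare.
pose c1 := b + g1 * x1; pose c2 := b + g2 * x2.
pose q1 := c1 ^+ 2 + x1 ^+ 2; pose q2 := c2 ^+ 2 + x2 ^+ 2.
have p10 : 0 < drift1 g1 x1 g2 x2 b - 2 * k by rewrite subr_gt0.
have [S hS] := quartic_pos _ (drift0 g1 x1 g2 x2 b - 2 * k * (2 * c2 - 2 * c1))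
  (- (2 * k) * (q2 + q1 - 4 * c1 * c2)) (- (2 * k) * (2 * c2 * q1 - 2 * c1 * q2))
  (- (2 * k) * (q1 * q2)) p10.
exists S => s /hS h; rewrite -subr_gt0; move: h; congr (0 < _).
move: p2; rewrite /drift2 /drift1 /drift0 -/c1 -/c2 /q1 /q2 => ->; ring.
Qed.

Lemma expanding_drift2 g1 x1 b x2 : 0 < drift2 g1 x1 (- g1) x2 b -> expanding g1 x1 (- g1) x2 b.
Proof.
move=> p2; have [S1 _ h1] := N_neg2 _ _ _ _ _ p2.
have [|S2 _ h2] := N_neg2 (- g1) x2 g1 x1 b; first by have [-> _ _] := drift_swap g1 x1 (- g1) x2 b.
apply: expanding_criterion; exists (Num.max S1 S2) => eta zeta.
rewrite !gt_max => /andP[_ e2] /andP[z1 _] _; rewrite subrr mul0r.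
by have := h1 _ z1; have := h2 _ e2; lra.
Qed.

Lemma expanding_drift0 g1 x1 b x2 : drift2 g1 x1 (- g1) x2 b = 0 -> drift1 g1 x1 (- g1) x2 b = 0 ->
  0 < drift0 g1 x1 (- g1) x2 b -> expanding g1 x1 (- g1) x2 b.
Proof.
move=> p2 p1 p0; have [S1 _ h1] := N_neg0 _ _ _ _ _ p2 p1 p0.
have [w2 w1 w0] := drift_swap g1 x1 (- g1) x2 b.
have [|||S2 _ h2] := N_neg0 (- g1) x2 g1 x1 b; rewrite ?w2 ?w1 ?w0 ?p1 ?oppr0//.
apply: expanding_criterion; exists (Num.max S1 S2) => eta zeta.
rewrite !gt_max => /andP[_ e2] /andP[z1 _] _; rewrite subrr mul0r.
by have := h1 _ z1; have := h2 _ e2; lra.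
Qed.

Lemma expanding_drift1 g1 x1 b x2 : drift2 g1 x1 (- g1) x2 b = 0 ->
  drift1 g1 x1 (- g1) x2 b * g1 < 0 -> expanding g1 x1 (- g1) x2 b.
Proof.
move=> p2 pg; set P := drift1 g1 x1 (- g1) x2 b in pg *.
have pi0 := pi_gt0 R.
have g10 : g1 != 0 by apply: contraTneq pg => ->; rewrite mulr0 ltxx.
(* zeta / eta tends to rho ^+ 2, so that 1 / zeta ^+ 2 and 1 / eta ^+ 2, which occur with
   opposite signs, do not compensate each other; rho is half-way. *)
pose rho := expR (g1 * pi / 2).
have rho0 : 0 < rho by exact: expR_gt0.
have sgn : (0 < P /\ g1 < 0) \/ (P < 0 /\ 0 < g1).
  have [gn|gp|ge] := ltgtP g1 0; last by move: g10; rewrite ge eqxx.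
    by left; split=> //; rewrite -(nmulr_llt0 _ gn).
  by right; split=> //; rewrite -(pmulr_llt0 _ gp).
have rhoE : (g1 < 0 -> rho < 1) /\ (0 < g1 -> 1 < rho).
  split=> h; rewrite -expR0 ltr_expR.
    by rewrite pmulr_llt0// pmulr_llt0.
  by rewrite divr_gt0// mulr_gt0.
(* As P and g1 have opposite signs, multiplying P / 2 by rho and dividing - P / 2 by rho both
   decrease, so both are admissible constants for [N_neg1]. *)
have k1 : 2 * (P / 2 * rho) < P.
  have -> : 2 * (P / 2 * rho) = P * rho by field.
  case: sgn => -[hP hg].
    by rewrite gtr_pMr//; exact: rhoE.1.
  by rewrite gtr_nMr//; exact: rhoE.2.
have k2 : 2 * (- (P / 2) / rho) < - P.
  have -> : 2 * (- (P / 2) / rho) = - (P / rho) by field; rewrite gt_eqF.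
  rewrite ltrN2; case: sgn => -[hP hg].
    by rewrite ltr_pdivlMr// gtr_pMr//; exact: rhoE.1.
  by rewrite ltr_pdivlMr// gtr_nMr//; exact: rhoE.2.
have [S1 S10 h1] := N_neg1 _ _ _ _ _ _ p2 k1.
have [w2 w1 w0] := drift_swap g1 x1 (- g1) x2 b.
have [||S2 S20 h2] := N_neg1 (- g1) x2 g1 x1 b (- (P / 2) / rho); rewrite ?w2 ?w1//.
(* With this precision at both ends, ln (zeta / eta) is within |g1| pi / 2 of g1 pi, which places
   zeta / eta beyond rho. *)
have e0 : 0 < `|g1| * pi / 4 by rewrite divr_gt0// mulr_gt0// normr_gt0.
have [S3 S30 h3] := Phi_ln g1 x1 b _ e0.
apply: expanding_criterion; exists (Num.max (Num.max S1 S2) S3) => eta zeta.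
rewrite !gt_max => /andP[/andP[e1 e2] e3] /andP[/andP[z1 z2] z3] rel; rewrite subrr mul0r.
have z0 : 0 < zeta by lra.
have et0 : 0 < eta by lra.
have l1 := h3 zeta; have l2 := h3 (- eta).
rewrite normrN (gtr0_norm z0) (gtr0_norm et0) in l1 l2.
have {}l1 := l1 z3; have {}l2 := l2 e3.
have hz : 0 <= P * ((rho * eta) ^+ 2 - zeta ^+ 2).
  move: l1 l2; rewrite !ltr_norml => /andP[l1 l1'] /andP[l2 l2'].
  have lr : ln (rho * eta) = g1 * pi / 2 + ln eta by rewrite lnM ?posrE// expRK.
  have re0 : 0 < rho * eta by rewrite mulr_gt0.
  case: sgn => -[hP hg].
    rewrite pmulr_rge0// subr_ge0 ler_pXn2r ?nnegrE ?ltW// -ltr_ln ?posrE// lr.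
    by move: l1 l1' l2 l2' rel; rewrite (ltr0_norm hg); lra.
  rewrite nmulr_rge0// subr_le0 ler_pXn2r ?nnegrE ?ltW// -ltr_ln ?posrE// lr.
  by move: l1 l1' l2 l2' rel; rewrite (gtr0_norm hg); lra.
have key : 0 <= P / 2 * rho / zeta ^+ 2 + (- (P / 2) / rho) / eta ^+ 2.
  have -> : P / 2 * rho / zeta ^+ 2 + (- (P / 2) / rho) / eta ^+ 2 =
    P * ((rho * eta) ^+ 2 - zeta ^+ 2) / (2 * rho * zeta ^+ 2 * eta ^+ 2).
    by field; rewrite (gt_eqF z0) (gt_eqF et0) (gt_eqF rho0).
  by apply: divr_ge0 => //; rewrite ltW// !mulr_gt0// exprn_gt0.
by have := h1 _ z1; have := h2 _ e2; lra.
Qed.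

End Expanding.

(** * From expansion to the absence of an annulus *)

Section Return.
Context {R : realType}.
Implicit Types (X : R -> R * R).

Lemma period_reduction X (T : R) : 0 < T -> (forall t, X (t + T) = X t) ->
  forall t, exists2 s, 0 <= s <= T & X s = X t.
Proof.
move=> T0 hT.
have hn (n : nat) t : X (t + T * n%:R) = X t.
  elim: n => [|n IH]; first by rewrite mulr0 addr0.
  by rewrite -natr1 mulrDr mulr1 addrA hT.
move=> t; pose k := Num.floor (t / T).
have /andP[h1 h2] := Num.Theory.real_floor_itv (num_real (t / T)).
exists (t - T * k%:~R).
  move: h1 h2; rewrite -/k intrD ler_pdivlMr// ltr_pdivrMr// => h1 h2.
  by bounds.
case: k => n; first by rewrite -[in RHS](subrK (T * n%:R) t) hn.
by rewrite NegzE mulrNz mulrN opprK hn.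
Qed.

Lemma periodic_no_escape X (T S : R) : continuous X -> 0 < T -> (forall t, X (t + T) = X t) ->
  (forall t eta, X t = (0, - eta) -> S < eta -> exists t' eta', X t' = (0, - eta') /\ eta < eta') ->
  forall t eta, X t = (0, - eta) -> eta <= S.
Proof.
move=> cX T0 hT esc t eta Xt; rewrite leNgt; apply/negP => Se.
have c1 : continuous (fun s => (X s).1) by move=> s; have /cont_pair[] := cX s.
have c2 : continuous (fun s => (X s).2) by move=> s; have /cont_pair[] := cX s.
pose A := `[0, T]%classic `&` ((fun s => (X s).1) @^-1` [set 0]).
have reduce s y : X s = (0, y) -> exists2 r, A r & (X r).2 = y.
  move=> e; have [r r0T er] := period_reduction _ _ T0 hT s; exists r; last by rewrite er e.
  by split; rewrite /= ?in_itv//= er e.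
have [r Ar er] := reduce _ _ Xt.
have cA : compact A.
  apply: compact_closedI; first exact: segment_compact.
  apply: preimage_closed; first by move=> s _; exact: c1.
  exact: closed_eq.
have [|c /set_mem[_ cx] hc] := compact_EVT_min _ cA (continuous_subspaceT c2); first by exists r.
have ce : (X c).2 <= - eta by rewrite -er; apply: hc; rewrite inE.
have [||t' [eta' [e' lt']]] := esc c (- (X c).2).
- by have : (X c).1 = 0 := cx; rewrite opprK; case: (X c) => ? ? /= ->.
- by rewrite ltrNr (le_lt_trans ce)// ltrN2.
have [r' Ar' er'] := reduce _ _ e'.
have := hc r'; rewrite inE er' => /(_ Ar'); lra.
Qed.

(** The rotation turns a left half-turn into a right one with the same b, so [half_map] serves for
    both. *)
Lemma solves_at_opp_affine gamma alpha beta X t :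
  solves_at (affine_field gamma alpha (- beta)) X t ->
  solves_at (affine_field gamma (- alpha) beta) (fun s => - X s) t.
Proof.
move=> [d1 d2]; split; [apply: (isd_eq (isd_opp d1))|apply: (isd_eq (isd_opp d2))].
  by rewrite /affine_field /=; ring.
by rewrite /affine_field /=; ring.
Qed.

Lemma expanding_tame_escape (gL gR aL aR b : R)
    (xL := aL / (1 + gL ^+ 2)) (xR := aR / (1 + gR ^+ 2)) :
  expanding gR xR gL (- xL) b ->
  exists S, forall X, tame (affine_field gL aL (- b)) (affine_field gR aR b) `|b| X ->
    forall t eta, X t = (0, - eta) -> S < eta ->
    exists t' eta', X t' = (0, - eta') /\ eta < eta'.
Proof.
move=> [S0 hS]; have [SL hL] := half_map gL (- aL) b S0.
(* The right half-turn must end high enough to be a crossing point (|b|), to start the left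
   half-turn (SL) and to enter the expansion (S0). *)
have [SR hR] := half_map gR aR b (Num.max S0 (Num.max `|b| SL)).
exists (Num.max SR (Num.max S0 `|b|)) => X [cX XR XL Xr Xl] t eta Xt.
rewrite !gt_max => /and3P[eR e0 eb].
have [|t1 [zeta [tt1 Xt1]]] := hR X t eta cX XR Xt _ eR.
  have [||e e_gt0 he] := Xr t; rewrite ?Xt//= ?ltrN2//.
  by exists e => // s /(he s).1.
rewrite !gt_max => /and3P[z0 zb zL] rel1.
have cY : continuous (fun s => - X s) by move=> s; apply: cvgN; exact: cX.
have YR s : 0 < (- X s).1 -> solves_at (affine_field gL (- aL) b) (fun s => - X s) s.
  by move=> /= h; apply: solves_at_opp_affine; apply: XL; rewrite -oppr_gt0.
have Yt1 : - X t1 = (0, - zeta) by rewrite Xt1 pair_oppE oppr0.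
have [|t2 [eta' [tt2 Yt2 e0' rel2]]] := hL _ t1 zeta cY YR Yt1 _ zL.
  have [||e e_gt0 he] := Xl t1; rewrite ?Xt1//=.
  by exists e => // s /(he s).1 /=; rewrite oppr_gt0.
exists t2, eta'; split; first by rewrite -[X t2]opprK Yt2 pair_oppE oppr0.
by apply: (hS eta zeta eta') => //; move: rel2; rewrite mulNr -/xL.
Qed.

Lemma expanding_no_annulus (gL gR aL aR b : R) (fL := affine_field gL aL (- b))
    (fR := affine_field gR aR b) :
  expanding gR (aR / (1 + gR ^+ 2)) gL (- (aL / (1 + gL ^+ 2))) b ->
  ~ has_period_annulus_at_infinity fL fR.
Proof.
move=> /expanding_tame_escape[S hS] [r hr].
pose eta := `|r| + `|S| + 1; pose p : R * R := (0, - eta).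
have eta0 : 0 < eta by rewrite ltr_pwDr// addr_ge0.
have [|[X sX X0] /(_ X sX X0)[[[T T0 hT] _] _ _]] := hr p.
  rewrite prod_normE lt_max /= normrN (gtr0_norm eta0); apply/orP; right.
  by have := ler_norm r; have := normr_ge0 S; rewrite /eta; lra.
have tX := filippov_tame _ _ _ _ _ _ sX.
have cX : continuous X by case: tX.
have := periodic_no_escape _ _ S cX T0 hT (hS X tX) _ _ X0.
by have := ler_norm S; have := normr_ge0 r; rewrite /eta; lra.
Qed.

(** Time reversal combined with y |-> - y preserves each half-plane and the family of systems,
    changing the signs of gamma and b; a contracting return becomes an expanding one. *)
Lemma solves_at_reverse gamma alpha beta X t :
  solves_at (affine_field gamma alpha beta) X (- t) ->
  solves_at (affine_field (- gamma) alpha (- beta)) (fun s => flip_y (X (- s))) t.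
Proof.
have d : is_derive t 1 (fun s : R => - s) (-1 : R) by der.
move=> [d1 d2]; split.
  by apply: (isd_eq (isd_comp d d1)); rewrite /affine_field /=; ring.
by apply: (isd_eq (isd_opp (isd_comp d d2))); rewrite /affine_field /=; ring.
Qed.

Lemma tame_reverse (gL gR aL aR bL bR B : R) X :
  tame (affine_field gL aL bL) (affine_field gR aR bR) B X ->
  tame (affine_field (- gL) aL (- bL)) (affine_field (- gR) aR (- bR)) B
    (fun t => flip_y (X (- t))).
Proof.
move=> [cX XR XL Xr Xl]; split.
- move=> t; have c : {for t, continuous (fun s => X (- s))}.
    by apply: (@continuous_comp _ _ _ (fun t : R => - t) X); [apply: cvgN; exact: cvg_id|exact: cX].
  have /cont_pair[c1 c2] := c; apply/cont_pair; split; [exact: c1|apply: cvgN; exact: c2].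
- by move=> t /XR; exact: solves_at_reverse.
- by move=> t /XL; exact: solves_at_reverse.
- move=> t /= x0 y0; rewrite ltrN2 in y0; have [//|//|e e0 he] := Xl (- t).
  exists e => // s /=; have [h1 h2] := he (- s); split=> /andP[s1 s2].
    by apply: h2; bounds.
  by apply: h1; bounds.
- move=> t /= x0 y0; rewrite ltrNr in y0; have [//|//|e e0 he] := Xr (- t).
  exists e => // s /=; have [h1 h2] := he (- s); split=> /andP[s1 s2].
    by apply: h2; bounds.
  by apply: h1; bounds.
Qed.

Lemma contracting_no_annulus (gL gR aL aR b : R) (fL := affine_field gL aL (- b))
    (fR := affine_field gR aR b) :
  expanding (- gR) (aR / (1 + gR ^+ 2)) (- gL) (- (aL / (1 + gL ^+ 2))) (- b) ->
  ~ has_period_annulus_at_infinity fL fR.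
Proof.
move=> ex; have [|S hS] := @expanding_tame_escape (- gL) (- gR) aL aR (- b).
  by rewrite !sqrrN.
move=> [r hr]; pose eta := `|r| + `|S| + 1; pose p : R * R := (0, eta).
have eta0 : 0 < eta by rewrite ltr_pwDr// addr_ge0.
have [|[X sX X0] /(_ X sX X0)[[[T T0 hT] _] _ _]] := hr p.
  rewrite prod_normE lt_max /= (gtr0_norm eta0); apply/orP; right.
  by have := ler_norm r; have := normr_ge0 S; rewrite /eta; lra.
have := tame_reverse _ _ _ _ _ _ _ _ (filippov_tame _ _ _ _ _ _ sX).
set Y := (fun t => _) => tY; rewrite -normrN in tY.
have cY : continuous Y by case: tY.
have hY t : Y (t + T) = Y t.
  by rewrite /Y -(hT (- (t + T))); congr (flip_y (X _)); ring.
have Y0 : Y 0 = (0, - eta) by rewrite /Y oppr0 X0.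
have := periodic_no_escape _ _ S cY T0 hY (hS _ tY) _ _ Y0.
by have := ler_norm S; have := normr_ge0 r; rewrite /eta; lra.
Qed.

Lemma annulus_necessary (gL gR aL aR b : R)
    (xL := aL / (1 + gL ^+ 2)) (xR := aR / (1 + gR ^+ 2)) :
  has_period_annulus_at_infinity (affine_field gL aL (- b)) (affine_field gR aR b) ->
  [\/ [/\ gL = 0, gR = 0 & b = 0],
      [/\ gL = - gR, gR <> 0, xL = 0, xR = 0 & b = 0] |
      [/\ gL = - gR, gR <> 0, xL = - xR, xR <> 0 & b = 0]].
Proof.
move=> ann.
have nE : ~ expanding gR xR gL (- xL) b by move=> /expanding_no_annulus.
have nC : ~ expanding (- gR) xR (- gL) (- xL) (- b) by move=> /contracting_no_annulus.
have gLE : gL = - gR.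
  have [lt|lt|e] := ltgtP (gR + gL) 0; last by lra.
    by exfalso; apply: nC; apply: expanding_sum; lra.
  by exfalso; apply: nE; exact: expanding_sum.
rewrite gLE opprK in nC; rewrite gLE in nE; rewrite -[X in expanding _ _ X _ _]opprK in nC.
have p2 : drift2 gR xR (- gR) (- xL) b = 0.
  have [lt|lt|//] := ltgtP (drift2 gR xR (- gR) (- xL) b) 0.
    exfalso; apply: nC; apply: expanding_drift2; move: lt; rewrite /drift2; lra.
  by exfalso; apply: nE; exact: expanding_drift2.
have p2' : drift2 (- gR) xR (- - gR) (- xL) (- b) = 0 by move: p2; rewrite /drift2; lra.
(* Under reversal the outer coefficients change sign and the middle one does not, but its product
   with gR does: either sign is thus excluded by one of [nE] and [nC]. *)
have p1E : drift1 (- gR) xR (- - gR) (- xL) (- b) = drift1 gR xR (- gR) (- xL) b.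
  by rewrite /drift1; ring.
have p0E : drift0 (- gR) xR (- - gR) (- xL) (- b) = - drift0 gR xR (- gR) (- xL) b.
  by rewrite /drift0; ring.
have p1 : drift1 gR xR (- gR) (- xL) b * gR = 0.
  have [lt|lt|//] := ltgtP (drift1 gR xR (- gR) (- xL) b * gR) 0.
    by exfalso; apply: nE; exact: expanding_drift1.
  by exfalso; apply: nC; apply: expanding_drift1 => //; rewrite p1E mulrN oppr_lt0.
have bE : b = - gR * (xR + xL) by move: p2; rewrite /drift2; lra.
have [g0|g0] := eqVneq gR 0.
  by apply: Or31; split; rewrite ?gLE ?bE ?g0 ?oppr0 ?mul0r.
move/eqP: p1; rewrite mulf_eq0 (negbTE g0) orbF => /eqP p1.
have p0 : drift0 gR xR (- gR) (- xL) b = 0.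
  have [lt|lt|//] := ltgtP (drift0 gR xR (- gR) (- xL) b) 0.
    by exfalso; apply: nC; apply: expanding_drift0; rewrite ?p1E ?p0E ?oppr_gt0.
  by exfalso; apply: nE; exact: expanding_drift0.
have q1 : (1 + gR ^+ 2) * (xL - xR) * (xL + xR) = 0.
  by rewrite -p1 bE /drift1; ring.
have q0 : gR * (1 + gR ^+ 2) * (xL + xR) * (xL ^+ 2 + xR ^+ 2) = 0.
  by rewrite -p0 bE /drift0; ring.
have D0 : 1 + gR ^+ 2 != 0 by rewrite gt_eqF// D_gt0.
have s0 : xL + xR = 0.
  (* In the alternative xL = xR, the last coefficient forces both abscissas to vanish, and the sum
     is 0 again. *)
  move/eqP: q1; rewrite !mulf_eq0 (negbTE D0) /= => /orP[|/eqP//].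
  rewrite subr_eq0 => /eqP xE; move/eqP: q0.
  rewrite xE !mulf_eq0 (negbTE g0) (negbTE D0) /= => /orP[/eqP//|].
  by rewrite paddr_eq0 ?sqr_ge0// sqrf_eq0 => /andP[/eqP -> _]; rewrite addr0.
have b0 : b = 0 by rewrite bE addrC s0 mulr0.
have xLE : xL = - xR by lra.
have [x0|x0] := eqVneq xR 0.
  by apply: Or32; split=> //; [exact/eqP|rewrite xLE x0 oppr0].
by apply: Or33; split=> //; exact/eqP.
Qed.

End Return.

(** * Assembly of the three cases *)

Lemma opposite_parameters {R : realType} (gamma a a' : R) :
  a / (1 + (- gamma) ^+ 2) = - (a' / (1 + gamma ^+ 2)) -> a = - a'.
Proof.
rewrite sqrrN -mulNr; apply: mulIf.
by rewrite invr_neq0// gt_eqF// D_gt0.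
Qed.

Theorem theorem5 (R : realType) (gammaL gammaR alphaL alphaR b : R) :
  let fL := affine_field gammaL alphaL (- b) in
  let fR := affine_field gammaR alphaR b in
  let F := filippov fL fR in
  let xL := alphaL / (1 + gammaL ^+ 2) in
  let xR := alphaR / (1 + gammaR ^+ 2) in
  let yL := 2 * gammaL * xL - b in
  let yR := 2 * gammaR * xR + b in
  let case_a := [/\ gammaL = 0, gammaR = 0 & b = 0] in
  let case_b :=
    [/\ gammaL = - gammaR, gammaR <> 0, xL = 0, xR = 0 & b = 0] in
  let case_c :=
    [/\ gammaL = - gammaR, gammaR <> 0, xL = - xR, xR <> 0 & b = 0] in
  [/\ has_period_annulus_at_infinity fL fR <-> [\/ case_a, case_b | case_c],
      case_a ->
        [/\ yL = 0 /\ yR = 0,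
            linear_center_at fL (xL, 0) /\ linear_center_at fR (xR, 0),
            symmetric_wrt_x_axis fL /\ symmetric_wrt_x_axis fR,
            reversible F flip_y &
            virtual_left fL (xL, yL) \/ virtual_right fR (xR, yR) ->
              global_center F],
      case_b ->
        [/\ yL = 0 /\ yR = 0,
            focus_at fL (0, 0) /\ focus_at fR (0, 0),
            reversible F flip_x,
            global_center_at F (0, 0) &
            nonlinear F] &
      case_c ->
        [/\ yL = yR /\ yR <> 0,
            (xL < 0 < xR ->
               real_left fL (xL, yL) /\ real_right fR (xR, yR)) /\
            (xR < 0 < xL ->
               virtual_left fL (xL, yL) /\ virtual_right fR (xR, yR)),
            [/\ reversible F flip_x, nonlinear F &
                has_period_annulus_at_infinity fL fR],
            real_left fL (xL, yL) /\ real_right fR (xR, yR) ->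
              ~ global_center F /\
              exists G : set (R * R),
                [/\ pseudo_saddle fL fR (0, 0) /\ homoclinic_orbit F (0, 0) G,
                    heart_shaped G,
                    [/\ focus_at fL (xL, yL), focus_at fR (xR, yR),
                        inside G (xL, yL) & inside G (xR, yR)],
                    period_annulus_at_infinity fL fR = outside G &
                    closure (period_annulus_at_infinity fL fR) `\`
                      period_annulus_at_infinity fL fR = G] &
            virtual_left fL (xL, yL) /\ virtual_right fR (xR, yR) ->
              global_center_at F (0, 0)]].
Proof.
move=> fL fR F xL xR yL yR case_a case_b case_c.
(* The last two cases are the same reversible system with alphaL = - alphaR, and differ only in the
   sign or vanishing of xR. *)
have bcE : case_b \/ case_c ->
    [/\ gammaL = - gammaR, gammaR <> 0, alphaL = - alphaR, xL = - xR & b = 0].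
  move=> h; have [e1 e2 e3 e4] : [/\ gammaL = - gammaR, gammaR <> 0, xL = - xR & b = 0].
    by case: h => -[] // e1 e2 e3 e4 e5; split=> //; rewrite e3 e4 oppr0.
  by split=> //; apply: (@opposite_parameters _ gammaR); rewrite -e1.
have annulus_bc : case_b \/ case_c -> has_period_annulus_at_infinity fL fR.
  move=> /bcE[e1 _ e3 _ e5]; rewrite /fL /fR e1 e3 e5 oppr0; exact: reversible_annulus.
have reversible_bc : case_b \/ case_c -> reversible F flip_x /\ nonlinear F.
  move=> /bcE[e1 e2 e3 _ e5]; rewrite /F /fL /fR e1 e3 e5 oppr0.
  by split; [exact: reversible_system|exact: reversible_nonlinear].
have global_bc : case_b \/ case_c -> xR <= 0 -> global_center_at F (0, 0).
  move=> /bcE[e1 e2 e3 _ e5] xR0; rewrite /F /fL /fR e1 e3 e5 oppr0.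
  exact: reversible_global_center.
have foci_bc : case_b \/ case_c -> focus_at fL (xL, yL) /\ focus_at fR (xR, yR).
  move=> /bcE[e1 e2 _ _ _]; split; last exact: affine_focus_at.
  by apply: affine_focus_at; rewrite e1 => /eqP; rewrite oppr_eq0 => /eqP.
split.
- split=> [|[a|a|a]]; first exact: annulus_necessary.
  + case: a => e1 e2 e3; rewrite /fL /fR e1 e2 e3 oppr0; exact: center_annulus.
  + by apply: annulus_bc; left.
  + by apply: annulus_bc; right.
- move=> [e1 e2 e3]; have yL0 : yL = 0 by rewrite /yL e1 e3 mulr0 mul0r subr0.
  have yR0 : yR = 0 by rewrite /yR e2 e3 mulr0 mul0r addr0.
  rewrite yL0 yR0 /F /fL /fR /xL /xR e1 e2 e3 oppr0; split=> //.
  + by split; exact: linear_center.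
  + by split; exact: center_symmetric.
  + by apply: reversible_flip_y => -[x y]; rewrite /affine_field /flip_y pair_oppE /=; congr pair; ring.
  + by move=> [[_ h]|[_ h]]; apply: center_global; [left|right].
- move=> B; have bc : case_b \/ case_c by left.
  have [rev non] := reversible_bc bc; have [fo1 fo2] := foci_bc bc.
  have gl : global_center_at F (0, 0) by apply: global_bc => //; case: B => _ _ _ -> _.
  case: B => e1 e2 e3 e4 e5.
  have yL0 : yL = 0 by rewrite /yL e3 e5 mulr0 subr0.
  have yR0 : yR = 0 by rewrite /yR e4 e5 mulr0 addr0.
  rewrite e3 yL0 in fo1; rewrite e4 yR0 in fo2.
  by split; [exact: conj yL0 yR0|exact: conj fo1 fo2|exact: rev|exact: gl|exact: non].
- move=> C; have bc : case_b \/ case_c by right.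
  have [rev non] := reversible_bc bc; have [fo1 fo2] := foci_bc bc.
  have [e1 e2 e3 e4 e5] := bcE bc.
  have yE : yL = yR by rewrite /yL /yR e4 e1 e5; ring.
  have eL : fL (xL, yL) = 0 by case: fo1.
  have eR : fR (xR, yR) = 0 by case: fo2.
  split.
  + split=> //; rewrite /yR e5 addr0; case: C => _ _ _ xR0 _.
    by apply/eqP/mulf_neq0; [apply: mulf_neq0; [rewrite pnatr_eq0|exact/eqP]|exact/eqP].
  + by split=> /andP[h1 h2]; split; split.
  + by split=> //; exact: annulus_bc.
  + move=> [_ [_ x0]]; have {}x0 : 0 < xR := x0.
    have annulusE : period_annulus_at_infinity fL fR = outer_region gammaR alphaR.
      rewrite /fL /fR e1 e3 e5 oppr0; exact: period_annulus_outer.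
    (* The two foci are mirror images, so both fold onto the right one, which is the spiral of size
       0. *)
    have folds p : p = (xL, yL) \/ p = (xR, yR) -> fold_x p = (xR, yR).
      by rewrite yE e4 => -[->|->]; rewrite /fold_x /= ?normrN gtr0_norm.
    have centre : (xR, yR) = spiral_curve gammaR xR 0 0.
      by rewrite /spiral_curve /yR e5; congr pair; ring.
    split; first by rewrite /F /fL /fR e1 e3 e5 oppr0; exact: real_foci_not_global.
    exists (heart gammaR alphaR); split.
    * split; rewrite /F /fL /fR e1 e3 e5 oppr0; first exact: heart_pseudo_saddle.
      exact: heart_homoclinic.
    * exact: heart_is_heart_shaped.
    * by split=> //; apply: focus_inside => //; rewrite folds //; [left|right].
    * by rewrite annulusE; exact: outer_region_outside.
    * by rewrite annulusE; exact: heart_boundary.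
  + move=> [_ [_ x0]]; apply: global_bc => //; exact: ltW.
Qed.
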